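(* Let assumptions (H1)-(H3) listed in the context hold and let $u^*\in\mathcal{U}$ be an optimal control with state process $\{X_k^*\}$. Then there exists a $P^*\in\mathcal{P}^*$ such that $$\inf_{u\in\mathcal{U}}E_{P^*}[\Theta^u]\ge0.$$
   Context: Noise. Let $\Omega$ be a sample space, $N$ a positive integer, $W_k=(W_k^1,\ldots,W_k^d)^T:\Omega\to\mathbb{R}^d$, $k=1,\ldots,N$, given functions, $W=(W_1,\ldots,W_N)$, $\mathcal{F}_k=\sigma\{W_1,\ldots,W_k\}$, $\mathcal{F}_0=\{\emptyset,\Omega\}$. $C_{b,Lip}$ denotes bounded Lipschitz functions and $Lip(\mathcal{F}_k)=\{\phi(W_1,\ldots,W_k):\phi\in C_{b,Lip}(\mathbb{R}^{d\times k})\}$. Let $\{F_\theta:\theta\in\Theta\}$ be a family of probability measures on $\mathbb{R}^d$. Define $\hat{\mathbb{E}}[\varphi(W_k)]=\sup_{\theta\in\Theta}\int\varphi\,dF_\theta$ for $\varphi\in C_{b,Lip}(\mathbb{R}^d)$, and for $\phi\in C_{b,Lip}(\mathbb{R}^{d\times N})$ set $\phi_N=\phi$, $\phi_k(x_1,\ldots,x_k)=\hat{\mathbb{E}}[\phi_{k+1}(x_1,\ldots,x_k,W_{k+1})]$ for $k=N-1,\ldots,1$, and $\hat{\mathbb{E}}[\phi(W_1,\ldots,W_N)]=\hat{\mathbb{E}}[\phi_1(W_1)]$. Standing assumptions: (A1) $W(\Omega)=A_1\times\cdots\times A_N$ with $A_k=W_k(\Omega)$ and $F_\theta(\bar A_k)=1$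 for all $\theta,k$ ($\bar A_k$ the closure of $A_k$); (A2) $\sup_\theta\int|x|F_\theta(dx)<\infty$; (A3) for each $Q\in\mathcal{A}$ there is a probability measure $P$ on $(\Omega,\mathcal{F}_N)$ with $Q=P\circ W^{-1}$, where $\mathcal{A}$ is the set of probability measures $Q$ on $\mathbb{R}^{d\times N}$ with $E_Q[\phi]\le\hat{\mathbb{E}}[\phi(W)]$ for all $\phi\in C_{b,Lip}(\mathbb{R}^{d\times N})$. Let $\mathcal{P}$ be the set of probability measures $P$ on $(\Omega,\mathcal{F}_N)$ with $E_P[\phi(W)]\le\hat{\mathbb{E}}[\phi(W)]$ for all $\phi\in C_{b,Lip}(\mathbb{R}^{d\times N})$. A set $B\in\mathcal{F}_N$ is polar if $\sup_{P\in\mathcal{P}}P(B)=0$; random variables equal outside a polar set are identified. $\hat{\mathbb{E}}$ is extended by $\hat{\mathbb{E}}[X]=\sup_{P\in\mathcal{P}}E_P[X]$ to all $\mathcal{F}_N$-measurable $X$ with $\sup_{P\in\mathcal{P}}E_P[|X|]<\infty$. $L_c^p(\mathcal{F}_k)$ is the completion of $Lip(\mathcal{F}_k)$ under $\|X\|_p=(\hat{\mathbb{E}}[|X|^p])^{1/p}$ (a closed subspace of the $\mathcal{F}_k$-measurable $X$ with $\hat{\mathbb{E}}[|X|^p]<\infty$), and $L_c^p(\mathcal{F}_0)=\mathbb{R}$. For vector-valued $Z$, ''$|Z|\in L_c^2(\mathcal{F}_k)$'' means that all components of $Z$ lie in $L_c^2(\mathcal{F}_k)$. Standing assumption: $|W_k|\in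 L_c^2(\mathcal{F}_k)$ for $k=1,\ldots,N$. Control problem. $U_k\subset\mathbb{R}^m$, $k=0,\ldots,N-1$, are nonempty convex sets; $\mathcal{U}$ is the set of admissible controls $u=\{u_k\}_{k=0}^{N-1}$ with $u_k:\Omega\to U_k$ and $|u_k|\in L_c^2(\mathcal{F}_k)$. The coefficients are $b(k,\cdot),\sigma^l(k,\cdot):\mathbb{R}^n\times U_k\times\Omega\to\mathbb{R}^n$, $f(k,\cdot):\mathbb{R}^n\times U_k\times\Omega\to\mathbb{R}$, $\varphi:\mathbb{R}^n\times\Omega\to\mathbb{R}$ ($l=1,\ldots,d$, $k=0,\ldots,N-1$), with $b,\sigma^l,f$ differentiable in $(x,u)$ and $\varphi$ differentiable in $x$; the argument $\omega$ is suppressed. The state process of $u\in\mathcal{U}$ is the solution of $X_{k+1}=b(k,X_k,u_k)+\sum_{l=1}^d\sigma^l(k,X_k,u_k)W_{k+1}^l$, $X_0=x_0\in\mathbb{R}^n$, $k=0,\ldots,N-1$, and the cost is $J(u)=\hat{\mathbb{E}}[\sum_{k=0}^{N-1}f(k,X_k,u_k)+\varphi(X_N)]$. A control $u^*\in\mathcal{U}$ is optimal if it minimizes $J$ over $\mathcal{U}$. (H1) $|b(k,x,u)|,|\sigma^l(k,x,u)|\in L_c^2(\mathcal{F}_k)$, $f(k,x,u)\in L_c^1(\mathcal{F}_k)$, $\varphi(x)\in L_c^1(\mathcal{F}_N)$ for all $x\in\mathbb{R}^n$, $u\in U_k$, $l$, $k$. (H2) There is $L>0$ with $|b_x(k,x,u)|+|b_u(k,x,u)|+|\sigma^l_x(k,x,u)|+|\sigma^l_u(k,x,u)|\le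 L$ and $|f_x(k,x,u)|+|f_u(k,x,u)|+|\varphi_x(x)|\le L(1+|x|+|u|)$ for all $x\in\mathbb{R}^n$, $u\in U_k$, $l$, $k$. (H3) For each $\alpha>0$ there is a modulus of continuity $\omega_\alpha:[0,\infty)\to[0,\infty)$ (nondecreasing, $\omega_\alpha(r)\to\omega_\alpha(0)=0$ as $r\downarrow0$) such that for all $x,x'\in\mathbb{R}^n$ with $|x|,|x'|\le\alpha$ and $u,u'\in U_k$ with $|u|,|u'|\le\alpha$, $|\phi(k,x,u)-\phi(k,x',u')|+|\varphi_x(x)-\varphi_x(x')|\le\omega_\alpha(|x-x'|+|u-u'|)$, where $\phi(k,\cdot,\cdot)$ is the derivative in $(x,u)$ of any of $b(k,\cdot,\cdot)$, $\sigma^l(k,\cdot,\cdot)$, $f(k,\cdot,\cdot)$. Variational objects. $b_x$ is the Jacobian matrix $(\partial b_i/\partial x_j)$, similarly $b_u,\sigma_x^l,\sigma_u^l$; $f_x,f_u,\varphi_x$ are row vectors. Write $b_x(k)=b_x(k,X_k^*,u_k^* )$ and similarly $b_u(k),\sigma_x^l(k),\sigma_u^l(k),f_x(k),f_u(k)$. Given $u\in\mathcal{U}$, $\{\hat X_k\}$ is the solution of $\hat X_0=0$, $$\hat X_{k+1}=b_x(k)\hat X_k+b_u(k)(u_k-u_k^* )+\sum_{l=1}^d\big[\sigma_x^l(k)\hat X_k+\sigma_u^l(k)(u_k-u_k^* )\big]W_{k+1}^l,\quad k=0,\ldots,N-1,$$ and $$\Theta^u=\sum_{k=0}^{N-1}\big[f_x(k)\hat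 X_k+f_u(k)(u_k-u_k^* )\big]+\varphi_x(X_N^* )\hat X_N.$$ Finally $\mathcal{P}^*=\{P\in\mathcal{P}:E_P[\sum_{k=0}^{N-1}f(k,X_k^*,u_k^* )+\varphi(X_N^* )]=\hat{\mathbb{E}}[\sum_{k=0}^{N-1}f(k,X_k^*,u_k^* )+\varphi(X_N^* )]\}$. *)

(* Defs.v *)
From HB Require Import structures.
From mathcomp Require Import all_boot all_order all_algebra.
From mathcomp Require Import all_classical all_reals all_analysis.

Set Implicit Arguments.
Unset Strict Implicit.
Unset Printing Implicit Defensive.

Import Order.TTheory GRing.Theory Num.Theory.
Import numFieldNormedType.Exports.

Local Open Scope classical_set_scope.
Local Open Scope ring_scope.

(* Conventions.  Vectors are columns; [`|x|] is the library (maximum) norm on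
   matrices, which is equivalent to the Euclidean one: every condition below is
   insensitive to that choice.  Time-indexed families are functions on [nat], of
   which only the indices named in the hypotheses ([k < N], or [1 <= k <= N] for
   the noise) are ever used. *)

(* R^(p x q) with its Borel sigma-algebra. *)
Definition borelM (R : realType) (p q : nat) :=
  g_sigma_algebraType (@open 'M[R]_(p, q)).

Section Noise.
Context {R : realType} {Omega : pointedType} {d : nat} {Theta : Type}.

Definition Cblip k (phi : 'M[R]_(d, k) -> R) : Prop :=
  bounded_fun phi /\ [lipschitz phi x | x in setT].

(* (x_1, ..., x_k), y |-> (x_1, ..., x_k, y) *)
Definition snoc k (x : 'M[R]_(d, k)) (y : 'cV[R]_d) : 'M[R]_(d, k.+1) :=
  \matrix_(i, j) (if unlift ord_max j is Some j' then x i j' else y i 0).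

Variables (W : nat -> Omega -> 'cV[R]_d) (F : Theta -> probability (borelM R d 1) R).

(* (W_1, ..., W_k) *)
Definition Wpath k (w : Omega) : 'M[R]_(d, k) := \matrix_(i, j) W j.+1 w i 0.

Definition filtration_gen k : set (set Omega) :=
  [set W j @^-1` B | j in [set j | 1 <= j <= k]%N &
                     B in @measurable _ (borelM R d 1)].

(* The measurable space (Omega, F_k); <<s set0>> is the trivial one for k = 0. *)
Definition OmegaF k := g_sigma_algebraType (filtration_gen k).

(* E^[phi(W_1, ..., W_k)]; the argument of the recursive call is phi_(k-1). *)
Fixpoint Elip k : ('M[R]_(d, k) -> R) -> R :=
  match k with
  | 0%N => fun phi => phi 0
  | k'.+1 => fun phi => Elip (fun x =>
      sup [set (\int[F th]_y phi (snoc x y))%R | th in [set: Theta]])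
  end.

Variable N : nat.

Definition calA : set (probability (borelM R d N) R) :=
  [set Q | forall phi, Cblip phi ->
     ('E_Q[(phi : borelM R d N -> R)] <= (Elip phi)%:E)%E].

Definition calP : set (probability (OmegaF N) R) :=
  [set P | forall phi, Cblip phi ->
     ('E_P[(fun w : OmegaF N => phi (Wpath N w))] <= (Elip phi)%:E)%E].

Definition A1 : Prop :=
  range (Wpath N) =
    [set x | forall k : 'I_N, range (W k.+1) (col k x)] /\
  (forall th k, (1 <= k <= N)%N -> F th (closure (range (W k))) = 1%E).

Definition A2 : Prop :=
  (ereal_sup [set \int[F th]_x (`|(x : 'cV[R]_d)|)%:E | th in [set: Theta]]
     < +oo)%E.

Definition A3 : Prop :=
  forall Q, calA Q -> exists P : probability (OmegaF N) R,
    forall B, measurable B -> Q B = P (Wpath N @^-1` B).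

Definition polar (B : set (OmegaF N)) : Prop :=
  measurable B /\ ereal_sup [set P B | P in calP] = 0%E.

Definition qs_eq (X Y : Omega -> R) : Prop :=
  exists2 B, polar B & forall w, ~ B w -> X w = Y w.

Definition Ehat (X : Omega -> R) : \bar R :=
  (ereal_sup [set 'E_P[(X : OmegaF N -> R)] | P in calP])%E.

Definition normp (p : nat) (X : Omega -> R) : \bar R :=
  (Ehat (fun w => `|X w| ^+ p)%R `^ (p%:R^-1))%E.

(* L_c^p(F_k).  The completion of Lip(F_k) is realized as its closure in the
   F_k-measurable Y with E^[|Y|^p] finite; as random variables are identified
   when they agree outside a polar set, an F_N-measurable X belongs to the space
   as soon as it has a version Y there.  For k = 0 such a Y is a constant. *)
Definition Lc (p k : nat) (X : Omega -> R) : Prop :=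
  measurable_fun [set: OmegaF N] X /\
  exists Y : Omega -> R,
    [/\ measurable_fun [set: OmegaF k] Y,
        (Ehat (fun w => `|Y w| ^+ p)%R < +oo)%E,
        forall e : R, 0 < e -> exists2 phi, Cblip phi &
          (normp p (fun w => Y w - phi (Wpath k w))%R < e%:E)%E
      & qs_eq X Y].

Definition Lc_vec (p k q : nat) (Z : Omega -> 'cV[R]_q) : Prop :=
  forall i, Lc p k (fun w => Z w i 0).

Definition noise_Lc2 : Prop :=
  forall k, (1 <= k <= N)%N -> Lc_vec 2 k (W k).

End Noise.

Arguments calP {R Omega d Theta} W F N _.

Section Control.
Context {R : realType} {Omega : pointedType} {d n m : nat} {Theta : Type}.
Variables (W : nat -> Omega -> 'cV[R]_d) (F : Theta -> probability (borelM R d 1) R).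
Variable N : nat.
Variable U : nat -> set 'cV[R]_m.
Variable x0 : 'cV[R]_n.
Variables (b : nat -> 'cV[R]_n -> 'cV[R]_m -> Omega -> 'cV[R]_n)
  (sigma : nat -> 'I_d -> 'cV[R]_n -> 'cV[R]_m -> Omega -> 'cV[R]_n)
  (f : nat -> 'cV[R]_n -> 'cV[R]_m -> Omega -> R)
  (varphi : 'cV[R]_n -> Omega -> R).
(* Derivatives of the coefficients: in (x, u) for b, sigma, f, the two partial
   Jacobians being the left n and the right m columns; in x for varphi. *)
Variables (Db : nat -> 'cV[R]_n -> 'cV[R]_m -> Omega -> 'M[R]_(n, n + m))
  (Dsigma : nat -> 'I_d -> 'cV[R]_n -> 'cV[R]_m -> Omega -> 'M[R]_(n, n + m))
  (Df : nat -> 'cV[R]_n -> 'cV[R]_m -> Omega -> 'rV[R]_(n + m))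
  (Dvarphi : 'cV[R]_n -> Omega -> 'rV[R]_n).

Definition control_sets : Prop :=
  forall k, (k < N)%N -> U k !=set0 /\
    convex_set (U k : set (convex_lmodType 'cV[R]_m)).

Definition admissible (u : nat -> Omega -> 'cV[R]_m) : Prop :=
  forall k, (k < N)%N -> (forall w, U k (u k w)) /\ Lc_vec W F N 2 k (u k).

(* A is a (Frechet) derivative at z0 of G restricted to D.  The increments stay
   in D because the coefficients are only given for u in U_k, which need not be
   open. *)
Definition is_jacobian p q (D : set 'cV[R]_q) (G : 'cV[R]_q -> 'cV[R]_p)
    (z0 : 'cV[R]_q) (A : 'M[R]_(p, q)) : Prop :=
  forall e : R, 0 < e -> \forall z \near within D (nbhs z0),
    `|G z - G z0 - A *m (z - z0)| <= e * `|z - z0|.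

Definition is_jacobian_xu p k (G : 'cV[R]_n -> 'cV[R]_m -> 'cV[R]_p)
    (x : 'cV[R]_n) (u : 'cV[R]_m) (A : 'M[R]_(p, n + m)) : Prop :=
  is_jacobian [set z : 'cV[R]_(n + m) | U k (dsubmx z)]
    (fun z => G (usubmx z) (dsubmx z)) (col_mx x u) A.

Definition coef_derivatives : Prop :=
  (forall w k x u, (k < N)%N -> U k u ->
    [/\ is_jacobian_xu k (fun x u => b k x u w) x u (Db k x u w),
        forall l, is_jacobian_xu k (fun x u => sigma k l x u w) x u
                    (Dsigma k l x u w)
      & is_jacobian_xu k (fun x u => (f k x u w)%:M) x u (Df k x u w)]) /\
  (forall w x,
    is_jacobian setT (fun x => (varphi x w)%:M) x (Dvarphi x w)).

Definition H1 : Prop :=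
  (forall k x u, (k < N)%N -> U k u ->
    [/\ Lc_vec W F N 2 k (b k x u),
        forall l, Lc_vec W F N 2 k (sigma k l x u)
      & Lc W F N 1 k (f k x u)]) /\
  (forall x, Lc W F N 1 N (varphi x)).

Definition H2 : Prop :=
  exists2 L : R, 0 < L &
    forall w k x u (l : 'I_d), (k < N)%N -> U k u ->
      `|lsubmx (Db k x u w)| + `|rsubmx (Db k x u w)| +
      `|lsubmx (Dsigma k l x u w)| + `|rsubmx (Dsigma k l x u w)| <= L /\
      `|lsubmx (Df k x u w)| + `|rsubmx (Df k x u w)| + `|Dvarphi x w|
        <= L * (1 + `|x| + `|u|).

Definition modulus (om : R -> R) : Prop :=
  [/\ forall r : R, 0 <= r -> 0 <= om r,
      forall r s : R, 0 <= r -> r <= s -> om r <= om s,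
      om 0 = 0
    & om r @[r --> 0^'+] --> 0].

Definition H3 : Prop :=
  forall alpha : R, 0 < alpha -> exists2 om, modulus om &
    forall w k x x' u u', (k < N)%N -> U k u -> U k u' ->
      `|x| <= alpha -> `|x'| <= alpha -> `|u| <= alpha -> `|u'| <= alpha ->
      let dphi := `|Dvarphi x w - Dvarphi x' w| in
      let bound := om (`|x - x'| + `|u - u'|) in
      [/\ `|Db k x u w - Db k x' u' w| + dphi <= bound,
          forall l, `|Dsigma k l x u w - Dsigma k l x' u' w| + dphi <= bound
        & `|Df k x u w - Df k x' u' w| + dphi <= bound].

Fixpoint state (u : nat -> Omega -> 'cV[R]_m) k (w : Omega) : 'cV[R]_n :=
  if k is j.+1 then
    let x := state u j w in
    b j x (u j w) w + \sum_(l < d) W j.+1 w l 0 *: sigma j l x (u j w) w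
  else x0.

Definition cost u (w : Omega) : R :=
  \sum_(k < N) f k (state u k w) (u k w) w + varphi (state u N w) w.

Definition J u : \bar R := Ehat W F N (cost u).

Definition optimal ustar : Prop :=
  admissible ustar /\ forall u, admissible u -> (J ustar <= J u)%E.

Definition calPstar ustar : set (probability (OmegaF W N) R) :=
  [set P | calP W F N P /\
     ('E_P[(cost ustar : OmegaF W N -> R)] = Ehat W F N (cost ustar))%E].

Section Variation.
Variables ustar u : nat -> Omega -> 'cV[R]_m.

Definition along T (D : nat -> 'cV[R]_n -> 'cV[R]_m -> Omega -> T) k w : T :=
  D k (state ustar k w) (ustar k w) w.

Fixpoint var_state k (w : Omega) : 'cV[R]_n :=
  if k is j.+1 then
    let x := var_state j w in
    let v := u j w - ustar j w in
    lsubmx (along Db j w) *m x + rsubmx (along Db j w) *m v +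
    \sum_(l < d) W j.+1 w l 0 *:
      (lsubmx (along (Dsigma ^~ l) j w) *m x +
       rsubmx (along (Dsigma ^~ l) j w) *m v)
  else 0.

Definition var_cost (w : Omega) : R :=
  \sum_(k < N) (lsubmx (along Df k w) *m var_state k w +
                rsubmx (along Df k w) *m (u k w - ustar k w)) 0 0 +
  (Dvarphi (state ustar N w) w *m var_state N w) 0 0.

End Variation.
End Control.

Arguments calPstar {R Omega d n m Theta} W F N x0 b sigma f varphi ustar _.

(* Main.v *)
(* On L_c^1(F_N) the upper expectation E = sup over calP of E_P is sublinear.
   Write Y for the optimal cost and Theta^u for its variation in the direction of u.
   The cost is differentiable in the mean along the segment of controls from the
   optimal one to u, and tau |-> E (Y + tau Theta^u) is convex, so optimality gives
   E Y <= E (Y + tau Theta^u) for every tau >= 0.  Since Theta^u is affine in u,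
   the constraints "l (s Y + tau Theta^u) >= s E Y" (s, tau >= 0) are indexed by a
   convex cone, so that Hahn-Banach yields a linear l <= E which satisfies them all:
   l Y = E Y and l Theta^u >= 0 for every u.  This replaces the minimax theorem.
   Under (A2) the functional l is tight, hence by Riesz it is the expectation under
   a probability measure on the path space, which (A3) carries back to Omega. *)

(* A minimax argument would need compactness of [calP]. Here attainment of the supremum and the sign
   of every Theta^u are constraints on one functional, which is why s and tau vary independently:
   (s, tau) = (1, 0) encodes the former, (0, 1) the latter. Sums stay in the cone because the U_k
   are convex: two controls are averaged with weights proportional to their tau. The analytic
   obstacle is that the coefficients are random and known to lie in L_c^p only for frozen arguments,
   while dominated convergence fails in general for E. Substituting a random argument Z is therefore
   done by infimal convolutions over finite nets, which involve only minima, sums and frozen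
   coefficients. Limits are controlled uniformly in P by a bounded Lipschitz approximant of the
   dominating function. The growth conditions are such that the dominating function is always the
   square of an element of L_c^2, for the state and the cost alike. Multiplication by W_(k+1)
   preserves L_c^2 thanks to the independence built into the iterated definition of E. *)
Require Import Defs.
From HB Require Import structures.
From mathcomp Require Import all_boot all_order all_algebra.
From mathcomp Require Import all_classical all_reals all_analysis.
From mathcomp Require Import measurable_realfun ring lra.
Set Implicit Arguments.
Unset Strict Implicit.
Unset Printing Implicit Defensive.
Import Order.TTheory GRing.Theory Num.Theory.
Import numFieldNormedType.Exports.
Local Open Scope classical_set_scope.
Local Open Scope ring_scope.

(** * Linear minorants under a cone of constraints *)

Section HahnBanach.
Context {R : realType} {V : lmodType R}.

(** Subspaces are predicates on an ambient space: the functionals used later are total on all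
    functions, but sublinear only on the bounded Lipschitz or the integrable ones. *)
Definition linear_set (S : set V) : Prop :=
  S 0 /\ forall a x y, S x -> S y -> S (a *: x + y).

Definition sublinear_on (S : set V) (p : V -> R) : Prop :=
  (forall x y, S x -> S y -> p (x + y) <= p x + p y) /\
  (forall a x, S x -> 0 <= a -> p (a *: x) = a * p x).

Definition linear_on (S : set V) (l : V -> R) : Prop :=
  forall a x y, S x -> S y -> l (a *: x + y) = a * l x + l y.

Lemma linear_setZ S a x : linear_set S -> S x -> S (a *: x).
Proof. by move=> [S0 SD] Sx; have := SD a x 0 Sx S0; rewrite addr0. Qed.

Lemma linear_setD S x y : linear_set S -> S x -> S y -> S (x + y).
Proof. by move=> [S0 SD] Sx Sy; have := SD 1 x y Sx Sy; rewrite scale1r. Qed.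

Lemma linear_setN S x : linear_set S -> S x -> S (- x).
Proof. by move=> hS Sx; rewrite -scaleN1r; exact: linear_setZ. Qed.

Lemma sublinear_on0 S p : linear_set S -> sublinear_on S p -> p 0 = 0.
Proof.
by move=> [S0 _] [_ /(_ 0 0 S0 (lexx _))]; rewrite scale0r mul0r.
Qed.

Lemma sublinear_onN S p x : linear_set S -> sublinear_on S p -> S x ->
  - p (- x) <= p x.
Proof.
move=> hS hp Sx; rewrite -subr_ge0 opprK.
have := hp.1 x (- x) Sx (linear_setN hS Sx).
by rewrite subrr (sublinear_on0 hS hp).
Qed.

(* For minimal p, the sublinear functional inf_(t >= 0) p (x + t y) - t p y
   lies below p, hence equals p; at t = 1 this is superadditivity of p. *)
Theorem hahn_banach_sublinear (S : set V) (q : V -> R) :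
  linear_set S -> sublinear_on S q ->
  exists l, linear_on S l /\ forall x, S x -> l x <= q x.
Proof.
move=> hS hq.
have S0 := hS.1.
pose T := {p : V -> R | sublinear_on S p /\ forall x, S x -> p x <= q x}.
(* Values off [S] are not compared, so this is only a preorder; a maximal element for [Rel] is a
   pointwise minimal functional. *)
pose Rel (p p' : T) := `[< forall x, S x -> sval p' x <= sval p x >].
pose q0 : T := exist _ q (conj hq (fun x _ => lexx (q x))).
have [||A Atot|[p [hp pq]] pmin] := @ZL_preorder T q0 Rel.
- by move=> t; apply/asboolP => x _.
- move=> r s t /asboolP h1 /asboolP h2; apply/asboolP => x Sx.
  exact: le_trans (h2 x Sx) (h1 x Sx).
- have [[p0 Ap0]|nA] := pselect (exists p, A p); last first.
    by exists q0 => s As; exfalso; apply: nA; exists s.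
  pose E x := [set sval p x | p in A].
  (* -q(-x) is a common lower bound of all candidates, so the infimum along a chain is finite. *)
  have lbE x p : S x -> A p -> - q (- x) <= sval p x.
    move=> Sx _; case: p => p [/= hp pq].
    apply: le_trans (sublinear_onN hS hp Sx).
    by rewrite lerN2 pq//; exact: linear_setN.
  have hasE x : S x -> has_inf (E x).
    move=> Sx; split; first by exists (sval p0 x), p0.
    by exists (- q (- x)) => _ [p Ap <-]; exact: lbE.
  have infE x p : S x -> A p -> inf (E x) <= sval p x.
    by move=> Sx Ap; apply: ge_inf; [exact: (hasE x Sx).2|exists p].
  pose t x := inf (E x).
  have tsub : sublinear_on S t.
    split.
    + move=> x y Sx Sy; rewrite /t -lerBlDr. apply: lb_le_inf.
        exact: (hasE x Sx).1.
      move=> _ [p1 Ap1 <-]; rewrite lerBlDr -lerBlDl.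
      apply: lb_le_inf; first exact: (hasE y Sy).1.
      move=> _ [p2 Ap2 <-]; rewrite lerBlDl.
      have Sxy := linear_setD hS Sx Sy.
      (* By totality of the chain, the smaller of the two functionals bounds both terms from below,
         and its subadditivity suffices. *)
      case: (Atot _ _ Ap1 Ap2) => /asboolP le12.
        apply: le_trans (infE _ _ Sxy Ap2) _.
        apply: le_trans ((svalP p2).1.1 _ _ Sx Sy) _.
        by rewrite lerD2r le12.
      apply: le_trans (infE _ _ Sxy Ap1) _.
      apply: le_trans ((svalP p1).1.1 _ _ Sx Sy) _.
      by rewrite lerD2l le12.
    + move=> a x Sx; rewrite le_eqVlt => /predU1P[<-|a0].
        rewrite scale0r mul0r /t (_ : E 0 = [set 0]) ?inf1//.
        apply/seteqP; split => [_ [p Ap <-]|_ ->].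
          by rewrite (sublinear_on0 hS (svalP p).1).
        by exists p0 => //; rewrite (sublinear_on0 hS (svalP p0).1).
      have Sax := linear_setZ a hS Sx.
      apply/eqP; rewrite eq_le; apply/andP; split.
        rewrite mulrC -ler_pdivrMr//; apply: lb_le_inf.
          exact: (hasE x Sx).1.
        move=> _ [p1 Ap1 <-]; rewrite ler_pdivrMr// mulrC.
        by rewrite -((svalP p1).1.2 _ _ Sx (ltW a0)); exact: infE.
      apply: lb_le_inf; first exact: (hasE _ Sax).1.
      move=> _ [p1 Ap1 <-]; rewrite ((svalP p1).1.2 _ _ Sx (ltW a0)).
      by rewrite ler_pM2l//; exact: infE.
  have tq x : S x -> t x <= q x.
    by move=> Sx; exact: le_trans (infE _ _ Sx Ap0) ((svalP p0).2 x Sx).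
  by exists (exist _ t (conj tsub tq)) => s As; apply/asboolP => x Sx; exact: infE.
have super y x : S x -> S y -> p x + p y <= p (x + y).
  move=> Sx Sy.
  pose E x := [set p (x + r *: y) - r * p y | r in [set r : R | 0 <= r]].
  have lbE z r : S z -> 0 <= r -> - p (- z) <= p (z + r *: y) - r * p y.
    move=> Sz r0; rewrite lerBrDr -(hp.2 _ _ Sy r0) addrC lerBlDr.
    rewrite -[in leLHS](addKr z (r *: y)) addrC.
    apply: le_trans (hp.1 _ _ _ _) _ => //.
    - by apply: linear_setD => //; apply: linear_setZ.
    - exact: linear_setN.
  have hasE z : S z -> has_inf (E z).
    move=> Sz; split; first by exists (p (z + 0 *: y) - 0 * p y), 0 => //=.
    by exists (- p (- z)) => _ [r r0 <-]; exact: lbE.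
  have infE z r : S z -> 0 <= r -> inf (E z) <= p (z + r *: y) - r * p y.
    by move=> Sz r0; apply: ge_inf; [exact: (hasE z Sz).2|exists r].
  pose t z := inf (E z).
  have tsub : sublinear_on S t.
    split.
    + move=> z z' Sz Sz'; rewrite /t -lerBlDr; apply: lb_le_inf.
        exact: (hasE z Sz).1.
      move=> _ [r1 r10 <-]; rewrite lerBlDr -lerBlDl.
      apply: lb_le_inf; first exact: (hasE z' Sz').1.
      move=> _ [r2 r20 <-]; rewrite lerBlDl.
      apply: le_trans (infE _ (r1 + r2) (linear_setD hS Sz Sz') (addr_ge0 r10 r20)) _.
      rewrite scalerDl addrACA mulrDl opprD.
      rewrite [leRHS]addrACA lerD2r.
      by apply: hp.1; apply: linear_setD => //; apply: linear_setZ.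
    + move=> a z Sz; rewrite le_eqVlt => /predU1P[<-|a0].
        rewrite scale0r mul0r; apply/eqP; rewrite eq_le; apply/andP; split.
          have := infE 0 0 S0 (lexx _).
          by rewrite scale0r mul0r subr0 addr0 (sublinear_on0 hS hp).
        apply: lb_le_inf; first exact: (hasE 0 S0).1.
        by move=> _ [r r0 <-]; rewrite add0r (hp.2 _ _ Sy r0) subrr.
      have Saz := linear_setZ a hS Sz.
      have aE r : p (a *: z + r *: y) - r * p y =
          a * (p (z + (r / a) *: y) - (r / a) * p y).
        have Szr := linear_setD hS Sz (linear_setZ (r / a) hS Sy).
        rewrite mulrBr mulrA -(hp.2 _ _ Szr (ltW a0)) scalerDr scalerA.
        by rewrite [a * (r / a)]mulrC mulfVK ?gt_eqF.
      apply/eqP; rewrite eq_le; apply/andP; split.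
        rewrite mulrC -ler_pdivrMr//; apply: lb_le_inf.
          exact: (hasE z Sz).1.
        move=> _ [r r0 <-]; rewrite ler_pdivrMr//.
        apply: le_trans (infE _ (r * a) Saz (mulr_ge0 r0 (ltW a0))) _.
        by rewrite aE mulfK ?gt_eqF// mulrC.
      apply: lb_le_inf; first exact: (hasE _ Saz).1.
      move=> _ [r r0 <-]; rewrite aE ler_pM2l//; apply: infE => //.
      by rewrite divr_ge0// ltW.
  have tp z : S z -> t z <= p z.
    move=> Sz; apply: le_trans (infE _ _ Sz (lexx 0)) _.
    by rewrite scale0r mul0r subr0 addr0.
  have tq z : S z -> t z <= q z.
    by move=> Sz; exact: le_trans (tp z Sz) (pq z Sz).
  have := pmin (exist _ t (conj tsub tq)).
  rewrite /Rel /= => /(_ (asboolT tp))/asboolP/(_ x Sx)/le_trans.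
  move=> /(_ _ (infE _ 1 Sx ler01)).
  by rewrite scale1r mul1r lerBrDr.
exists p; split => // a x y Sx Sy.
have pD u v : S u -> S v -> p (u + v) = p u + p v.
  by move=> Su Sv; apply/eqP; rewrite eq_le super// andbT; exact: hp.1.
rewrite pD//; last exact: linear_setZ.
congr (_ + _); have [a0|a0] := leP 0 a; first exact: hp.2.
have Nx : p (- (a *: x)) = - (a * p x).
  by rewrite -scaleNr hp.2// ?oppr_ge0 ?ltW// mulNr.
have Sax := linear_setZ a hS Sx.
have := pD _ _ Sax (linear_setN hS Sax).
by rewrite subrr (sublinear_on0 hS hp) Nx => /esym/eqP; rewrite subr_eq0 => /eqP.
Qed.

(* Hahn-Banach applied to the sublinear functional inf_((c, r) in C) E (x + c) - r. *)
Theorem hahn_banach_cone (S : set V) (E : V -> R) (C : V -> R -> Prop) :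
  linear_set S -> sublinear_on S E ->
  (forall c r, C c r -> S c /\ r <= E c) -> C 0 0 ->
  (forall c r c' r', C c r -> C c' r' -> C (c + c') (r + r')) ->
  (forall a c r, 0 <= a -> C c r -> C (a *: c) (a * r)) ->
  exists l, [/\ linear_on S l, forall x, S x -> l x <= E x &
    forall c r, C c r -> r <= l c].
Proof.
move=> hS hE CE C0 CD CZ.
pose B x := [set y | exists c r, C c r /\ y = E (x + c) - r].
(* The requirement r <= E c is what bounds E (x + c) - r from below. *)
have lbB x y : S x -> B x y -> - E (- x) <= y.
  move=> Sx [c [r [Ccr ->]]]; have [Sc rE] := CE _ _ Ccr.
  rewrite lerBrDr (le_trans (lerD (lexx _) rE))// addrC lerBlDr.
  rewrite -[in leLHS](addKr x c) addrC; apply: hE.1; last exact: linear_setN.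
  exact: linear_setD.
have hasB x : S x -> has_inf (B x).
  move=> Sx; split; first by exists (E (x + 0) - 0), 0, 0.
  by exists (- E (- x)) => y; exact: lbB.
have infB x c r : S x -> C c r -> inf (B x) <= E (x + c) - r.
  by move=> Sx Ccr; apply: ge_inf; [exact: (hasB x Sx).2|exists c, r].
have qsub : sublinear_on S (fun x => inf (B x)).
  split.
  - move=> x y Sx Sy; rewrite -lerBlDr; apply: lb_le_inf.
      exact: (hasB x Sx).1.
    move=> _ [c1 [r1 [C1 ->]]]; rewrite lerBlDr -lerBlDl.
    apply: lb_le_inf; first exact: (hasB y Sy).1.
    move=> _ [c2 [r2 [C2 ->]]]; rewrite lerBlDl.
    apply: le_trans (infB _ _ _ (linear_setD hS Sx Sy) (CD _ _ _ _ C1 C2)) _.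
    rewrite addrACA opprD [leRHS]addrACA lerD2r.
    by apply: hE.1; apply: linear_setD => //; [exact: (CE _ _ C1).1|exact: (CE _ _ C2).1].
  - move=> a x Sx; rewrite le_eqVlt => /predU1P[<-|a0].
      rewrite scale0r mul0r; apply/eqP; rewrite eq_le; apply/andP; split.
        by have := infB _ _ _ hS.1 C0; rewrite addr0 subr0 (sublinear_on0 hS hE).
      apply: lb_le_inf; first exact: (hasB 0 hS.1).1.
      move=> _ [c [r [Ccr ->]]]; rewrite add0r subr_ge0; exact: (CE _ _ Ccr).2.
    have Sax := linear_setZ a hS Sx.
    have aE a' x' c r : S x' -> C c r -> 0 < a' ->
        E (a' *: x' + a' *: c) - a' * r = a' * (E (x' + c) - r).
      move=> Sx' Ccr a'0; rewrite -scalerDr hE.2 ?ltW// ?mulrBr//.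
      by apply: linear_setD => //; exact: (CE _ _ Ccr).1.
    apply/eqP; rewrite eq_le; apply/andP; split.
      rewrite mulrC -ler_pdivrMr//; apply: lb_le_inf; first exact: (hasB x Sx).1.
      move=> _ [c [r [Ccr ->]]]; rewrite ler_pdivrMr// mulrC -aE//.
      by apply: infB => //; apply: CZ => //; exact: ltW.
    apply: lb_le_inf; first exact: (hasB _ Sax).1.
    move=> _ [c [r [Ccr ->]]].
    have aV0 : 0 < a^-1 by rewrite invr_gt0.
    rewrite mulrC -ler_pdivlMr// mulrC -aE// scalerA mulVf ?gt_eqF// scale1r.
    by apply: infB => //; apply: CZ => //; exact: ltW.
have [l [llin lq]] := hahn_banach_sublinear hS qsub.
exists l; split => // [x Sx|c r Ccr].
  by apply: le_trans (lq _ Sx) _; have := infB _ _ _ Sx C0; rewrite addr0 subr0.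
have [Sc _] := CE _ _ Ccr.
(* Testing at -c with the pair (c, r) gives l (-c) <= E 0 - r = -r. *)
have := le_trans (lq _ (linear_setN hS Sc)) (infB _ _ _ (linear_setN hS Sc) Ccr).
rewrite addNr (sublinear_on0 hS hE) sub0r.
have -> : l (- c) = - l c; last by rewrite lerN2.
(* With both arguments equal to c, the coefficient -2 yields l (-c) without computing l 0 first. *)
have := llin (-2) c c Sc Sc.
by rewrite -{2}[c]scale1r -scalerDl (_ : -2 + 1 = -1)//; [rewrite scaleN1r => ->; ring|ring].
Qed.

End HahnBanach.

(** * The max norm and Borel sets of matrices *)

Section MatrixNorm.
Context {R : realType}.

Lemma mx_norm_leP p q (A : 'M[R]_(p, q)) (c : R) : 0 <= c ->
  reflect (forall i j, `|A i j| <= c) (`|A| <= c).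
Proof.
move=> c0; rewrite (_ : `|A| = mx_norm A)// mx_normrE; apply: (iffP idP).
  by move=> /bigmax_leP[_ h] i j; exact: (h (i, j)).
by move=> h; apply/bigmax_leP; split => // -[i j] _; exact: h.
Qed.

Lemma ler_entry_norm p q (A : 'M[R]_(p, q)) i j : `|A i j| <= `|A|.
Proof. by move: i j; apply/mx_norm_leP. Qed.

Lemma ler_norm_mulmx p (A : 'rV[R]_p) (v : 'cV[R]_p) :
  `|(A *m v) 0 0| <= p%:R * (`|A| * `|v|).
Proof.
rewrite mxE (le_trans (ler_norm_sum _ _ _))//.
apply: le_trans (_ : \sum_(i < p) `|A| * `|v| <= _).
  by apply: ler_sum => i _; rewrite normrM ler_pM// ler_entry_norm.
by rewrite sumr_const card_ord mulr_natl.
Qed.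

(** Heine-Borel is carried over from row vectors along [vec_mx], which preserves the maximum
    norm. *)
Lemma closed_ball_compact_mx p q (r : R) : compact [set x : 'M[R]_(p, q) | `|x| <= r].
Proof.
have [r0|r0] := ltP r 0.
  rewrite (_ : mkset _ = set0); first exact: compact0.
  by apply/seteqP; split => // x /= xr; have := le_lt_trans xr r0; rewrite normr_lt0.
have vecE (v : 'rV[R]_(p * q)) : `|vec_mx v| <= `|v|.
  by apply/mx_norm_leP => // i j; rewrite mxE ler_entry_norm.
have mxE' (A : 'M[R]_(p, q)) : `|mxvec A| <= `|A|.
  apply/mx_norm_leP => // i j; rewrite ord1.
  by case/mxvec_indexP: j => i' j'; rewrite mxvecE ler_entry_norm.
rewrite (_ : mkset _ = vec_mx @` [set v : 'rV[R]_(p * q) | `|v| <= r]); last first.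
  apply/seteqP; split => [x xr|_ [v vr <-]] /=; last exact: le_trans (vecE v) vr.
  by exists (mxvec x); [exact: le_trans (mxE' x) xr|exact: mxvecK].
apply: continuous_compact.
  apply: continuous_subspaceT => v P /nbhs_ballP[e /= e0 eP].
  apply/nbhs_ballP; exists e => //= w; rewrite -ball_normE /= => vw.
  apply: eP; rewrite -ball_normE /= -linearB; exact: le_lt_trans (vecE _) vw.
apply: bounded_closed_compact.
  by exists r; split; [exact: num_real|move=> M rM v /= /le_trans; apply; exact: ltW].
apply: (@closed_comp _ _ _ [set x | x <= r]); last exact: closed_le.
by move=> v _; exact: norm_continuous.
Qed.

(* Splits [-r, r]^q into cells of side at most e and keeps one point of D per cell. *)
Lemma finite_net q (D : set 'cV[R]_q) (r e : R) : 0 < e ->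
  exists2 ys : seq 'cV[R]_q, (forall y, y \in ys -> D y) &
    forall z, D z -> `|z| <= r -> exists2 y, y \in ys & `|z - y| <= e.
Proof.
move=> e0.
(* [K] cells of side e cover [-r, r]; the successor accounts for the right end point. *)
pose K := (Num.truncn ((r + r) / e)).+1.
pose cell (z : 'cV[R]_q) : {ffun 'I_q -> 'I_K} :=
  [ffun i => inord (Num.truncn ((z i 0 + r) / e))].
(* The default 0 may lie outside [D]; it never occurs, since only occupied cells are kept. *)
pose pt (c : {ffun 'I_q -> 'I_K}) : 'cV[R]_q :=
  xget (0 : 'cV[R]_q) [set z : 'cV[R]_q | [/\ D z, `|z| <= r & cell z = c]].
pose occ c := `[< exists z, [/\ D z, `|z| <= r & cell z = c] >].
exists [seq pt c | c <- enum {: {ffun 'I_q -> 'I_K}} & occ c].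
  move=> y /mapP[c]; rewrite mem_filter => /andP[/asboolP[z zc] _] ->.
  by rewrite /pt; case: xgetP => [_ -> []|/(_ z)].
move=> z Dz zr; exists (pt (cell z)).
  by apply: map_f; rewrite mem_filter mem_enum andbT; apply/asboolP; exists z.
have : [/\ D (pt (cell z)), `|pt (cell z)| <= r & cell (pt (cell z)) = cell z].
  by rewrite /pt; case: xgetP => [y _ //|/(_ z)]; case.
move: (pt _) => y [Dy yr yz].
apply/mx_norm_leP => [|i j]; first exact: ltW.
rewrite ord1 !mxE.
have bd (x : 'cV[R]_q) : `|x| <= r -> 0 <= x i 0 + r /\
    (Num.truncn ((x i 0 + r) / e)%R < K)%N.
  move=> xr; have := le_trans (ler_entry_norm x i 0) xr.
  rewrite ler_norml => /andP[h1 h2]; have h0 : 0 <= x i 0 + r by lra.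
  split => //; rewrite /K ltnS le_truncn// ler_pM2r ?invr_gt0//.
  by rewrite lerD2r.
have [z0 zK] := bd _ zr; have [y0 yK] := bd _ yr.
have := congr1 (fun g : {ffun 'I_q -> 'I_K} => val (g i)) yz.
rewrite /= !ffunE !inordK// => tE.
have z0' : 0 <= (z i 0 + r) / e by rewrite divr_ge0// ltW.
have y0' : 0 <= (y i 0 + r) / e by rewrite divr_ge0// ltW.
have /andP[zl zu] := truncn_itv z0'; have /andP[yl yu] := truncn_itv y0'.
rewrite -tE in zl zu; rewrite -natr1 in zu; rewrite -natr1 in yu.
have : `|(z i 0 + r) / e - (y i 0 + r) / e| <= 1.
  by rewrite ler_norml; apply/andP; split; lra.
have -> : (z i 0 + r) / e - (y i 0 + r) / e = (z i 0 - y i 0) / e by ring.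
by rewrite normrM [`|e^-1|]gtr0_norm ?invr_gt0// ler_pdivrMr// mul1r.
Qed.

Lemma borelM_continuous_measurable p q (f : 'M[R]_(p, q) -> R) :
  continuous f -> measurable_fun [set: borelM R p q] f.
Proof.
move=> cf; apply: (measurability _ (RGenOInfty.measurableE R)) => //.
move=> /= _ [_ [x ->] <-]; rewrite setTI.
apply: sub_sigma_algebra; rewrite preimage_itvoy.
rewrite (_ : mkset _ = f @^-1` [set y | x < y])//.
by apply: open_comp; [move=> y _; exact: cf|exact: open_gt].
Qed.

(* 'M[R]_(p, q) is second countable: an open set is the union of the rational
   boxes that it contains. *)
Lemma measurable_fun_borelM d (T : measurableType d) p q (g : T -> 'M[R]_(p, q)) :
  (forall i j, measurable_fun setT (fun t => g t i j)) ->
  @measurable_fun _ _ T (borelM R p q) setT g.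
Proof.
move=> mg; apply: (@measurability _ _ _ (borelM R p q) _ _ (@open _)) => //.
move=> _ [U oU <-]; rewrite setTI.
pose cube (c : 'M[rat]_(p, q) * nat) :=
  [set x : 'M[R]_(p, q) | forall i j, `|x i j - ratr (c.1 i j)| < c.2.+1%:R^-1].
have UE : U = \bigcup_(c in [set c | cube c `<=` U]) cube c.
  apply/seteqP; split => [x Ux|x [c cU]]; last exact: cU.
  have /nbhs_ballP[e /= e0 eU] : nbhs x U by exact: open_nbhs_nbhs.
  (* Every point of a box is within 1 / (k + 1) of its centre, hence the factor 2 between two of
     them. *)
  have [k k0] : exists k : nat, 2 * k.+1%:R^-1 <= e.
    exists (Num.truncn (2 / e)).
    have := truncnS_gt (2 / e); set K := _.+1%:R => eK.
    by rewrite ler_pdivrMr ?ltr0n// mulrC -ler_pdivrMr// ltW.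
  have c0 : 0 < k.+1%:R^-1 :> R by rewrite invr_gt0.
  have dense i j : exists r : rat, `|x i j - ratr r| < k.+1%:R^-1.
    have lt : x i j - k.+1%:R^-1 < x i j + k.+1%:R^-1.
      by rewrite ltrD2l; apply: lt_trans c0; rewrite oppr_lt0.
    have [r] := rat_in_itvoo lt; rewrite in_itv/= => /andP[h1 h2].
    by exists r; rewrite ltr_distlC h1 h2.
  pose c : 'M[rat]_(p, q) := \matrix_(i, j) xchoose (dense i j).
  exists (c, k); last first.
    by move=> i j /=; rewrite mxE; exact: (xchooseP (dense i j)).
  move=> y /= yc; apply: eU; split => // i j; rewrite /ball/=.
  have h1 := yc i j; have := xchooseP (dense i j).
  rewrite mxE in h1 => h2; apply: lt_le_trans k0.
  rewrite distrC in h1.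
  have -> : x i j - y i j = (x i j - ratr (xchoose (dense i j))) +
    (ratr (xchoose (dense i j)) - y i j) by ring.
  by rewrite (le_lt_trans (ler_normD _ _))// mulr2n mulrDl !mul1r ltrD.
rewrite UE preimage_bigcup; rewrite bigcup_mkcond; apply: countable_bigcupT_measurable.
  exact: countableP.
move=> c; case: ifP => // _; rewrite (_ : _ @^-1` _ =
  \bigcap_(ij in [set: 'I_p * 'I_q])
    ((fun t => g t ij.1 ij.2) @^-1` ball (ratr (c.1 ij.1 ij.2) : R) c.2.+1%:R^-1)).
  apply: fin_bigcap_measurable => // -[i j] _ /=.
  rewrite -[X in measurable X]setTI; apply: mg => //.
  exact: measurable_ball.
apply/seteqP; split => t /=.
  by move=> tc [i j] _ /=; rewrite /ball/= distrC; exact: tc.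
by move=> tc i j; have := tc (i, j) I; rewrite /= /ball/= distrC.
Qed.

End MatrixNorm.

(** * Bounded Lipschitz functions *)

Section BoundedLipschitz.
Context {R : realType} {d : nat}.
Implicit Types k : nat.

Lemma CblipP k (phi : 'M[R]_(d, k) -> R) :
  Cblip phi <-> exists C : R, (forall x, `|phi x| <= C) /\
    (forall x y, `|phi x - phi y| <= C * `|x - y|).
Proof.
split=> [[[M1 [_ hM1]] [M2 [_ hM2]]]|[C [bC lC]]].
  (* Each property holds for all constants strictly above a threshold, hence the added 1. *)
  pose C := Num.max M1 M2 + 1; exists C; split=> [x|x y].
    by apply: (hM1 C) => //; rewrite /C ltr_pwDr// le_max lexx.
  have := hM2 C; rewrite /C ltr_pwDr ?le_max ?lexx ?orbT// => /(_ isT).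
  by move=> /(_ (x, y)) /=; apply.
split; exists C; split; rewrite ?num_real// => M CM.
  by move=> x _; exact: le_trans (bC x) (ltW CM).
move=> [x y] _ /=; apply: le_trans (lC x y) _.
by rewrite ler_wpM2r// ltW.
Qed.

Lemma Cblip_norm_bound k (phi : 'M[R]_(d, k) -> R) :
  Cblip phi -> exists2 C : R, 0 < C & forall x, `|phi x| <= C.
Proof.
move=> /CblipP[C [bC _]]; exists (C + 1) => [|x].
  by rewrite ltr_wpDl// (le_trans _ (bC 0)).
by rewrite (le_trans (bC x))// lerDl.
Qed.

Lemma Cblip_cst k (c : R) : Cblip (fun _ : 'M[R]_(d, k) => c).
Proof. by apply/CblipP; exists `|c|; split=> // x y; rewrite subrr normr0 mulr_ge0. Qed.

Lemma Cblip_lin k a (f g : 'M[R]_(d, k) -> R) :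
  Cblip f -> Cblip g -> Cblip (fun x => a * f x + g x).
Proof.
move=> /CblipP[C [bC lC]] /CblipP[D [bD lD]]; apply/CblipP.
exists (`|a| * C + D); split=> [x|x y].
  by rewrite (le_trans (ler_normD _ _))// lerD// normrM ler_wpM2l.
have -> : a * f x + g x - (a * f y + g y) = a * (f x - f y) + (g x - g y) by ring.
rewrite (le_trans (ler_normD _ _))// mulrDl lerD// normrM -mulrA ler_wpM2l//.
Qed.

Lemma CblipD k (f g : 'M[R]_(d, k) -> R) :
  Cblip f -> Cblip g -> Cblip (fun x => f x + g x).
Proof.
move=> cf cg; rewrite (_ : (fun x => _) = fun x => 1 * f x + g x).
  exact: Cblip_lin.
by apply/funext => x; rewrite mul1r.
Qed.

Lemma CblipZ k a (f : 'M[R]_(d, k) -> R) : Cblip f -> Cblip (fun x => a * f x).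
Proof.
move=> cf; rewrite (_ : (fun x => _) = fun x => a * f x + 0).
  by apply: Cblip_lin => //; exact: Cblip_cst.
by apply/funext => x; rewrite addr0.
Qed.

Lemma CblipB k (f g : 'M[R]_(d, k) -> R) :
  Cblip f -> Cblip g -> Cblip (fun x => f x - g x).
Proof.
move=> cf cg; rewrite (_ : (fun x => _) = fun x => -1 * g x + f x).
  exact: Cblip_lin.
by apply/funext => x; rewrite mulN1r addrC.
Qed.

Lemma Cblip_linear_set k : linear_set (@Cblip R d k).
Proof.
by split=> [|a x y Sx Sy]; [exact: (Cblip_cst k 0)|exact: (@Cblip_lin k a x y)].
Qed.

Lemma Cblip_sum k (I : Type) (s : seq I) (f : I -> 'M[R]_(d, k) -> R) :
  (forall i, Cblip (f i)) -> Cblip (fun x => \sum_(i <- s) f i x).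
Proof.
move=> cf; elim: s => [|i s IH].
  by under eq_fun do rewrite big_nil; exact: Cblip_cst.
by under eq_fun do rewrite big_cons; exact: CblipD.
Qed.

Lemma CblipM k (f g : 'M[R]_(d, k) -> R) :
  Cblip f -> Cblip g -> Cblip (fun x => f x * g x).
Proof.
move=> /CblipP[C [bC lC]] /CblipP[D [bD lD]]; apply/CblipP.
have C0 : 0 <= C by exact: le_trans (bC 0).
have D0 : 0 <= D by exact: le_trans (bD 0).
exists (C * D + C * D); split=> [x|x y].
  by rewrite normrM (le_trans (ler_pM _ _ (bC x) (bD x)))// lerDl mulr_ge0.
have -> : f x * g x - f y * g y = f x * (g x - g y) + (f x - f y) * g y by ring.
rewrite (le_trans (ler_normD _ _))// !normrM mulrDl lerD//.
  by rewrite -mulrA ler_pM.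
by rewrite mulrAC ler_pM.
Qed.

Lemma Cblip_abs k (f : 'M[R]_(d, k) -> R) : Cblip f -> Cblip (fun x => `|f x|).
Proof.
move=> /CblipP[C [bC lC]]; apply/CblipP; exists C; split=> [x|x y].
  by rewrite normr_id.
exact: le_trans (ler_dist_dist _ _) (lC x y).
Qed.

Lemma min_abs (x y : R) : Num.min x y = 2^-1 * (x + y - `|x - y|).
Proof. by rewrite minr_absE; field. Qed.

Lemma max_abs (x y : R) : Num.max x y = 2^-1 * (x + y + `|x - y|).
Proof. by rewrite maxr_absE; field. Qed.

Lemma Cblip_min k (f g : 'M[R]_(d, k) -> R) :
  Cblip f -> Cblip g -> Cblip (fun x => Num.min (f x) (g x)).
Proof.
move=> cf cg; under eq_fun do rewrite min_abs.
apply: CblipZ; apply: CblipB; first exact: CblipD.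
by apply: Cblip_abs; exact: CblipB.
Qed.

Lemma Cblip_max k (f g : 'M[R]_(d, k) -> R) :
  Cblip f -> Cblip g -> Cblip (fun x => Num.max (f x) (g x)).
Proof.
move=> cf cg; under eq_fun do rewrite max_abs.
apply: CblipZ; apply: CblipD; first exact: CblipD.
by apply: Cblip_abs; exact: CblipB.
Qed.

Lemma Cblip_comp k k' (h : 'M[R]_(d, k') -> 'M[R]_(d, k)) (f : 'M[R]_(d, k) -> R) :
  (forall x y, `|h x - h y| <= `|x - y|) -> Cblip f -> Cblip (fun x => f (h x)).
Proof.
move=> lh /CblipP[C [bC lC]]; apply/CblipP; exists C; split=> // x y.
by rewrite (le_trans (lC _ _))// ler_wpM2l// (le_trans _ (bC 0)).
Qed.

(** Source of the cut-offs: a truncation brings norms and noise components into [Cblip]. *)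
Lemma Cblip_min_lip k (c : R) (L : R) (h : 'M[R]_(d, k) -> R) :
  (forall x, 0 <= h x) -> 0 <= c ->
  (forall x y, `|h x - h y| <= L * `|x - y|) -> Cblip (fun x => Num.min c (h x)).
Proof.
move=> h0 c0 lh; apply/CblipP; exists (Num.max c `|L|).
split=> [x|x y].
  rewrite ger0_norm; last by rewrite le_min c0 h0.
  by rewrite ge_min le_max lexx.
have lh' : `|h x - h y| <= Num.max c `|L| * `|x - y|.
  rewrite (le_trans (lh _ _))// ler_wpM2r// le_max.
  by rewrite ler_norm orbT.
have r0 : 0 <= Num.max c `|L| * `|x - y| by rewrite mulr_ge0// le_max c0.
move: lh'; rewrite !ler_norml => /andP[h1 h2].
by rewrite !minEle; do 2 case: ifPn; rewrite -?ltNge => h3 h4;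
  apply/andP; split; lra.
Qed.

Lemma Cblip_continuous k (f : 'M[R]_(d, k) -> R) : Cblip f -> continuous f.
Proof.
move=> /CblipP[C [bC lC]] x P /nbhs_ballP[e /= e0 eP].
have C1 : 0 < C + 1 by rewrite ltr_wpDl// (le_trans _ (bC x)).
apply/nbhs_ballP; exists (e / (C + 1)); first by rewrite /= divr_gt0.
move=> y; rewrite -ball_normE /= => xy; apply: eP; rewrite -ball_normE /=.
apply: le_lt_trans (lC x y) _.
apply: (@le_lt_trans _ _ ((C + 1) * `|x - y|)).
  by rewrite ler_wpM2r// lerDl.
by rewrite mulrC -ltr_pdivlMr.
Qed.

Lemma Cblip_measurable k (f : 'M[R]_(d, k) -> R) :
  Cblip f -> measurable_fun [set: borelM R d k] f.
Proof. by move=> /Cblip_continuous; exact: borelM_continuous_measurable. Qed.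

(* min(1, n dist(x, ~` O)), written as an infimum over a never empty set. *)
Definition plateau k (O : set 'M[R]_(d, k)) (n : nat) (x : 'M[R]_(d, k)) : R :=
  inf (1 |` [set n%:R * `|x - y| | y in ~` O]).

Lemma plateau_has_inf k O n (x : 'M[R]_(d, k)) :
  has_inf (1 |` [set n%:R * `|x - y| | y in ~` O]).
Proof.
split; first by exists 1; left.
by exists 0 => _ [->//|[y _ <-]]; rewrite mulr_ge0.
Qed.

Lemma plateau_ge k O n (x : 'M[R]_(d, k)) c :
  c <= 1 -> (forall y, ~ O y -> c <= n%:R * `|x - y|) -> c <= plateau O n x.
Proof.
move=> c1 cO; apply: lb_le_inf; first exact: (plateau_has_inf _ _ _).1.
by move=> _ [->//|[y Oy <-]]; exact: cO.
Qed.

Lemma plateau_le1 k O n (x : 'M[R]_(d, k)) : plateau O n x <= 1.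
Proof. by apply: ge_inf; [exact: (plateau_has_inf _ _ _).2|left]. Qed.

Lemma plateau_le k O n (x y : 'M[R]_(d, k)) : ~ O y -> plateau O n x <= n%:R * `|x - y|.
Proof. by move=> Oy; apply: ge_inf; [exact: (plateau_has_inf _ _ _).2|right; exists y]. Qed.

Lemma plateau_ge0 k O n (x : 'M[R]_(d, k)) : 0 <= plateau O n x.
Proof. by apply: plateau_ge => // y _; rewrite mulr_ge0. Qed.

Lemma plateau_out k O n (x : 'M[R]_(d, k)) : ~ O x -> plateau O n x = 0.
Proof.
move=> Ox; apply/eqP; rewrite eq_le plateau_ge0 andbT.
by rewrite (le_trans (plateau_le n _ Ox))// subrr normr0 mulr0.
Qed.

Lemma plateau_mono k O n m (x : 'M[R]_(d, k)) : (n <= m)%N -> plateau O n x <= plateau O m x.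
Proof.
move=> nm; apply: plateau_ge; first exact: plateau_le1.
move=> y Oy; rewrite (le_trans (plateau_le n x Oy))// ler_wpM2r//.
by rewrite ler_nat.
Qed.

Lemma plateau_in k (O : set 'M[R]_(d, k)) x : open O -> O x ->
  exists n, plateau O n x = 1.
Proof.
move=> oO Ox; have /nbhs_ballP[e /= e0 eO] : nbhs x O by exact: open_nbhs_nbhs.
exists (Num.truncn e^-1).+1; apply/eqP; rewrite eq_le plateau_le1/=.
apply: plateau_ge => // y Oy; have xy : e <= `|x - y|.
  rewrite leNgt; apply/negP => xy; apply: Oy; apply: eO.
  by rewrite -ball_normE.
apply: (@le_trans _ _ (e^-1 * e)); first by rewrite mulVf// gt_eqF.
apply: ler_pM => //; [by rewrite invr_ge0 ltW|exact: ltW|].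
by rewrite ltW// truncnS_gt.
Qed.

Lemma plateau_Cblip k (O : set 'M[R]_(d, k)) n : Cblip (plateau O n).
Proof.
have lip x y : plateau O n x - plateau O n y <= n%:R * `|x - y|.
  rewrite lerBlDr addrC -lerBlDr; apply: plateau_ge.
    by rewrite lerBlDr (le_trans (plateau_le1 O n x))// lerDl mulr_ge0.
  move=> z Oz; rewrite lerBlDr (le_trans (plateau_le n x Oz))// -mulrDr ler_wpM2l//.
  by rewrite [leRHS]addrC ler_distD.
apply/CblipP; exists (n%:R + 1); split=> [x|x y].
  by rewrite ger0_norm ?plateau_ge0// (le_trans (plateau_le1 O n x))// lerDr.
apply: (@le_trans _ _ (n%:R * `|x - y|)); last by rewrite ler_wpM2r// lerDl.
by rewrite ler_norml lip andbT lerNl opprB distrC lip.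
Qed.

End BoundedLipschitz.

(** * Riesz representation *)

Section PositiveFunctional.
Context {R : realType} {d k : nat}.
Local Notation M := 'M[R]_(d, k).
Variable l : (M -> R) -> R.
Hypothesis l_lin : linear_on (@Cblip R d k) l.
Hypothesis l_pos : forall phi, Cblip phi -> (forall x, 0 <= phi x) -> 0 <= l phi.
Hypothesis l_one : l (fun=> 1) = 1.
Hypothesis l_tight : forall e : R, 0 < e -> exists r : R, forall phi, Cblip phi ->
  (forall x, 0 <= phi x <= 1) -> (forall x : 'M[R]_(d, k), `|x| <= r -> phi x = 0) -> l phi <= e.

Lemma pf_lin a phi psi : Cblip phi -> Cblip psi ->
  l (fun x => a * phi x + psi x) = a * l phi + l psi.
Proof. by move=> cphi cpsi; exact: l_lin. Qed.

Lemma pf0 : l (fun=> 0) = 0.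
Proof.
have c0 : Cblip (fun _ : M => 0 : R) by exact: Cblip_cst.
rewrite -[RHS](addNr (l (fun=> 0))) -[in RHS]mulN1r -pf_lin//.
by congr l; apply/funext => x; rewrite mulr0 addr0.
Qed.

Lemma pfZ a phi : Cblip phi -> l (fun x => a * phi x) = a * l phi.
Proof.
move=> cphi; have := pf_lin a cphi (Cblip_cst k 0).
by rewrite pf0 addr0 => <-; congr l; apply/funext => x; rewrite addr0.
Qed.

Lemma pfD phi psi : Cblip phi -> Cblip psi ->
  l (fun x => phi x + psi x) = l phi + l psi.
Proof.
move=> cphi cpsi; have := pf_lin 1 cphi cpsi.
by rewrite mul1r => <-; congr l; apply/funext => x; rewrite mul1r.
Qed.

Lemma pf_cst c : l (fun=> c) = c.
Proof.
rewrite -[RHS]mulr1 -l_one -pfZ; last exact: Cblip_cst.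
by congr l; apply/funext => x; rewrite mulr1.
Qed.

Lemma pf_le phi psi : Cblip phi -> Cblip psi ->
  (forall x, phi x <= psi x) -> l phi <= l psi.
Proof.
move=> cphi cpsi le; have := @l_pos (fun x => -1 * phi x + psi x).
rewrite pf_lin// mulN1r addrC subr_ge0; apply; first exact: Cblip_lin.
by move=> x; rewrite mulN1r addrC subr_ge0.
Qed.

Lemma pf_sum (I : Type) (s : seq I) (f : I -> M -> R) :
  (forall i, Cblip (f i)) -> l (fun x => \sum_(i <- s) f i x) = \sum_(i <- s) l (f i).
Proof.
move=> cf; elim: s => [|i s IH].
  by rewrite big_nil -[RHS]pf0; congr l; apply/funext => x; rewrite big_nil.
rewrite big_cons -IH -pfD//; last exact: Cblip_sum.
by congr l; apply/funext => x; rewrite big_cons.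
Qed.

(* Dini on a compact ball, tightness outside of it. *)
Lemma pf_dini (h : nat -> M -> R) : (forall n, Cblip (h n)) ->
  (forall n x, 0 <= h n x) -> (forall n m x, (n <= m)%N -> h m x <= h n x) ->
  (forall x (e : R), 0 < e -> exists n, h n x < e) ->
  forall e : R, 0 < e -> exists n, l (h n) <= e.
Proof.
move=> ch h0 hmon hcvg e e0.
have [C C0 bC] := Cblip_norm_bound (ch 0%N).
(* [C] bounds h 0 and hence every h n, so with this accuracy the tail costs at most e / 2. *)
have [|r rP] := @l_tight (e / 2 / C); first by rewrite !divr_gt0.
(* It vanishes on the ball of radius r, as tightness demands, and equals 1 beyond r + 1; Dini is
   needed only on the compact ball of radius r + 1. *)
pose tail (x : M) : R := Num.min 1 (Num.max 0 (`|x| - r)).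
have ctail : Cblip tail.
  apply: (@Cblip_min_lip _ _ _ 1 1) => // [x|x y]; first by rewrite le_max lexx.
  rewrite mul1r; apply: le_trans (ler_dist_dist _ _).
  rewrite !maxEle ler_norml; move: (`|x|) (`|y|) => u v.
  by case: ifPn; case: ifPn; rewrite -?ltNge => h1 h2;
    have [h3|h3] := leP 0 (u - v); rewrite ?(ger0_norm h3) ?(ltr0_norm h3);
    apply/andP; split; lra.
have tail01 x : 0 <= tail x <= 1.
  by rewrite /tail le_min ler01 le_max lexx ge_min lexx.
have ltail : l tail <= e / 2 / C.
  apply: rP => // x xr; rewrite /tail max_l; last by rewrite subr_le0.
  by rewrite min_r.
have e20 : 0 < e / 2 by rewrite divr_gt0.
have : \forall n \near \oo, [set x : M | `|x| <= r + 1] `<=` (fun x => h n x < e / 2).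
  have /compact_near_coveringP := @closed_ball_compact_mx R d k (r + 1).
  apply => x _; have [n hn] := hcvg x (e / 2) e20.
  exists ([set y | h n y < e / 2], [set m | (n <= m)%N]); last first.
    by move=> [y m] /= [hy nm]; exact: le_lt_trans (hmon _ _ _ nm) hy.
  split; last by exists n.
  apply: open_nbhs_nbhs; split => //.
  apply: (@open_comp _ _ (h n) [set y | y < e / 2]); last exact: open_lt.
  by move=> y _; exact: Cblip_continuous.
move=> [n _ /(_ n (leqnn n)) hn]; exists n.
apply: (@le_trans _ _ (l (fun x => C * tail x + e / 2))).
  apply: pf_le => // [|x]; first by apply: Cblip_lin => //; exact: Cblip_cst.
  have [xr|xr] := leP `|x| (r + 1).
    have /andP[t0 _] := tail01 x.
    by rewrite ler_wpDl ?(mulr_ge0 (ltW C0) t0)//; apply/ltW/hn.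
  rewrite /tail max_r; last by lra.
  rewrite min_l; last by lra.
  rewrite mulr1 ler_wpDr ?(ltW e20)//.
  apply: le_trans (hmon 0%N n x (leq0n n)) _.
  exact: le_trans (ler_norm _) (bC x).
rewrite pf_lin ?pf_cst//; last exact: Cblip_cst.
rewrite [leRHS]splitr lerD2r mulrC -ler_pdivlMr//.
Qed.

(** Vanishing off [O] takes the place of compact support; escape of mass is prevented by tightness,
    through [pf_dini]. *)
Definition subord (O : set M) (phi : M -> R) : Prop :=
  [/\ Cblip phi, forall x, 0 <= phi x <= 1 & forall x, ~ O x -> phi x = 0].

(** The value that the representing measure has to take on an open set. *)
Definition content (O : set M) : R := sup [set l phi | phi in subord O].

Lemma subord0 O : subord O (fun=> 0).
Proof. by split => // [|x]; [exact: Cblip_cst|rewrite lexx ler01]. Qed.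

Lemma subord_le1 O phi : subord O phi -> l phi <= 1.
Proof.
move=> [cphi phi01 _]; rewrite -[leRHS]l_one; apply: pf_le => //.
  exact: Cblip_cst.
by move=> x; case/andP: (phi01 x).
Qed.

Lemma content_has_sup O : has_sup [set l phi | phi in subord O].
Proof.
split; first by exists (l (fun=> 0)), (fun=> 0) => //; exact: subord0.
by exists 1 => _ [phi + <-]; exact: subord_le1.
Qed.

Lemma content_ge O phi : subord O phi -> l phi <= content O.
Proof. by move=> sphi; apply: ub_le_sup; [exact: (content_has_sup O).2|exists phi]. Qed.

Lemma content_le O c : (forall phi, subord O phi -> l phi <= c) -> content O <= c.
Proof.
move=> h; apply: ge_sup; first exact: (content_has_sup O).1.
by move=> _ [phi + <-]; exact: h.
Qed.

Lemma content_approx O (e : R) : 0 < e -> exists2 phi, subord O phi & content O - e < l phi.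
Proof.
by move=> e0; have [_ [phi sphi <-] h] := sup_adherent e0 (content_has_sup O); exists phi.
Qed.

Lemma content_ge0 O : 0 <= content O.
Proof. by rewrite -pf0; apply: content_ge; exact: subord0. Qed.

Lemma content_le1 O : content O <= 1.
Proof. by apply: content_le => phi; exact: subord_le1. Qed.

Lemma content_mono A B : A `<=` B -> content A <= content B.
Proof.
move=> AB; apply: content_le => phi [c p z]; apply: content_ge; split=> // x nB.
by apply: z => /AB.
Qed.

Lemma content_set0 : content set0 = 0.
Proof.
apply/eqP; rewrite eq_le content_ge0 andbT; apply: content_le => phi [_ _ z].
rewrite (_ : phi = fun=> 0) ?pf0//; apply/funext => x; exact: z.
Qed.

Lemma content_setT : content setT = 1.
Proof.
apply/eqP; rewrite eq_le content_le1/= -l_one; apply: content_ge; split => [|x|x].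
- exact: Cblip_cst.
- by rewrite ler01 lexx.
- by move=> /(_ I).
Qed.

Lemma subord_plateau O n : subord O (plateau O n).
Proof.
by split=> [|x|x]; [exact: plateau_Cblip|rewrite plateau_ge0 plateau_le1|exact: plateau_out].
Qed.

(** For phi subordinate to the union, the excess of phi over the partial sums of plateaus decreases
    pointwise to 0; [pf_dini] makes it negligible, so finitely many of the sets carry l phi up to
    e. *)
Lemma content_sigma_subadd (F : nat -> set M) : (forall i, open (F i)) ->
  ((content (\bigcup_i F i))%:E <= \sum_(i <oo) (content (F i))%:E)%E.
Proof.
move=> oF; suff H phi : subord (\bigcup_i F i) phi ->
    ((l phi)%:E <= \sum_(i <oo) (content (F i))%:E)%E.
  have S0 : (0 <= \sum_(i <oo) (content (F i))%:E)%E.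
    by apply: nneseries_ge0 => i _ _; rewrite lee_fin content_ge0.
  move: S0 H; case: (X in (0 <= X)%E -> _) => [s|_ _|//]; last by rewrite leey.
  move=> _ H; rewrite lee_fin; apply: content_le => phi sphi.
  by rewrite -lee_fin; exact: H.
move=> [cphi phi01 phiz]; apply/lee_addgt0Pr => e e0.
(* [n] is both the number of sets and the steepness of the plateaus, so that a single index tends to
   infinity. *)
pose s n x := \sum_(0 <= i < n) plateau (F i) n x.
have cs n : Cblip (s n) by apply: Cblip_sum => i; exact: plateau_Cblip.
have s0 n x : 0 <= s n x by apply: sumr_ge0 => i _; exact: plateau_ge0.
have smon n m x : (n <= m)%N -> s n x <= s m x.
  move=> nm; rewrite /s (big_cat_nat (leq0n n) nm)//=; apply: ler_wpDr.
    by apply: sumr_ge0 => i _; exact: plateau_ge0.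
  by apply: ler_sum => i _; exact: plateau_mono.
pose h n x := phi x - Num.min (phi x) (s n x).
have ch n : Cblip (h n) by apply: CblipB => //; exact: Cblip_min.
have [|||n hn] := @pf_dini h ch _ _ _ e e0.
- by move=> n x; rewrite subr_ge0 ge_min lexx.
- move=> n m x nm; rewrite lerD2l lerN2 le_min ge_min lexx/=.
  by rewrite ge_min smon ?orbT.
- move=> x e' e'0; have [[i _ Fx]|nF] := pselect ((\bigcup_i F i) x); last first.
    by exists 0%N; rewrite /h phiz// min_l ?subrr.
  have [n bn] := plateau_in (oF i) Fx.
  exists (maxn n i.+1); rewrite /h min_l ?subrr//.
  apply: (@le_trans _ _ 1); first by case/andP: (phi01 x).
  have iI : (i < maxn n i.+1)%N by rewrite leq_max ltnSn orbT.
  rewrite /s big_mkord (bigD1 (Ordinal iI))//=; apply: ler_wpDr.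
    by apply: sumr_ge0 => j _; exact: plateau_ge0.
  by rewrite -bn plateau_mono// leq_maxl.
have le1 : l phi <= \sum_(0 <= i < n) content (F i) + e.
  have -> : l phi = l (fun x => h n x + Num.min (phi x) (s n x)).
    by congr l; apply/funext => x; rewrite /h subrK.
  rewrite pfD//; last exact: Cblip_min.
  rewrite addrC lerD//.
  apply: (@le_trans _ _ (l (s n))).
    by apply: pf_le => //; [exact: Cblip_min|move=> x; rewrite ge_min lexx orbT].
  rewrite pf_sum; last by move=> i; exact: plateau_Cblip.
  by apply: ler_sum => i _; apply: content_ge; exact: subord_plateau.
apply: (@le_trans _ _ ((\sum_(0 <= i < n) content (F i))%:E + e%:E)%E).
  by rewrite -EFinD lee_fin.
rewrite leeD2r// -sumEFin; apply: nneseries_lim_ge => i _ _.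
by rewrite lee_fin content_ge0.
Qed.

Definition outer (A : set M) : \bar R :=
  ereal_inf [set (content O)%:E | O in [set O | open O /\ A `<=` O]].

Lemma outer_le A O : open O -> A `<=` O -> (outer A <= (content O)%:E)%E.
Proof. by move=> oO AO; apply: ereal_inf_lbound; exists O. Qed.

Lemma outer_open O : open O -> outer O = (content O)%:E.
Proof.
move=> oO; apply/eqP; rewrite eq_le outer_le//=; apply: le_ereal_inf_tmp.
by move=> _ [G [_ OG] <-]; rewrite lee_fin content_mono.
Qed.

Lemma outer_set0 : outer set0 = 0%E.
Proof. by rewrite outer_open ?content_set0//; exact: open0. Qed.

Lemma outer_ge0 A : (0 <= outer A)%E.
Proof. by apply: le_ereal_inf_tmp => _ [G _ <-]; rewrite lee_fin content_ge0. Qed.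

Lemma outer_mono : {homo outer : A B / A `<=` B >-> (A <= B)%E}.
Proof.
move=> A B AB; apply: le_ereal_inf_tmp => _ [G [oG BG] <-].
by apply: outer_le => //; exact: subset_trans AB BG.
Qed.

Lemma outer_approx A (e : R) : 0 < e ->
  exists2 O, open O /\ A `<=` O & ((content O)%:E <= outer A + e%:E)%E.
Proof.
move=> e0; have fin : outer A \is a fin_num.
  rewrite ge0_fin_numE ?outer_ge0//; apply: le_lt_trans (ltry 1).
  by rewrite -content_setT; apply: outer_le => //; exact: openT.
have [_ [B BP <-] h] := lb_ereal_inf_adherent e0 fin.
by exists B => //; exact: ltW.
Qed.

Lemma outer_sigma_subadd : sigma_subadditive outer.
Proof.
move=> F; apply/lee_addgt0Pr => e e0.
have e2 i : 0 < e / (2 ^ i.+1)%:R by rewrite divr_gt0// ltr0n expn_gt0.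
have ex i := outer_approx (F i) (e2 i).
pose O i := projT1 (cid2 (ex i)).
have OP i : (open (O i) /\ F i `<=` O i) /\
    ((content (O i))%:E <= outer (F i) + (e / (2 ^ i.+1)%:R)%:E)%E.
  by rewrite /O; case: (cid2 (ex i)).
apply: le_trans (epsilon_trick _ _ (ltW e0)); last by move=> n; exact: outer_ge0.
apply: (@le_trans _ _ (content (\bigcup_i O i))%:E).
  apply: outer_le; first by apply: bigcup_open => i _; exact: (OP i).1.1.
  by apply: subset_bigcup => i _; exact: (OP i).1.2.
apply: le_trans (content_sigma_subadd _) _; first by move=> i; exact: (OP i).1.1.
apply: lee_nneseries => i _; first by rewrite lee_fin content_ge0.
exact: (OP i).2.
Qed.

HB.instance Definition _ := isOuterMeasure.Build R M outer
  outer_set0 outer_ge0 outer_mono outer_sigma_subadd.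

(* Given phi subordinate to G `&` O, truncate it below level e: what remains lives
   on the closed set {e <= phi}, so a function subordinate to the complement of
   that set can be added to it. *)
Lemma open_caratheodory O : open O -> outer.-caratheodory O.
Proof.
move=> oO; apply: (@le_caratheodory_measurable _ _ outer) => X.
apply: le_ereal_inf_tmp => _ [G [oG XG] <-]; apply/lee_addgt0Pr => e e0.
(* Three losses of e / 3: the choice of phi, the choice of psi, and the truncation of phi. *)
have e30 : 0 < e / 3 by rewrite divr_gt0.
have [phi sphi phie] := content_approx (G `&` O) e30.
have [cphi phi01 phiz] := sphi.
pose H := G `&` [set x | phi x < e / 3].
have oH : open H.
  apply: openI => //.
  apply: (@open_comp _ _ phi [set y | y < e / 3]); last exact: open_lt.
  by move=> y _; exact: Cblip_continuous.
have [psi [cpsi psi01 psiz] psie] := content_approx H e30.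
pose phi' x := Num.max (phi x - e / 3) 0.
have cphi' : Cblip phi'.
  by apply: Cblip_max; [apply: CblipB => //|]; exact: Cblip_cst.
have le1 : l phi' + l psi <= content G.
  (* psi vanishes where phi >= e / 3 and phi' where phi < e / 3, so the sum stays at most 1. *)
  rewrite -pfD//; apply: content_ge; split; first exact: CblipD.
    move=> x; have /andP[p0 p1] := phi01 x; have /andP[q0 q1] := psi01 x.
    rewrite addr_ge0//=; last by rewrite le_max lexx orbT.
    have [h|h] := ltP (phi x) (e / 3).
      by rewrite /phi' max_r ?add0r// subr_le0 ltW.
    rewrite psiz ?addr0; last by move=> [_ /=]; rewrite ltNge h.
    by rewrite /phi' ge_max ler01 andbT lerBlDr (le_trans p1)// lerDl ltW.
  move=> x nG; rewrite psiz; last by case.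
  rewrite addr0 /phi' phiz; last by case.
  by rewrite max_r// sub0r oppr_le0 ltW.
have le2 : l phi <= l phi' + e / 3.
  rewrite -[X in _ + X]pf_cst -pfD//; last exact: Cblip_cst.
  apply: pf_le => //; first by apply: CblipD => //; exact: Cblip_cst.
  by move=> x; rewrite -lerBlDr /phi' le_max lexx.
apply: (@le_trans _ _ ((content (G `&` O))%:E + (content H)%:E)%E).
  apply: leeD; apply: outer_le => //; first exact: openI.
    exact: setSI.
  move=> x [Xx nO]; split; first exact: XG.
  by rewrite /= phiz//; case.
rewrite -!EFinD lee_fin; lra.
Qed.

Lemma borel_caratheodory : @measurable _ (borelM R d k) `<=` outer.-caratheodory.
Proof.
apply: smallest_sub; last by move=> O; exact: open_caratheodory.
split; first exact: caratheodory_measurable_set0.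
  by move=> A mA; rewrite setTD; exact: caratheodory_measurable_setC.
by move=> F mF; exact: caratheodory_measurable_bigcup.
Qed.

Definition pf_measure (A : set (borelM R d k)) : \bar R := outer A.

Lemma pf_measure_sigma_additive : semi_sigma_additive pf_measure.
Proof.
move=> F mF tF mUF.
apply: (@caratheodory_measure_sigma_additive R M outer) => //.
  by move=> i; exact: borel_caratheodory (mF i).
exact: borel_caratheodory.
Qed.

HB.instance Definition _ := isMeasure.Build _ (borelM R d k) R pf_measure
  outer_set0 outer_ge0 pf_measure_sigma_additive.

Lemma pf_measure_setT : pf_measure setT = 1%E.
Proof. by rewrite /pf_measure outer_open ?content_setT//; exact: openT. Qed.

HB.instance Definition _ := Measure_isProbability.Build _ _ _ pf_measure pf_measure_setT.

Definition pf_probability : probability (borelM R d k) R := pf_measure.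

Lemma pf_integral_cst c : (\int[pf_probability]_x c%:E = c%:E)%E.
Proof.
by rewrite integral_cst// [X in (_ * X)%E](_ : _ = 1%E) ?mule1//; exact: pf_measure_setT.
Qed.

Lemma Cblip_integrable (P : probability (borelM R d k) R) phi :
  Cblip phi -> P.-integrable setT (EFin \o phi).
Proof.
move=> cphi; apply: measurable_bounded_integrable => //.
- exact: fin_num_fun_lty.
- exact: Cblip_measurable.
- by case: cphi.
Qed.

(** phi is cut into n slices of height 1 / n. Times n, slice i is subordinate to {phi > i / n},
    which bounds l from above; slice i is also at least 1 / n on {phi > (i + 1) / n}, which bounds
    the integral from below. *)
Lemma pf_layer_cake phi : Cblip phi -> (forall x, 0 <= phi x <= 1) ->
  ((l phi)%:E <= \int[pf_probability]_x (phi x)%:E)%E.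
Proof.
move=> cphi phi01; apply/lee_addgt0Pr => e e0.
pose n := (Num.truncn e^-1).+1.
have n0 : 0 < n%:R :> R by rewrite ltr0n.
have ne : n%:R^-1 <= e.
  by rewrite invf_ple ?posrE// ltW// truncnS_gt.
have nV0 : 0 <= n%:R^-1 :> R by rewrite invr_ge0 ltW.
pose t (i : nat) : R := i%:R / n%:R.
have tS i : t i.+1 = t i + n%:R^-1 by rewrite /t -natr1 mulrDl mul1r.
have t0 i : 0 <= t i by rewrite /t divr_ge0// ltW.
pose O i := [set x | t i < phi x].
have oO i : open (O i).
  apply: (@open_comp _ _ phi [set y | t i < y]); last exact: open_gt.
  by move=> y _; exact: Cblip_continuous.
pose a i := content (O i).
pose slice i x := Num.min (phi x) (t i.+1) - Num.min (phi x) (t i).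
have cslice i : Cblip (slice i).
  by apply: CblipB; apply: Cblip_min => //; exact: Cblip_cst.
have phiE : phi = fun x => \sum_(0 <= i < n) slice i x.
  apply/funext => x; have /andP[p0 p1] := phi01 x.
  rewrite telescope_sumr// /t mul0r divff ?gt_eqF// min_l// min_r//.
  by rewrite subr0.
have le1 : l phi <= \sum_(0 <= i < n) n%:R^-1 * a i.
  rewrite phiE pf_sum//; apply: ler_sum => i _.
  rewrite mulrC ler_pdivlMr// mulrC -pfZ//; apply: content_ge; split.
  - exact: CblipZ.
  - move=> x; have := tS i; set u := t i.+1 => uE.
    have nV : n%:R * n%:R^-1 = 1 :> R by rewrite divff// gt_eqF.
    have sl : 0 <= slice i x <= n%:R^-1.
      rewrite /slice -/u !minEle; case: ifPn; case: ifPn;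
        rewrite -?ltNge => h1 h2; apply/andP; split; lra.
    case/andP: sl => s0 s1; rewrite (mulr_ge0 (ltW n0) s0)/=.
    by rewrite -[leRHS]nV ler_pM2l.
  - move=> x /negP; rewrite -leNgt => le.
    rewrite /slice min_l; last by rewrite tS (le_trans le)// lerDl.
    by rewrite min_l// subrr mulr0.
(* Shifting the index loses the term i = 0, worth at most 1 / n <= e, and gains a nonnegative
   one. *)
have le2 : \sum_(0 <= i < n) n%:R^-1 * a i <=
    e + \sum_(0 <= i < n) n%:R^-1 * a i.+1.
  rewrite /n big_nat_recl//= big_nat_recr//= -/n.
  apply: (@le_trans _ _ (e + \sum_(0 <= i < Num.truncn e^-1) n%:R^-1 * a i.+1)).
    by rewrite lerD2r (le_trans _ ne)// ler_piMr// content_le1.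
  by rewrite lerD2l lerDl mulr_ge0// content_ge0.
have le3 : ((\sum_(0 <= i < n) n%:R^-1 * a i.+1)%:E <=
    \int[pf_probability]_x (phi x)%:E)%E.
  have mO i : measurable (O i : set (borelM R d k)).
    by apply: sub_sigma_algebra; exact: oO.
  have -> : (\sum_(0 <= i < n) n%:R^-1 * a i.+1)%:E =
      (\int[pf_probability]_x
        \sum_(0 <= i < n) ((n%:R^-1)%:E * (\1_(O i.+1) x)%:E))%E.
    rewrite ge0_integral_sum//; last first.
      by move=> i; apply: measurable_funeM; apply/measurable_EFinP.
    rewrite -sumEFin; apply: eq_bigr => i _.
    rewrite ge0_integralZl//; last exact/measurable_EFinP.
    by rewrite integral_indic// setIT EFinM /= /pf_measure outer_open.
  apply: ge0_le_integral => //.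
  - by move=> x Dx; apply: sume_ge0 => i _; rewrite -EFinM lee_fin mulr_ge0.
  - apply: emeasurable_sum => i; apply: measurable_funeM.
    exact/measurable_EFinP.
  - by apply/measurable_EFinP; exact: Cblip_measurable.
  - move=> x Dx; under eq_bigr do rewrite -EFinM.
    rewrite sumEFin lee_fin [leRHS](congr1 (fun f => f x) phiE).
    apply: ler_sum => i _; rewrite indicE; case: (boolP (x \in O i.+1)).
      rewrite inE /O/= mulr1 => h.
      rewrite /slice min_r; last exact: ltW.
      rewrite min_r; last by rewrite (le_trans _ (ltW h))// tS lerDl.
      by rewrite tS [X in _ <= X]addrAC subrr add0r.
    rewrite mulr0 => _; rewrite /slice subr_ge0 le_min ge_min lexx/=.
    by rewrite ge_min tS lerDl nV0 orbT.
apply: (@le_trans _ _ (e%:E + (\sum_(0 <= i < n) n%:R^-1 * a i.+1)%:E)%E).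
  by rewrite -EFinD lee_fin (le_trans le1 le2).
by rewrite addeC leeD2r.
Qed.

(** The layer-cake inequality for 1 - phi gives the converse one, since the total mass and l 1 are
    both 1. *)
Lemma pf_integral_unit phi : Cblip phi -> (forall x, 0 <= phi x <= 1) ->
  (\int[pf_probability]_x (phi x)%:E = (l phi)%:E)%E.
Proof.
move=> cphi phi01; apply/eqP; rewrite eq_le pf_layer_cake// andbT.
have c1 : Cblip (fun x => 1 - phi x) by apply: CblipB => //; exact: Cblip_cst.
have := pf_layer_cake c1; have -> : l (fun x => 1 - phi x) = 1 - l phi.
  rewrite [RHS]addrC -[X in _ = _ + X]l_one -mulN1r -pf_lin//; last exact: Cblip_cst.
  by congr l; apply/funext => x; rewrite mulN1r addrC.
under eq_integral do rewrite EFinB.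
rewrite integralB//; last 2 first.
- exact: (Cblip_integrable _ (Cblip_cst k 1)).
- exact: Cblip_integrable.
rewrite pf_integral_cst.
have /integrable_fin_num := Cblip_integrable pf_probability cphi.
move=> /(_ measurableT); rewrite /comp; case: (integral _ _ _) => // r _.
rewrite -EFinB !lee_fin => /(_ _); rewrite lerD2l lerN2; apply => x.
by case/andP: (phi01 x) => p0 p1; apply/andP; split; lra.
Qed.

(** phi / (2 C) + 1 / 2 takes its values in [0, 1], and both sides respect this affine change. *)
Theorem positive_functional_integral phi : Cblip phi ->
  (\int[pf_probability]_x (phi x)%:E = (l phi)%:E)%E.
Proof.
move=> cphi; have [C C0 bC] := Cblip_norm_bound cphi.
pose psi x := (2 * C)^-1 * phi x + 2^-1.
have C20 : 0 < 2 * C by rewrite mulr_gt0.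
have cpsi : Cblip psi by apply: Cblip_lin => //; exact: Cblip_cst.
have phiE x : phi x = (2 * C) * psi x + - C.
  by rewrite /psi; field; rewrite gt_eqF.
have psi01 x : 0 <= psi x <= 1.
  have := bC x; rewrite ler_norml phiE => /andP[h1 h2]; apply/andP; split.
    by rewrite -(pmulr_rge0 _ C20); lra.
  by rewrite -(ler_pM2l C20); lra.
rewrite (_ : phi = fun x => (2 * C) * psi x + - C); last exact/funext.
rewrite pf_lin//; last exact: Cblip_cst.
rewrite pf_cst EFinD EFinM -pf_integral_unit//.
under eq_integral do rewrite EFinD EFinM.
rewrite integralD//; last 2 first.
- by apply: integrableZl => //; exact: Cblip_integrable.
- exact: (Cblip_integrable _ (Cblip_cst k (- C))).
rewrite integralZl//; last exact: Cblip_integrable.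
by rewrite pf_integral_cst.
Qed.

End PositiveFunctional.

Theorem riesz_Cblip (R : realType) (d k : nat) (l : ('M[R]_(d, k) -> R) -> R) :
  linear_on (@Cblip R d k) l ->
  (forall phi, Cblip phi -> (forall x, 0 <= phi x) -> 0 <= l phi) ->
  l (fun=> 1) = 1 ->
  (forall e : R, 0 < e -> exists r : R, forall phi, Cblip phi ->
    (forall x, 0 <= phi x <= 1) -> (forall x : 'M[R]_(d, k), `|x| <= r -> phi x = 0) ->
    l phi <= e) ->
  exists Q : probability (borelM R d k) R,
    forall phi, Cblip phi -> (\int[Q]_x (phi x)%:E = (l phi)%:E)%E.
Proof.
move=> h1 h2 h3 h4; exists (pf_probability h1 h2 h3 h4) => phi cphi.
exact: positive_functional_integral.
Qed.

(** * The sublinear expectation of the noise *)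

Section SublinearExpectation.
Context {R : realType} {d : nat} {Theta : Type}.
Variable F : Theta -> probability (borelM R d 1) R.
Hypothesis Theta_inh : inhabited Theta.

Definition supE (psi : 'cV[R]_d -> R) : R :=
  sup [set (\int[F th]_y psi y)%R | th in [set: Theta]].

Let integ th psi : @Cblip R d 1 psi -> (F th).-integrable setT (EFin \o psi).
Proof. exact: Cblip_integrable. Qed.

Let int_cst th (c : R) : (\int[F th]_y c)%R = c.
Proof.
by rewrite Rintegral_cst// [X in fine X](_ : _ = 1%E) ?mulr1//; exact: probability_setT.
Qed.

Lemma supE_has_sup (psi : 'cV[R]_d -> R) : Cblip psi ->
  has_sup [set (\int[F th]_y psi y)%R | th in [set: Theta]].
Proof.
move=> cpsi; case: Theta_inh => th0; split.
  by exists (\int[F th0]_y psi y)%R, th0.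
have [C C0 bC] := Cblip_norm_bound cpsi.
exists C => _ [th _ <-]; rewrite -(int_cst th C).
apply: le_Rintegral => //; [exact: integ|exact: (integ _ (Cblip_cst 1 C))|].
by move=> y _; exact: le_trans (ler_norm _) (bC y).
Qed.

Lemma supE_ge th psi : Cblip psi -> (\int[F th]_y psi y)%R <= supE psi.
Proof. by move=> cpsi; apply: ub_le_sup; [exact: (supE_has_sup cpsi).2|exists th]. Qed.

Lemma supE_le psi c : (forall th, (\int[F th]_y psi y)%R <= c) -> supE psi <= c.
Proof.
move=> h; apply: ge_sup; last by move=> _ [th _ <-].
by case: Theta_inh => th0; exists (\int[F th0]_y psi y)%R, th0.
Qed.

Lemma supE_cst c : supE (fun=> c) = c.
Proof.
apply/eqP; rewrite eq_le; apply/andP; split.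
  by apply: supE_le => th; rewrite int_cst.
by case: Theta_inh => th0; rewrite -{1}(int_cst th0 c) supE_ge//; exact: Cblip_cst.
Qed.

Lemma supE_mono psi chi : Cblip psi -> Cblip chi ->
  (forall y, psi y <= chi y) -> supE psi <= supE chi.
Proof.
move=> cpsi cchi le; apply: supE_le => th; apply: le_trans (supE_ge th cchi).
by apply: le_Rintegral => //; [exact: integ|exact: integ].
Qed.

Lemma supED psi chi : Cblip psi -> Cblip chi ->
  supE (fun y => psi y + chi y) <= supE psi + supE chi.
Proof.
move=> cpsi cchi; apply: supE_le => th.
by rewrite RintegralD//; [rewrite lerD// supE_ge|exact: integ|exact: integ].
Qed.

Lemma supEZ a psi : Cblip psi -> 0 <= a -> supE (fun y => a * psi y) = a * supE psi.
Proof.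
move=> cpsi; rewrite le_eqVlt => /predU1P[<-|a0].
  rewrite mul0r -[RHS](supE_cst 0); congr supE.
  by apply/funext => y; rewrite mul0r.
have intZ th : (\int[F th]_y (a * psi y) = a * \int[F th]_y psi y)%R.
  by rewrite RintegralZl//; exact: integ.
apply/eqP; rewrite eq_le; apply/andP; split.
  by apply: supE_le => th; rewrite intZ ler_pM2l// supE_ge.
rewrite mulrC -ler_pdivlMr//; apply: supE_le => th.
by rewrite ler_pdivlMr// mulrC -intZ supE_ge//; exact: CblipZ.
Qed.

Lemma supE_ler_add psi chi c : Cblip psi -> Cblip chi ->
  (forall y, psi y <= chi y + c) -> supE psi <= supE chi + c.
Proof.
move=> cpsi cchi h; rewrite -[X in _ + X]supE_cst.
apply: le_trans (supED _ _) => //; last exact: Cblip_cst.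
by apply: supE_mono => //; apply: CblipD => //; exact: Cblip_cst.
Qed.

Lemma snoc_lip_l k (x x' : 'M[R]_(d, k)) (y : 'cV[R]_d) :
  `|snoc x y - snoc x' y| <= `|x - x'|.
Proof.
apply/mx_norm_leP => // i j; rewrite !mxE; case: unlift => [j'|].
  by have := ler_entry_norm (x - x') i j'; rewrite !mxE.
by rewrite subrr normr0.
Qed.

Lemma snoc_lip_r k (x : 'M[R]_(d, k)) (y y' : 'cV[R]_d) :
  `|snoc x y - snoc x y'| <= `|y - y'|.
Proof.
apply/mx_norm_leP => // i j; rewrite !mxE; case: unlift => [j'|].
  by rewrite subrr normr0.
by have := ler_entry_norm (y - y') i 0; rewrite !mxE.
Qed.

Lemma Cblip_snoc k phi (x : 'M[R]_(d, k)) :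
  Cblip phi -> Cblip (fun y : 'cV[R]_d => phi (snoc x y)).
Proof. by move=> cphi; apply: Cblip_comp => // y y'; exact: snoc_lip_r. Qed.

Definition condE k (phi : 'M[R]_(d, k.+1) -> R) (x : 'M[R]_(d, k)) : R :=
  supE (fun y => phi (snoc x y)).

Lemma ElipS k (phi : 'M[R]_(d, k.+1) -> R) : Elip F phi = Elip F (condE phi).
Proof. by []. Qed.

(** A supremum of functions sharing one bound and one Lipschitz constant keeps both, so the backward
    recursion of [Elip] never leaves [Cblip]. *)
Lemma Cblip_condE k (phi : 'M[R]_(d, k.+1) -> R) : Cblip phi -> Cblip (condE phi).
Proof.
move=> cphi; have /CblipP[C [bC lC]] := cphi.
apply/CblipP; exists C; split=> [x|x x'].
  have cx := Cblip_snoc x cphi; case: Theta_inh => th0.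
  rewrite ler_norml; apply/andP; split.
    rewrite -[leLHS]supE_cst; apply: supE_mono => //; first exact: Cblip_cst.
    by move=> y; have := bC (snoc x y); rewrite ler_norml => /andP[].
  rewrite -[leRHS]supE_cst; apply: supE_mono => //; first exact: Cblip_cst.
  by move=> y; have := bC (snoc x y); rewrite ler_norml => /andP[].
have C0 : 0 <= C by exact: le_trans (bC 0).
have half z z' : condE phi z - condE phi z' <= C * `|z - z'|.
  rewrite lerBlDr addrC; apply: supE_ler_add; [exact: Cblip_snoc..|].
  move=> y; rewrite addrC -lerBlDr (le_trans (ler_norm _))//.
  by rewrite (le_trans (lC _ _))// ler_wpM2l// snoc_lip_l.
by rewrite ler_norml half andbT lerNl opprB distrC half.
Qed.

Lemma Elip_cst k c : Elip F (fun _ : 'M[R]_(d, k) => c) = c.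
Proof.
elim: k => [//|k IH]; rewrite ElipS -[RHS]IH; congr Elip.
by apply/funext => x; exact: supE_cst.
Qed.

Lemma Elip_mono k (phi psi : 'M[R]_(d, k) -> R) : Cblip phi -> Cblip psi ->
  (forall x, phi x <= psi x) -> Elip F phi <= Elip F psi.
Proof.
elim: k phi psi => [|k IH] phi psi cphi cpsi le; first exact: le.
rewrite !ElipS; apply: IH; [exact: Cblip_condE..|].
by move=> x; apply: supE_mono => //; exact: Cblip_snoc.
Qed.

Lemma ElipD k (phi psi : 'M[R]_(d, k) -> R) : Cblip phi -> Cblip psi ->
  Elip F (fun x => phi x + psi x) <= Elip F phi + Elip F psi.
Proof.
elim: k phi psi => [//|k IH] phi psi cphi cpsi; rewrite !ElipS.
have c1 := Cblip_condE cphi; have c2 := Cblip_condE cpsi.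
apply: le_trans (IH _ _ c1 c2); apply: Elip_mono; [|exact: CblipD|].
  by apply: Cblip_condE; exact: CblipD.
by move=> x; apply: supED; exact: Cblip_snoc.
Qed.

Lemma ElipZ k a (phi : 'M[R]_(d, k) -> R) : Cblip phi -> 0 <= a ->
  Elip F (fun x => a * phi x) = a * Elip F phi.
Proof.
elim: k phi => [//|k IH] phi cphi a0; rewrite !ElipS -IH//; last exact: Cblip_condE.
by congr Elip; apply/funext => x; rewrite /condE supEZ//; exact: Cblip_snoc.
Qed.

Lemma Elip_sublinear k : sublinear_on (@Cblip R d k) (Elip F (k:=k)).
Proof. by split=> [x y cx cy|a x cx a0]; [exact: ElipD|exact: ElipZ]. Qed.

Lemma snocK k (x : 'M[R]_(d, k)) (y : 'cV[R]_d) : col' ord_max (snoc x y) = x.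
Proof. by apply/matrixP => i j; rewrite !mxE liftK. Qed.

Lemma snocK_last k (x : 'M[R]_(d, k)) (y : 'cV[R]_d) : col ord_max (snoc x y) = y.
Proof. by apply/matrixP => i j; rewrite !mxE unlift_none ord1. Qed.

Lemma col'_lip k (x y : 'M[R]_(d, k.+1)) :
  `|col' ord_max x - col' ord_max y| <= `|x - y|.
Proof.
apply/mx_norm_leP => // i j.
by have := ler_entry_norm (x - y) i (lift ord_max j); rewrite !mxE.
Qed.

Lemma col_lip k j (x y : 'M[R]_(d, k)) : `|col j x - col j y| <= `|x - y|.
Proof.
apply/mx_norm_leP => // i j'.
by have := ler_entry_norm (x - y) i j; rewrite !mxE.
Qed.

(** Consistency of the iterated expectation: a last variable that does not occur integrates out,
    because [supE] preserves constants. *)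
Lemma Elip_col' k (phi : 'M[R]_(d, k) -> R) :
  Elip F (fun x : 'M[R]_(d, k.+1) => phi (col' ord_max x)) = Elip F phi.
Proof.
rewrite ElipS; congr Elip; apply/funext => x.
by rewrite -[RHS]supE_cst; congr supE; apply/funext => y; rewrite snocK.
Qed.

Hypothesis F_A2 : A2 F.

Lemma A2_bound : exists2 C : R, 0 <= C &
  forall th, (\int[F th]_x (`|(x : 'cV[R]_d)|)%:E <= C%:E)%E.
Proof.
have := F_A2; rewrite /A2; set S := (X in ereal_sup X) => Slt.
have bd th : (\int[F th]_x (`|(x : 'cV[R]_d)|)%:E <= ereal_sup S)%E.
  by apply: ereal_sup_ubound; exists th.
have S0 : (0 <= ereal_sup S)%E.
  case: Theta_inh => th; apply: le_trans (bd th).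
  by apply: integral_ge0 => x _; rewrite lee_fin.
move: Slt S0 bd; case: (ereal_sup S) => // C _ C0 bd.
by exists C => //; rewrite -lee_fin.
Qed.

(** Markov's inequality, tested on a bounded Lipschitz function in place of an indicator. *)
Lemma supE_tail : exists2 C : R, 0 <= C &
  forall r : R, 0 < r -> supE (fun y => Num.min 1 (`|y| / r)) <= C / r.
Proof.
have [C C0 bC] := A2_bound; exists C => // r r0; apply: supE_le => th.
have rV0 : 0 <= r^-1 by rewrite invr_ge0 ltW.
have mn : measurable_fun [set: borelM R d 1] (fun y : 'cV[R]_d => `|y|).
  by apply: borelM_continuous_measurable => y; exact: norm_continuous.
have nn (y : 'cV[R]_d) : 0 <= `|y| / r by rewrite mulr_ge0.
have cm : Cblip (fun y : 'cV[R]_d => Num.min 1 (`|y| / r)).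
  apply: (@Cblip_min_lip _ _ _ 1 r^-1) => // x y.
  rewrite -mulrBl normrM (ger0_norm rV0) mulrC ler_wpM2l//.
  exact: ler_dist_dist.
rewrite -lee_fin fineK; last first.
  by apply: integrable_fin_num => //; exact: integ.
apply: (@le_trans _ _ (\int[F th]_y ((r^-1)%:E * `|(y : 'cV[R]_d)|%:E))%E).
  apply: ge0_le_integral => //.
  - by move=> y _; rewrite lee_fin le_min ler01/=.
  - by apply/measurable_EFinP; exact: Cblip_measurable.
  - by apply: measurable_funeM; exact/measurable_EFinP.
  - by move=> y _; rewrite -EFinM lee_fin ge_min mulrC lexx orbT.
rewrite ge0_integralZl//; last exact/measurable_EFinP.
by rewrite mulrC EFinM; apply: lee_wpmul2l; rewrite ?lee_fin//; exact: bC.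
Qed.

(** Union bound: outside the ball of radius r some column exceeds r, and each column costs C / r
    when its variable is integrated out. *)
Lemma Elip_tail k : exists2 C : R, 0 <= C & forall r : R, 0 < r ->
  forall phi, Cblip phi -> (forall x, 0 <= phi x <= 1) ->
  (forall x : 'M[R]_(d, k), `|x| <= r -> phi x = 0) -> Elip F phi <= C / r.
Proof.
have [C C0 hC] := supE_tail; exists (k%:R * C); first by rewrite mulr_ge0.
move=> r r0 phi cphi phi01 phiz.
have rV0 : 0 <= r^-1 by rewrite invr_ge0 ltW.
have nn (y : 'cV[R]_d) : 0 <= `|y| / r by rewrite mulr_ge0.
have cm : Cblip (fun y : 'cV[R]_d => Num.min 1 (`|y| / r)).
  apply: (@Cblip_min_lip _ _ _ 1 r^-1) => // x y.
  rewrite -mulrBl normrM (ger0_norm rV0) mulrC ler_wpM2l//.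
  exact: ler_dist_dist.
pose g j (x : 'M[R]_(d, j)) := \sum_(i < j) Num.min 1 (`|col i x| / r).
have cg j : Cblip (@g j).
  apply: Cblip_sum => i.
  apply: (@Cblip_comp _ _ 1 _ (col i) (fun y => Num.min 1 (`|y| / r))) => //.
  exact: col_lip.
apply: (@le_trans _ _ (Elip F (@g k))).
  apply: Elip_mono => // x; have [xr|xr] := leP `|x| r.
    by rewrite phiz// sumr_ge0// => i _; rewrite le_min ler01 nn.
  have [i rx] : exists i, r < `|col i x|.
    apply/not_existsP => H; move: xr; rewrite ltNge => /negP; apply.
    apply/mx_norm_leP => [|i j]; first exact: ltW.
    have /negP := H j; rewrite -leNgt; apply: le_trans.
    by have := ler_entry_norm (col j x) i 0; rewrite mxE.
  rewrite /g (bigD1 i)//= min_l; last by rewrite ler_pdivlMr// mul1r ltW.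
  apply: ler_wpDr; last by case/andP: (phi01 x).
  by apply: sumr_ge0 => j _; rewrite le_min ler01 nn.
elim: k {phi cphi phi01 phiz} => [|k IH]; first by rewrite /= /g big_ord0 !mul0r.
have step x : condE (@g k.+1) x <= g k x + C / r.
  rewrite -[X in X + _]supE_cst addrC; apply: le_trans (lerD (hC r r0) (lexx _)).
  apply: le_trans (supED cm (Cblip_cst 1 (g k x))).
  apply: supE_mono; [exact: Cblip_snoc|apply: CblipD => //; exact: Cblip_cst|].
  move=> y; rewrite /g big_ord_recr/= snocK_last addrC lerD2l.
  apply: ler_sum => i _; rewrite [X in col X _](_ : _ = lift ord_max i).
    rewrite (_ : col _ _ = col i x)//.
    by apply/matrixP => i' j'; rewrite !mxE liftK.
  by apply/val_inj; rewrite /= /bump leqNgt ltn_ord add0n.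
rewrite ElipS; apply: (@le_trans _ _ (Elip F (fun x => g k x + C / r))).
  apply: Elip_mono => //; first exact: Cblip_condE.
  by apply: CblipD => //; exact: Cblip_cst.
apply: le_trans (ElipD (cg k) (Cblip_cst k (C / r))) _.
by rewrite Elip_cst -natr1 2!mulrDl mul1r lerD2r.
Qed.

End SublinearExpectation.

(** * Probability measures on the sample space and the law of the noise path *)

Section Noise.
Context {R : realType} {Omega : pointedType} {d : nat} {Theta : Type}.
Variables (W : nat -> Omega -> 'cV[R]_d) (F : Theta -> probability (borelM R d 1) R).
Variable N : nat.

Lemma noise_measurable k j i : (1 <= j <= k)%N ->
  measurable_fun [set: OmegaF W k] (fun w => W j w i 0).
Proof.
move=> jk _ B mB; rewrite setTI; apply: sub_sigma_algebra.
exists j => //; exists ((fun y : 'cV[R]_d => y i 0) @^-1` B) => //.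
rewrite -[X in measurable X]setTI.
have : measurable_fun [set: borelM R d 1] (fun y : 'cV[R]_d => y i 0).
  apply: borelM_continuous_measurable => y P /nbhs_ballP[e /= e0 eP].
  apply/nbhs_ballP; exists e => //= z; rewrite -ball_normE /= => yz.
  apply: eP; rewrite -ball_normE /=; apply: le_lt_trans yz.
  by have := ler_entry_norm (y - z) i 0; rewrite !mxE.
exact.
Qed.

Lemma Wpath_measurable k j : (j <= k)%N ->
  @measurable_fun _ _ (OmegaF W k) (borelM R d j) setT (Wpath W j).
Proof.
move=> jk; apply: measurable_fun_borelM => i l.
under eq_fun do rewrite mxE.
by apply: noise_measurable; rewrite /= (leq_trans (ltn_ord l)).
Qed.

Lemma Cblip_Wpath_measurable k j phi : (j <= k)%N -> @Cblip R d j phi ->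
  measurable_fun [set: OmegaF W k] (fun w => phi (Wpath W j w)).
Proof.
move=> jk cphi; apply: (@measurableT_comp _ _ _ _ (borelM R d j)).
  exact: Cblip_measurable.
exact: Wpath_measurable.
Qed.

Lemma filtration_mono j k (X : Omega -> R) : (j <= k)%N ->
  measurable_fun [set: OmegaF W j] X -> measurable_fun [set: OmegaF W k] X.
Proof.
move=> jk mX _ B mB; have := mX measurableT _ mB.
apply: sub_sigma_algebra2 => _ [i /= /andP[i1 ij] [A mA <-]].
by exists i; [rewrite /= i1 (leq_trans ij)|exists A].
Qed.

Lemma Wpath_col' k w : col' ord_max (Wpath W k.+1 w) = Wpath W k w.
Proof. by apply/matrixP => i j; rewrite !mxE /= /bump leqNgt ltn_ord. Qed.

Lemma Wpath_col_max k w : col ord_max (Wpath W k.+1 w) = W k.+1 w.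
Proof. by apply/matrixP => i j; rewrite !mxE ord1. Qed.

Hypothesis Theta_inh : inhabited Theta.
Hypothesis F_A2 : A2 F.
Hypothesis W_A3 : A3 W F N.

Lemma Cblip_extend k m (phi : 'M[R]_(d, k) -> R) : (k <= m)%N -> Cblip phi ->
  exists phi' : 'M[R]_(d, m) -> R, [/\ Cblip phi',
    forall w, phi' (Wpath W m w) = phi (Wpath W k w) & Elip F phi' = Elip F phi].
Proof.
move=> /subnKC <-; elim: (m - k)%N => [|i IH] cphi; first by rewrite addn0; exists phi.
have [psi [cpsi Wpsi Epsi]] := IH cphi.
rewrite addnS; exists (fun x => psi (col' ord_max x)); split.
- by apply: Cblip_comp => //; exact: col'_lip.
- by move=> w; rewrite Wpath_col'.
- by rewrite Elip_col'.
Qed.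

Lemma Wpath_integrable (P : probability (OmegaF W N) R) k phi : (k <= N)%N ->
  @Cblip R d k phi -> P.-integrable setT (fun w => (phi (Wpath W k w))%:E).
Proof.
move=> kN cphi; apply: measurable_bounded_integrable => //.
- exact: fin_num_fun_lty.
- exact: Cblip_Wpath_measurable.
- have [C C0 bC] := Cblip_norm_bound cphi.
  exists C; split; first exact: num_real.
  by move=> x Cx w _; exact: le_trans (bC _) (ltW Cx).
Qed.

Lemma calP_Elip (P : probability (OmegaF W N) R) k phi : calP W F N P ->
  (k <= N)%N -> @Cblip R d k phi ->
  (\int[P]_w (phi (Wpath W k w))%:E <= (Elip F phi)%:E)%E.
Proof.
move=> PP kN cphi; have [psi [cpsi Wpsi <-]] := Cblip_extend kN cphi.
have := PP _ cpsi; rewrite unlock; apply: le_trans.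
by under eq_integral do rewrite -Wpsi.
Qed.

(** Domination by [Elip] yields positivity, total mass 1 and tightness of l, and also places the
    Riesz measure in [calA]. *)
Lemma represent (l : ('M[R]_(d, N) -> R) -> R) : linear_on (@Cblip R d N) l ->
  (forall phi, Cblip phi -> l phi <= Elip F phi) ->
  exists2 P : probability (OmegaF W N) R, calP W F N P &
    forall phi, Cblip phi -> (\int[P]_w (phi (Wpath W N w))%:E = (l phi)%:E)%E.
Proof.
move=> llin lE.
have c1 := Cblip_cst (R := R) (d := d) N 1.
have lN phi : Cblip phi -> l (fun x => - phi x) = - l phi.
  move=> cphi; have := llin (-2) phi phi cphi cphi.
  rewrite (_ : -2 *: phi + phi = fun x => - phi x); last first.
    by apply/funext => x; change (-2 * phi x + phi x = - phi x); ring.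
  by move=> ->; ring.
have [Q hQ] : exists Q : probability (borelM R d N) R,
    forall phi, Cblip phi -> (\int[Q]_x (phi x)%:E = (l phi)%:E)%E.
  apply: riesz_Cblip => //.
  - move=> phi cphi phi0; rewrite -lerN2 oppr0 -lN//.
    have cN : Cblip (fun x => - phi x).
      by rewrite (_ : (fun x => _) = fun x => -1 * phi x);
        [exact: CblipZ|apply/funext => x; rewrite mulN1r].
    apply: le_trans (lE _ cN) _; rewrite -(Elip_cst F Theta_inh N 0).
    apply: Elip_mono => //; first exact: Cblip_cst.
    by move=> x; rewrite oppr_le0.
  - apply/eqP; rewrite eq_le; apply/andP; split.
      by rewrite (le_trans (lE _ c1))// Elip_cst.
    rewrite -lerN2 -lN// (le_trans (lE _ (Cblip_cst N (-1))))//.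
    by rewrite Elip_cst.
  - move=> e e0; have [C C0 hC] := Elip_tail Theta_inh F_A2 N.
    (* The constant of [Elip_tail] may vanish; adding 1 makes the radius positive. *)
    have C1 : 0 < C + 1 by rewrite ltr_wpDl.
    exists ((C + 1) / e) => phi cphi phi01 phiz.
    apply: le_trans (lE _ cphi) _.
    apply: le_trans (hC ((C + 1) / e) _ phi cphi phi01 phiz) _.
      by rewrite divr_gt0.
    by rewrite invf_div mulrCA ler_piMr ?ltW// ltr_pdivrMr// mul1r ltrDl.
have QA : calA F Q.
  by move=> phi cphi; rewrite unlock hQ// lee_fin; exact: lE.
have [P PQ] := W_A3 QA.
have PE phi : Cblip phi -> (\int[P]_w (phi (Wpath W N w))%:E = (l phi)%:E)%E.
  move=> cphi; rewrite -hQ//.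
  pose mW := Wpath_measurable (leqnn N).
  pose fW : {mfun OmegaF W N >-> borelM R d N} :=
    HB.pack (Wpath W N : OmegaF W N -> borelM R d N)
      (isMeasurableFun.Build _ _ _ _ _ mW).
  rewrite (@eq_measure_integral _ _ _ _ (pushforward P fW)); last first.
    by move=> A mA _; exact: PQ.
  rewrite integral_pushforward//.
  - by apply/measurable_EFinP; exact: Cblip_measurable.
  - exact: Wpath_integrable.
exists P => // phi cphi; rewrite unlock PE// lee_fin; exact: lE.
Qed.

(** Hahn-Banach with the constraints reduced to one ray. It shows that [calP] is nonempty and that
    the upper expectation over [calP] agrees with the iterated one on [Cblip]. *)
Lemma Elip_attained phi : @Cblip R d N phi ->
  exists2 P : probability (OmegaF W N) R, calP W F N P &
    (\int[P]_w (phi (Wpath W N w))%:E = (Elip F phi)%:E)%E.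
Proof.
move=> cphi.
pose C (c : 'M[R]_(d, N) -> R) r :=
  exists2 a, 0 <= a & c = (fun x => a * phi x) /\ r = a * Elip F phi.
have [||c r c' r' [a a0 [-> ->]] [a' a'0 [-> ->]]|a c r a0 [a' a'0 [-> ->]]|l [llin lE lC]] :=
  hahn_banach_cone (Cblip_linear_set N) (Elip_sublinear F Theta_inh N) (C := C).
- move=> c r [a a0 [-> ->]]; split; first exact: CblipZ.
  by rewrite ElipZ.
- by exists 0 => //; split; [apply/funext => x; rewrite mul0r|rewrite mul0r].
- exists (a + a'); first exact: addr_ge0.
  by split; [apply/funext => x; rewrite mulrDl|rewrite mulrDl].
- exists (a * a'); first exact: mulr_ge0.
  split; last by rewrite mulrA.
  by apply/funext => x; rewrite -mulrA.
have [P PP PE] := represent llin lE; exists P => //; rewrite PE//; congr EFin.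
apply/eqP; rewrite eq_le lE//=; apply: lC; exists 1 => //.
by split; [apply/funext => x; rewrite mul1r|rewrite mul1r].
Qed.

Lemma calP_nonempty : exists P : probability (OmegaF W N) R, calP W F N P.
Proof.
by have [P PP _] := Elip_attained (Cblip_cst (R := R) (d := d) N 0); exists P.
Qed.

(** Converse of [calP_Elip]: a bound known under every measure of [calP] passes to the iterated
    expectation. *)
Lemma Elip_le_of_calP k phi (c : R) : (k <= N)%N -> @Cblip R d k phi ->
  (forall P, calP W F N P -> (\int[P]_w (phi (Wpath W k w))%:E <= c%:E)%E) ->
  Elip F phi <= c.
Proof.
move=> kN cphi h; have [psi [cpsi Wpsi <-]] := Cblip_extend kN cphi.
have [P PP PE] := Elip_attained cpsi.
rewrite -lee_fin -PE; under eq_integral do rewrite Wpsi; exact: h.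
Qed.

(* W_(k+1) is independent of (W_1, ..., W_k) under the sublinear expectation. *)
Lemma calP_noise_bound P k phi g (c e : R) : calP W F N P -> (k < N)%N ->
  @Cblip R d k phi -> (forall x, 0 <= phi x) ->
  @Cblip R d 1 g -> (forall y, 0 <= g y) ->
  (forall P', calP W F N P' -> (\int[P']_w (phi (Wpath W k w))%:E <= e%:E)%E) ->
  (forall P', calP W F N P' -> (\int[P']_w (g (W k.+1 w))%:E <= c%:E)%E) ->
  (\int[P]_w (phi (Wpath W k w) * g (W k.+1 w))%:E <= (c * e)%:E)%E.
Proof.
move=> PP kN cphi phi0 cg g0 phie gc.
pose gl (x : 'M[R]_(d, k.+1)) := g (col ord_max x).
pose pl (x : 'M[R]_(d, k.+1)) := phi (col' ord_max x).
have cgl : Cblip gl by apply: (Cblip_comp (h := col ord_max)) => //; exact: col_lip.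
have cpl : Cblip pl.
  by apply: (Cblip_comp (h := col' ord_max)) => //; exact: col'_lip.
have Egl : Elip F gl = supE F g.
  rewrite ElipS -[RHS](Elip_cst F Theta_inh k); congr Elip; apply/funext => x.
  by congr supE; apply/funext => y; rewrite /gl snocK_last.
have sg0 : 0 <= supE F g.
  rewrite -(supE_cst F Theta_inh 0); apply: supE_mono => //; exact: Cblip_cst.
have sgc : supE F g <= c.
  rewrite -Egl; apply: (Elip_le_of_calP kN cgl) => P' PP'.
  by under eq_integral do rewrite /gl Wpath_col_max; exact: gc.
have Ephi : Elip F phi <= e by apply: (Elip_le_of_calP (ltnW kN) cphi).
have Ephi0 : 0 <= Elip F phi.
  rewrite -(Elip_cst F Theta_inh k 0); apply: Elip_mono => //; exact: Cblip_cst.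
have := calP_Elip PP kN (CblipM cpl cgl).
under eq_integral do rewrite /pl /gl Wpath_col' Wpath_col_max.
move=> /le_trans; apply; rewrite lee_fin.
(* Once the past x is given, phi x is a nonnegative constant and comes out of [supE]. *)
have -> : Elip F (fun x => pl x * gl x) = Elip F (fun x => supE F g * phi x).
  rewrite ElipS; congr Elip; apply/funext => x.
  rewrite /condE mulrC -supEZ//; congr supE; apply/funext => y.
  by rewrite /pl /gl snocK snocK_last.
by rewrite ElipZ//; apply: ler_pM.
Qed.

End Noise.

(** * The classes L_c^p *)

Lemma measurable_normX d (T : measurableType d) (R : realType) (f : T -> R) p :
  measurable_fun setT f -> measurable_fun setT (fun x => `|f x| ^+ p).
Proof. by move=> mf; apply: measurable_funX; exact: measurableT_comp. Qed.

(** The crude constant 2 ^ p, from |x + y| <= 2 max(|x|, |y|), stands in for Minkowski's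
    inequality. *)
Lemma ler_normD_exp (R : realType) (p : nat) (x y : R) :
  `|x + y| ^+ p <= 2 ^+ p * `|x| ^+ p + 2 ^+ p * `|y| ^+ p.
Proof.
have mx (a b : R) : 0 <= a -> a <= b -> (a + b) ^+ p <= 2 ^+ p * a ^+ p + 2 ^+ p * b ^+ p.
  move=> a0 ab; have b0 := le_trans a0 ab.
  apply: (@le_trans _ _ ((2 * b) ^+ p)).
    by rewrite lerXn2r ?nnegrE ?addr_ge0 ?mulr_ge0//; lra.
  by rewrite exprMn lerDr mulr_ge0 ?exprn_ge0.
apply: (@le_trans _ _ ((`|x| + `|y|) ^+ p)).
  by rewrite lerXn2r ?nnegrE ?addr_ge0// ler_normD.
have [h|/ltW h] := leP `|x| `|y|; first exact: mx.
by rewrite addrC [leRHS]addrC; exact: mx.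
Qed.

Section UniformIntegrability.
Context {R : realType} {Omega : pointedType} {d : nat} {Theta : Type}.
Variables (W : nat -> Omega -> 'cV[R]_d) (F : Theta -> probability (borelM R d 1) R).
Variable N : nat.
Local Notation calP := (calP W F N).
Local Notation meas := (measurable_fun [set: OmegaF W N]).
Implicit Types (X Y Z : Omega -> R) (c e : R).

(** A bound on E |X|, kept as one inequality for each measure so that integrals are compared under a
    fixed P. *)
Definition mean_le X c : Prop :=
  forall P, calP P -> (\int[P]_w (`|X w|)%:E <= c%:E)%E.

Lemma mean_leW X c c' : c <= c' -> mean_le X c -> mean_le X c'.
Proof. by move=> cc' h P PP; apply: le_trans (h P PP) _; rewrite lee_fin. Qed.

Lemma mean_le_dom2 Z X Y a b c c' : meas Z -> meas X -> meas Y ->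
  0 <= a -> 0 <= b -> (forall w, `|Z w| <= a * `|X w| + b * `|Y w|) ->
  mean_le X c -> mean_le Y c' -> mean_le Z (a * c + b * c').
Proof.
move=> mZ mX mY a0 b0 le hX hY P PP.
have mXn : measurable_fun [set: OmegaF W N] (fun w => (`|X w|)%:E).
  by apply/measurable_EFinP; exact: measurableT_comp.
have mYn : measurable_fun [set: OmegaF W N] (fun w => (`|Y w|)%:E).
  by apply/measurable_EFinP; exact: measurableT_comp.
apply: (@le_trans _ _ (\int[P]_w (a%:E * (`|X w|)%:E + b%:E * (`|Y w|)%:E))%E).
  apply: ge0_le_integral => //.
  - by apply/measurable_EFinP; exact: measurableT_comp.
  - by apply: emeasurable_funD; exact: measurable_funeM.
  - by move=> w _; rewrite -!EFinM -EFinD lee_fin.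
rewrite ge0_integralD//; last 4 first.
- by move=> w _; rewrite mule_ge0 ?lee_fin.
- exact: measurable_funeM.
- by move=> w _; rewrite mule_ge0 ?lee_fin.
- exact: measurable_funeM.
rewrite !ge0_integralZl// ?lee_fin// EFinD !EFinM; apply: leeD.
  by apply: lee_wpmul2l; rewrite ?lee_fin//; exact: hX.
by apply: lee_wpmul2l; rewrite ?lee_fin//; exact: hY.
Qed.

Lemma mean_le_cst c : 0 <= c -> mean_le (fun=> c) c.
Proof.
move=> c0 P PP; rewrite ger0_norm// integral_cst// [X in (_ * X)%E](_ : _ = 1%E) ?mule1//.
exact: probability_setT.
Qed.

Lemma mean_le_dom Z X a c : meas Z -> meas X -> 0 <= a ->
  (forall w, `|Z w| <= a * `|X w|) -> mean_le X c -> mean_le Z (a * c).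
Proof.
move=> mZ mX a0 le hX; rewrite -[a * c]addr0 -[X in _ + X](mul0r c).
by apply: (mean_le_dom2 mZ mX mX) => // w; rewrite mul0r addr0.
Qed.

Lemma mean_le_mono Z X c : meas Z -> meas X ->
  (forall w, `|Z w| <= `|X w|) -> mean_le X c -> mean_le Z c.
Proof.
move=> mZ mX le hX; rewrite -[c]mul1r.
by apply: (mean_le_dom mZ mX) => // w; rewrite mul1r.
Qed.

Lemma mean_le_dom_cst Z X a b c : meas Z -> meas X -> 0 <= a -> 0 <= b ->
  (forall w, `|Z w| <= a + b * `|X w|) -> mean_le X c -> mean_le Z (a + b * c).
Proof.
move=> mZ mX a0 b0 le hX; rewrite -[a]mulr1.
apply: (mean_le_dom2 mZ _ mX _ _ _ (mean_le_cst ler01)) => // w.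
by rewrite normr1 mulr1.
Qed.

Lemma mean_le_sum2 Z X Y c : meas Z -> meas X -> meas Y ->
  (forall w, `|Z w| <= `|X w| + `|Y w|) ->
  mean_le X (c / 2) -> mean_le Y (c / 2) -> mean_le Z c.
Proof.
move=> mZ mX mY le hX hY; have -> : c = 1 * (c / 2) + 1 * (c / 2) by field.
by apply: (mean_le_dom2 mZ mX mY) => // w; rewrite !mul1r.
Qed.

(* L_c^p(F_k) up to a polar set. *)
Definition lipL (p k : nat) X : Prop := meas X /\
  forall e, 0 < e -> exists2 phi, Cblip phi &
    mean_le (fun w => `|X w - phi (Wpath W k w)| ^+ p) e.

Section FixedTime.
Variable k : nat.
Hypothesis kN : (k <= N)%N.

Lemma Cblip_meas phi : @Cblip R d k phi -> meas (fun w => phi (Wpath W k w)).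
Proof. exact: Cblip_Wpath_measurable. Qed.

Lemma lipL_Cblip p phi : (0 < p)%N -> @Cblip R d k phi ->
  lipL p k (fun w => phi (Wpath W k w)).
Proof.
move=> p0 cphi; split=> [|e e0]; first exact: Cblip_meas.
exists phi => //; apply: (mean_leW (ltW e0)).
rewrite (_ : (fun w => _) = fun=> 0); first exact: mean_le_cst.
by apply/funext => w; rewrite subrr normr0 expr0n eqn0Ngt p0.
Qed.

Lemma lipL_cst p c : (0 < p)%N -> lipL p k (fun=> c).
Proof. by move=> p0; exact: (lipL_Cblip p0 (Cblip_cst k c)). Qed.

Let mdist p X phi : meas X -> @Cblip R d k phi ->
  meas (fun w => `|X w - phi (Wpath W k w)| ^+ p).
Proof.
move=> mX cphi; apply: measurable_normX; apply: measurable_funB => //.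
exact: Cblip_meas.
Qed.

Lemma lipL_lin p a X Y : lipL p k X -> lipL p k Y ->
  lipL p k (fun w => a * X w + Y w).
Proof.
move=> [mX hX] [mY hY]; split.
  by apply: measurable_funD => //; exact: measurable_funM.
(* The added 1 keeps [A] positive when a = 0. *)
move=> e e0; pose A : R := 2 ^+ p * (`|a| ^+ p + 1).
have p20 : 0 < 2 ^+ p :> R by rewrite exprn_gt0.
have A0 : 0 < A by rewrite mulr_gt0// ltr_wpDl// exprn_ge0.
have [phi cphi hphi] := hX (e / 2 / A) (divr_gt0 (divr_gt0 e0 (ltr0Sn R 1)) A0).
have [psi cpsi hpsi] := hY (e / 2 / 2 ^+ p) (divr_gt0 (divr_gt0 e0 (ltr0Sn R 1)) p20).
exists (fun x => a * phi x + psi x); first exact: Cblip_lin.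
rewrite [e]splitr.
rewrite -[X in X + _](@divfK _ A) ?gt_eqF// -[X in _ + X](@divfK _ (2 ^+ p)) ?gt_eqF//.
rewrite [X in X + _]mulrC [X in _ + X]mulrC.
apply: (mean_le_dom2 _ _ _ _ _ _ hphi hpsi).
- apply: (@mdist p (fun w => a * X w + Y w) (fun x => a * phi x + psi x)).
    by apply: measurable_funD => //; exact: measurable_funM.
  exact: Cblip_lin.
- exact: mdist.
- exact: mdist.
- exact: ltW.
- exact: ltW.
move=> w; rewrite !normrX !normr_id.
have -> : a * X w + Y w - (a * phi (Wpath W k w) + psi (Wpath W k w)) =
  a * (X w - phi (Wpath W k w)) + (Y w - psi (Wpath W k w)) by ring.
apply: le_trans (ler_normD_exp _ _ _) _; rewrite lerD2r normrM exprMn mulrA.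
by rewrite ler_wpM2r ?exprn_ge0// /A mulrDr lerDl mulr1 ltW.
Qed.

Lemma lipLD p X Y : lipL p k X -> lipL p k Y -> lipL p k (fun w => X w + Y w).
Proof.
move=> hX hY; rewrite (_ : (fun w => _) = fun w => 1 * X w + Y w).
  exact: lipL_lin.
by apply/funext => w; rewrite mul1r.
Qed.

Lemma lipLZ p a X : (0 < p)%N -> lipL p k X -> lipL p k (fun w => a * X w).
Proof.
move=> p0 hX; rewrite (_ : (fun w => _) = fun w => a * X w + 0).
  by apply: lipL_lin => //; exact: lipL_cst.
by apply/funext => w; rewrite addr0.
Qed.

Lemma lipLB p X Y : lipL p k X -> lipL p k Y -> lipL p k (fun w => X w - Y w).
Proof.
move=> hX hY; rewrite (_ : (fun w => _) = fun w => -1 * Y w + X w).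
  exact: lipL_lin.
by apply/funext => w; rewrite mulN1r addrC.
Qed.

Lemma lipL_sum p (I : Type) (s : seq I) (X : I -> Omega -> R) : (0 < p)%N ->
  (forall i, lipL p k (X i)) -> lipL p k (fun w => \sum_(i <- s) X i w).
Proof.
move=> p0 hX; elim: s => [|i s IH].
  by under eq_fun do rewrite big_nil; exact: lipL_cst.
by under eq_fun do rewrite big_cons; exact: lipLD.
Qed.

Lemma lipL_abs p X : lipL p k X -> lipL p k (fun w => `|X w|).
Proof.
move=> [mX hX]; split; first exact: measurableT_comp.
move=> e /hX[phi cphi hphi]; exists (fun x => `|phi x|); first exact: Cblip_abs.
apply: mean_le_mono hphi; [|exact: mdist|].
  apply: (@mdist p (fun w => `|X w|) (fun x => `|phi x|)).
    exact: measurableT_comp.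
  exact: Cblip_abs.
move=> w; rewrite !normrX !normr_id lerXn2r ?nnegrE//.
exact: ler_dist_dist.
Qed.

Lemma lipL_min p X Y : (0 < p)%N -> lipL p k X -> lipL p k Y ->
  lipL p k (fun w => Num.min (X w) (Y w)).
Proof.
move=> p0 hX hY; under eq_fun do rewrite min_abs.
apply: lipLZ => //; apply: lipLB; first exact: lipLD.
by apply: lipL_abs; exact: lipLB.
Qed.

Lemma lipL_max p X Y : (0 < p)%N -> lipL p k X -> lipL p k Y ->
  lipL p k (fun w => Num.max (X w) (Y w)).
Proof.
move=> p0 hX hY; under eq_fun do rewrite max_abs.
apply: lipLZ => //; apply: lipLD; first exact: lipLD.
by apply: lipL_abs; exact: lipLB.
Qed.

Lemma lipL_lim p X : meas X ->
  (forall e, 0 < e -> exists2 Y, lipL p k Y & mean_le (fun w => `|X w - Y w| ^+ p) e) ->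
  lipL p k X.
Proof.
move=> mX hX; split=> // e e0.
have p20 : 0 < 2 ^+ p :> R by rewrite exprn_gt0.
have e1 : 0 < e / 2 / 2 ^+ p by rewrite !divr_gt0.
have [Y [mY hY] XY] := hX _ e1; have [phi cphi hphi] := hY _ e1.
exists phi => //; rewrite [e]splitr -[e / 2](@divfK _ (2 ^+ p)) ?gt_eqF//.
rewrite mulrC.
apply: (mean_le_dom2 _ _ _ _ _ _ XY hphi); [exact: mdist| |exact: mdist|exact: ltW|exact: ltW|].
  by apply: measurable_normX; exact: measurable_funB.
move=> w; rewrite !normrX !normr_id.
by have := ler_normD_exp p (X w - Y w) (Y w - phi (Wpath W k w)); rewrite addrA subrK.
Qed.

Lemma lipL_bound p X : lipL p k X ->
  exists2 C : R, 0 <= C & mean_le (fun w => `|X w| ^+ p) C.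
Proof.
move=> [mX hX]; have [phi cphi hphi] := hX 1 ltr01.
have [B B0 bB] := Cblip_norm_bound cphi.
have p20 : 0 <= 2 ^+ p :> R by rewrite exprn_ge0.
exists (2 ^+ p * B ^+ p + 2 ^+ p * 1).
  by rewrite addr_ge0// mulr_ge0// exprn_ge0// ltW.
apply: (mean_le_dom_cst _ _ _ _ _ hphi) => //.
- exact: measurable_normX.
- exact: mdist.
- by rewrite mulr_ge0// exprn_ge0// ltW.
move=> w; rewrite !normrX !normr_id.
have := ler_normD_exp p (phi (Wpath W k w)) (X w - phi (Wpath W k w)).
rewrite addrC subrK => /le_trans; apply; rewrite lerD2r ler_wpM2l//.
by rewrite lerXn2r ?nnegrE// ltW.
Qed.

(* Dominated convergence, uniformly over the measures of calP: a bounded Lipschitz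
   approximation phi of G takes over where G exceeds twice the bound of phi. *)
Lemma uniform_domination p G e : lipL p k G -> 0 < e ->
  exists2 K : R, 0 < K & forall Z, meas Z -> (forall w, 0 <= Z w <= `|G w| ^+ p) ->
    (forall w, `|G w| <= K -> Z w <= e / 2) -> mean_le Z e.
Proof.
move=> [mG hG] e0; have p20 : 0 < 2 ^+ p :> R by rewrite exprn_gt0.
have [phi cphi hphi] := hG (e / 2 / 2 ^+ p) (divr_gt0 (divr_gt0 e0 (ltr0Sn R 1)) p20).
have [B B0 bB] := Cblip_norm_bound cphi.
exists (2 * B); first by rewrite mulr_gt0.
move=> Z mZ ZG Zsmall.
rewrite [e]splitr -[X in _ + X](@divfK _ (2 ^+ p)) ?gt_eqF// [X in _ + X]mulrC.
apply: (mean_le_dom_cst mZ _ _ _ _ hphi); [exact: mdist|exact/ltW/divr_gt0|exact: ltW|].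
move=> w; have /andP[Z0 ZG'] := ZG w; rewrite (ger0_norm Z0) normrX normr_id.
have [GK|GK] := leP `|G w| (2 * B).
  by apply: ler_wpDr; [rewrite mulr_ge0 ?exprn_ge0|exact: Zsmall].
apply: ler_wpDl; first by rewrite ltW// divr_gt0.
apply: le_trans ZG' _; rewrite -exprMn lerXn2r ?nnegrE ?mulr_ge0//.
have := bB (Wpath W k w); have := ler_normD (G w - phi (Wpath W k w)) (phi (Wpath W k w)).
by rewrite subrK; lra.
Qed.

End FixedTime.

Lemma lipL_mono p k m X : (k <= m)%N -> (m <= N)%N -> lipL p k X -> lipL p m X.
Proof.
move=> km mN [mX hX]; split=> // e /hX[phi cphi hphi].
have [psi cpsi Wpsi] : exists2 psi : 'M[R]_(d, m) -> R, Cblip psi &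
    forall w, psi (Wpath W m w) = phi (Wpath W k w).
  move: km; clear -cphi => /subnKC <-.
  elim: (m - k)%N => [|i [psi cpsi Wpsi]]; first by rewrite addn0; exists phi.
  rewrite addnS; exists (fun x => psi (col' ord_max x)).
    by apply: Cblip_comp => //; exact: col'_lip.
  by move=> w; rewrite Wpath_col'.
by exists psi => //; under eq_fun do rewrite Wpsi.
Qed.

(** Young's inequality u <= e / 2 + u ^ 2 / (2 e) turns a square-mean error e ^ 2 into a mean error
    e. *)
Lemma lipL_2_1 k X : (k <= N)%N -> lipL 2 k X -> lipL 1 k X.
Proof.
move=> kN [mX hX]; split=> // e e0; have [phi cphi hphi] := hX _ (exprn_gt0 2 e0).
exists phi => //.
have -> : e = e / 2 + (e^-1 / 2) * e ^+ 2 by field; rewrite gt_eqF.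
have mD : meas (fun w => X w - phi (Wpath W k w)).
  by apply: measurable_funB => //; exact: Cblip_meas.
apply: (mean_le_dom_cst _ _ _ _ _ hphi).
- by apply: measurable_normX.
- by apply: measurable_normX.
- by rewrite divr_ge0// ltW.
- by rewrite divr_ge0// invr_ge0 ltW.
move=> w; rewrite expr1 normrX !normr_id.
move: (`|_|) (normr_ge0 (X w - phi (Wpath W k w))) => u u0.
rewrite -(ler_pM2l e0).
have -> : e * (e / 2 + e^-1 / 2 * u ^+ 2) = (e ^+ 2 + u ^+ 2) / 2.
  by field; rewrite gt_eqF.
have := sqr_ge0 (u - e); rewrite !expr2; nra.
Qed.

(** X Y - phi psi = (X - phi) Y + phi (Y - psi). A weighted Young inequality handles the first
    product; phi is chosen before psi, so the accuracy of psi may depend on the bound of phi. *)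
Lemma lipL_mul k X Y : (k <= N)%N -> lipL 2 k X -> lipL 2 k Y ->
  lipL 1 k (fun w => X w * Y w).
Proof.
move=> kN hX hY; have [mX aX] := hX; have [mY aY] := hY.
split; first exact: measurable_funM.
move=> e e0; have [C C0 bY] := lipL_bound kN hY.
have C1 : 0 < C + 1 by rewrite ltr_wpDl.
(* Weight in u v <= u ^ 2 / (2 s) + s v ^ 2 / 2, small enough that the term carrying the bound [C]
   of Y costs at most e / 4. *)
pose s := e / 2 / (C + 1).
have s0 : 0 < s by rewrite !divr_gt0.
have [phi cphi hphi] := aX (s * (e / 2)) (mulr_gt0 s0 (divr_gt0 e0 (ltr0Sn R 1))).
have [B B0 bB] := Cblip_norm_bound cphi.
have [psi cpsi hpsi] := (lipL_2_1 kN hY).2 (e / 2 / B) (divr_gt0 (divr_gt0 e0 (ltr0Sn R 1)) B0).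
exists (fun x => phi x * psi x); first exact: CblipM.
have mphi := Cblip_meas kN cphi; have mpsi := Cblip_meas kN cpsi.
pose Q w := (X w - phi (Wpath W k w)) * Y w.
have mQ : meas Q by apply: measurable_funM => //; exact: measurable_funB.
pose Q' w := Y w - psi (Wpath W k w).
have mQ' : meas Q' by exact: measurable_funB.
have hQ : mean_le Q (e / 2).
  apply: (@mean_leW _ (s^-1 / 2 * (s * (e / 2)) + s / 2 * C)).
    have -> : s^-1 / 2 * (s * (e / 2)) = e / 4 by field; rewrite gt_eqF.
    have : s / 2 * C <= e / 4; last by lra.
    rewrite /s -[leRHS](@mulfK _ (C + 1)) ?gt_eqF//.
    rewrite [leLHS](_ : _ = e / 4 * C / (C + 1)); last by field; rewrite gt_eqF.
    rewrite ler_wpM2r ?invr_ge0 ?(ltW C1)// ler_wpM2l ?divr_ge0 ?(ltW e0)//.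
    by rewrite lerDl.
  apply: (mean_le_dom2 mQ _ _ _ _ _ hphi bY).
  - by apply: measurable_normX; exact: measurable_funB.
  - exact: measurable_normX.
  - by rewrite divr_ge0 ?invr_ge0 ?(ltW s0).
  - by rewrite divr_ge0 ?(ltW s0).
  move=> w; rewrite !normrX !normr_id /Q normrM.
  move: (`|X w - _|) (`|Y w|) => u v.
  rewrite -(ler_pM2l s0).
  have -> : s * (s^-1 / 2 * u ^+ 2 + s / 2 * v ^+ 2) = (u ^+ 2 + (s * v) ^+ 2) / 2.
    by field; rewrite gt_eqF.
  have := sqr_ge0 (u - s * v); rewrite !expr2; nra.
rewrite [e]splitr -[e / 2 in X in _ + X](@divfK _ B) ?gt_eqF//.
rewrite [X in _ + X]mulrC -[X in X + _]mul1r.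
apply: (mean_le_dom2 _ mQ mQ' _ _ _ hQ).
- apply: measurable_normX; apply: measurable_funB; first exact: measurable_funM.
  exact: measurable_funM.
- by [].
- exact: ltW.
- move=> w; rewrite expr1 normr_id mul1r.
  have -> : X w * Y w - phi (Wpath W k w) * psi (Wpath W k w) =
    Q w + phi (Wpath W k w) * Q' w by rewrite /Q /Q'; ring.
  by rewrite (le_trans (ler_normD _ _))// lerD2l normrM ler_wpM2r.
- apply: mean_le_mono hpsi => //; first exact: measurable_normX.
  by move=> w; rewrite expr1 normr_id.
Qed.

End UniformIntegrability.

(** * The completion spaces and multiplication by the noise *)

Section CompletionSpaces.
Context {R : realType} {Omega : pointedType} {d : nat} {Theta : Type}.
Variables (W : nat -> Omega -> 'cV[R]_d) (F : Theta -> probability (borelM R d 1) R).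
Variable N : nat.
Local Notation calP := (calP W F N).
Local Notation meas := (measurable_fun [set: OmegaF W N]).
Local Notation mean_le := (mean_le W F N).
Local Notation lipL := (lipL W F N).
Local Notation Ehat := (Ehat W F N).
Implicit Types (X Y Z : Omega -> R).

Lemma mean_le_EhatP Z (c : R) : (forall w, 0 <= Z w) ->
  mean_le Z c <-> (Ehat Z <= c%:E)%E.
Proof.
move=> Z0; have nZ w : `|Z w| = Z w by rewrite ger0_norm.
split=> [h|h P PP].
  apply: ge_ereal_sup => _ [P PP <-]; rewrite unlock.
  by have := h P PP; under eq_integral do rewrite nZ.
under eq_integral do rewrite nZ.
by apply: le_trans h; apply: ereal_sup_ubound; exists P => //; rewrite unlock.
Qed.

(** A supremum over an empty [calP] would be -oo, which is why nonemptiness accompanies the norm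
    estimates. *)
Lemma Ehat_exp_ge0 p Z : (exists P, calP P) -> (0 <= Ehat (fun w => `|Z w| ^+ p)%R)%E.
Proof.
move=> [P PP]; apply: le_trans (_ : ('E_P[(fun w => `|Z w| ^+ p)%R] <= _)%E).
  by apply: expectation_ge0 => w; rewrite exprn_ge0.
by apply: ereal_sup_ubound; exists P.
Qed.

Lemma normp_lt p Z (e : R) : (0 < p)%N -> 0 < e -> (exists P, calP P) ->
  mean_le (fun w => `|Z w| ^+ p) ((e / 2) ^+ p) -> (normp W F N p Z < e%:E)%E.
Proof.
move=> p0 e0 neP /mean_le_EhatP h; have e20 : 0 < e / 2 by rewrite divr_gt0.
apply: (@le_lt_trans _ _ (e / 2)%:E); last by rewrite lte_fin; lra.
rewrite /normp; apply: (@le_trans _ _ ((((e / 2) ^+ p)%:E) `^ p%:R^-1)%E).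
  apply: gt0_ler_poweR.
  - by rewrite invr_ge0.
  - by rewrite in_itv/= Ehat_exp_ge0//= leey.
  - by rewrite in_itv/= lee_fin exprn_ge0 ?(ltW e20)//= leey.
  - by apply: h => w; rewrite exprn_ge0.
rewrite poweR_EFin -powR_mulrn ?(ltW e20)// -powRrM divff ?powRr1 ?(ltW e20)//.
by rewrite pnatr_eq0 -lt0n.
Qed.

Lemma lt_normp p Z (e : R) : (0 < p)%N -> 0 < e -> (exists P, calP P) ->
  (normp W F N p Z < e%:E)%E -> mean_le (fun w => `|Z w| ^+ p) (e ^+ p).
Proof.
move=> p0 e0 neP /ltW h; apply/mean_le_EhatP => [w|]; first by rewrite exprn_ge0.
have pR0 : p%:R != 0 :> R by rewrite pnatr_eq0 -lt0n.
rewrite -[leLHS]poweRe1 ?Ehat_exp_ge0// -(mulVf pR0) poweRrM.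
rewrite -powR_mulrn ?(ltW e0)// -poweR_EFin.
apply: gt0_ler_poweR => //.
- by rewrite in_itv/= poweR_ge0 leey.
- by rewrite in_itv/= lee_fin (ltW e0) leey.
Qed.

(** Closeness for [normp] becomes closeness in mean; what [lipL] alone forgets is the version
    measurable for F_k. *)
Lemma LcP p k X : (0 < p)%N -> (k <= N)%N -> (exists P, calP P) ->
  Lc W F N p k X <-> meas X /\ exists Y, [/\ measurable_fun [set: OmegaF W k] Y,
    lipL p k Y & qs_eq W F N X Y].
Proof.
move=> p0 kN neP; split=> -[mX [Y]].
  move=> [mY fY aY XY]; split=> //; exists Y; split=> //; split.
    exact: filtration_mono kN mY.
  (* As e1 <= 1, its p-th power is at most e1, hence at most e. *)
  move=> e e0; pose e1 := Num.min 1 e.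
  have e10 : 0 < e1 by rewrite lt_min ltr01.
  have [phi cphi /lt_normp h] := aY _ e10; exists phi => //.
  apply: mean_leW (h p0 e10 neP); apply: (@le_trans _ _ e1).
    by rewrite ler_iXnr ?(ltW e10)// ge_min lexx.
  by rewrite ge_min lexx orbT.
move=> [mY LY XY]; split=> //; exists Y; split=> //.
  have [C C0 /mean_le_EhatP h] := lipL_bound kN LY.
  by apply: le_lt_trans (h _) (ltry C) => w; rewrite exprn_ge0.
move=> e e0; have [_ aY] := LY.
have [phi cphi h] := aY _ (exprn_gt0 p (divr_gt0 e0 (ltr0Sn R 1))).
by exists phi => //; exact: normp_lt.
Qed.

Lemma Lc_lipL p k X : (0 < p)%N -> (k <= N)%N -> (exists P, calP P) ->
  Lc W F N p k X -> lipL p k X.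
Proof.
move=> p0 kN neP /(LcP _ p0 kN neP)[mX [Y [mY [mY' aY] [B [mB PB] XY]]]].
split=> // e /aY[phi cphi hphi]; exists phi => // P PP.
(* A polar set is null under each single measure of [calP], so passing from Y to X changes no
   integral. *)
have PB0 : P B = 0%E.
  apply/eqP; rewrite eq_le measure_ge0 andbT -PB.
  by apply: ereal_sup_ubound; exists P.
have mphi := Cblip_meas kN cphi.
have := hphi P PP; congr (_ <= _)%E; apply: ge0_ae_eq_integral => //.
- apply/measurable_EFinP; apply: measurableT_comp => //.
  by apply: measurable_normX; exact: measurable_funB.
- apply/measurable_EFinP; apply: measurableT_comp => //.
  by apply: measurable_normX; exact: measurable_funB.
exists B; split=> //; apply: subsetCl => w nB Dw /=.
by rewrite XY.
Qed.

Lemma qs_eq_lin a X Y X' Y' : qs_eq W F N X X' -> qs_eq W F N Y Y' ->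
  qs_eq W F N (fun w => a * X w + Y w) (fun w => a * X' w + Y' w).
Proof.
move=> [B [mB PB] XB] [C [mC PC] YC]; exists (B `|` C); last first.
  by move=> w nBC; rewrite XB ?YC// => h; apply: nBC; [right|left].
split; first exact: measurableU.
have [neP|neP] := pselect (exists P, calP P); last first.
  rewrite (_ : [set P (B `|` C) | P in calP] = [set P B | P in calP])//.
  by apply/seteqP; split=> _ [P PP <-]; exfalso; apply: neP; exists P.
apply/eqP; rewrite eq_le; apply/andP; split; last first.
  have [P PP] := neP; apply: le_trans (measure_ge0 P (B `|` C)) _.
  by apply: ereal_sup_ubound; exists P.
apply: ge_ereal_sup => _ [P PP <-].
have PB0 : (P B <= 0)%E by rewrite -PB; apply: ereal_sup_ubound; exists P.
have PC0 : (P C <= 0)%E by rewrite -PC; apply: ereal_sup_ubound; exists P.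
by rewrite (le_trans (measureU2 _ mB mC))// -[leRHS]adde0; exact: leeD.
Qed.

(** Admissibility of controls is stated with [Lc], so their convex combinations have to be formed
    there and not in [lipL]. *)
Lemma Lc_lin p k a X Y : (0 < p)%N -> (k <= N)%N -> (exists P, calP P) ->
  Lc W F N p k X -> Lc W F N p k Y -> Lc W F N p k (fun w => a * X w + Y w).
Proof.
move=> p0 kN neP /(LcP _ p0 kN neP)[mX [X' [mX' LX' XX']]].
move=> /(LcP _ p0 kN neP)[mY [Y' [mY' LY' YY']]]; apply/(LcP _ p0 kN neP); split.
  by apply: measurable_funD => //; exact: measurable_funM.
exists (fun w => a * X' w + Y' w); split.
- by apply: measurable_funD => //; exact: measurable_funM.
- exact: lipL_lin.
- exact: qs_eq_lin.
Qed.

Section NoiseMultiplication.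
Hypothesis Theta_inh : inhabited Theta.
Hypothesis F_A2 : A2 F.
Hypothesis W_A3 : A3 W F N.
Hypothesis W_Lc2 : noise_Lc2 W F N.

Let neP : exists P, calP P := calP_nonempty Theta_inh F_A2 W_A3.

Lemma lipL_W k i : (k < N)%N -> lipL 2 k.+1 (fun w => W k.+1 w i 0).
Proof. by move=> kN; apply: Lc_lipL => //; exact: W_Lc2. Qed.

(** Independence is available for bounded Lipschitz functions, so X is replaced by a function phi of
    the past and the noise is truncated at M. The resulting bound is uniform in M and survives
    monotone convergence under each fixed P. The factor 4 comes from using (x + y) ^ 2 <= 2 x ^ 2 +
    2 y ^ 2 twice. *)
Lemma mean_le_noise k i : (k < N)%N -> exists2 C : R, 0 <= C &
  forall X c, lipL 2 k X -> mean_le (fun w => `|X w| ^+ 2) c ->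
    mean_le (fun w => `|X w * W k.+1 w i 0| ^+ 2) (C * c).
Proof.
move=> kN; have [C C0 bC] := lipL_bound kN (lipL_W i kN).
exists (4 * C); first by rewrite mulr_ge0.
move=> X c [mX aX] hX P PP.
have mW : meas (fun w => W k.+1 w i 0) := (lipL_W i kN).1.
pose g (M : nat) (y : 'cV[R]_d) : R := Num.min M%:R `|y i 0| ^+ 2.
have gM M y : 0 <= g M y <= M%:R ^+ 2.
  by rewrite exprn_ge0 ?le_min ?ler0n//= lerXn2r ?nnegrE ?le_min ?ler0n ?ge_min ?lexx//=.
have gW M y : g M y <= `|y i 0| ^+ 2.
  by rewrite lerXn2r ?nnegrE ?le_min ?ler0n//= ge_min lexx orbT.
have cg M : @Cblip R d 1 (g M).
  have c1 : Cblip (fun y : 'cV[R]_d => Num.min M%:R `|y i 0|).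
    apply: (@Cblip_min_lip _ _ _ _ 1) => // x y; rewrite mul1r.
    rewrite (le_trans (ler_dist_dist _ _))//.
    by have := ler_entry_norm (x - y) i 0; rewrite !mxE.
  by rewrite (_ : g M = fun y => Num.min M%:R `|y i 0| * Num.min M%:R `|y i 0|);
    [exact: CblipM|apply/funext => y; rewrite /g expr2].
have mg M : meas (fun w => g M (W k.+1 w)).
  apply: measurable_funX; apply: measurable_minr => //; exact: measurableT_comp.
have step M : (\int[P]_w (X w ^+ 2 * g M (W k.+1 w))%:E <= (4 * C * c)%:E)%E.
  apply/lee_addgt0Pr => e e0; rewrite -EFinD.
  (* [D] collects the coefficients of the approximation error: 4 C from independence, 2 M ^ 2 from
     the truncated noise, and 1 for positivity. *)
  pose D : R := 4 * C + 2 * M%:R ^+ 2 + 1.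
  have D0 : 0 < D by rewrite ltr_wpDl// addr_ge0 ?mulr_ge0// exprn_ge0.
  have [phi cphi hphi] := aX (e / D) (divr_gt0 e0 D0).
  have mphi := Cblip_meas (ltnW kN) cphi.
  have mD : meas (fun w => `|X w - phi (Wpath W k w)| ^+ 2).
    by apply: measurable_normX; exact: measurable_funB.
  have cphi2 : Cblip (fun x => phi x ^+ 2).
    by under eq_fun do rewrite expr2; exact: CblipM.
  have mphi2 : meas (fun w => phi (Wpath W k w) ^+ 2) by exact: measurable_funX.
  have sqD (x y : R) : (x + y) ^+ 2 <= 2 * x ^+ 2 + 2 * y ^+ 2.
    by have := sqr_ge0 (x - y); rewrite !expr2; nra.
  have hphi2 : mean_le (fun w => phi (Wpath W k w) ^+ 2) (2 * c + 2 * (e / D)).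
    apply: (mean_le_dom2 _ _ _ _ _ _ hX hphi) => //; first exact: measurable_normX.
    move=> w; rewrite !normrX !normr_id !real_normK ?num_real//.
    have := sqD (X w) (phi (Wpath W k w) - X w).
    by rewrite [X w + _]addrC subrK -[(phi _ - _) ^+ 2]sqrrN opprB.
  have hpg : mean_le (fun w => phi (Wpath W k w) ^+ 2 * g M (W k.+1 w))
      (C * (2 * c + 2 * (e / D))).
    move=> P' PP'; under eq_integral => w _.
      rewrite ger0_norm; last first.
        by rewrite mulr_ge0 ?sqr_ge0//; case/andP: (gM M (W k.+1 w)).
      over.
    apply: (calP_noise_bound Theta_inh F_A2 W_A3 PP' kN cphi2 _ (cg M)).
    - by move=> x; exact: sqr_ge0.
    - by move=> y; case/andP: (gM M y).
    - move=> P'' PP''; have := hphi2 P'' PP''.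
      by under eq_integral do rewrite ger0_norm ?sqr_ge0//.
    move=> P'' PP''; apply: le_trans (bC P'' PP''); apply: ge0_le_integral => //.
    - by move=> w _; rewrite lee_fin; case/andP: (gM M (W k.+1 w)).
    - exact/measurable_EFinP.
    - apply/measurable_EFinP; apply: measurableT_comp => //; exact: measurable_normX.
    - by move=> w _; rewrite lee_fin normrX normr_id.
  have hXg : mean_le (fun w => X w ^+ 2 * g M (W k.+1 w))
      (2 * (C * (2 * c + 2 * (e / D))) + 2 * M%:R ^+ 2 * (e / D)).
    apply: (mean_le_dom2 _ _ _ _ _ _ hpg hphi) => //.
    - by apply: measurable_funM => //; exact: measurable_funX.
    - exact: measurable_funM.
    move=> w; have /andP[g0 g1] := gM M (W k.+1 w); move: (g M _) g0 g1 => t t0 t1.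
    rewrite !(ger0_norm (mulr_ge0 (sqr_ge0 _) t0)) normrX normr_id real_normK ?num_real//.
    move: (phi _) => y; have := sqD y (X w - y); rewrite addrC subrK => h.
    have hu : (X w - y) ^+ 2 * t <= M%:R ^+ 2 * (X w - y) ^+ 2.
      by rewrite mulrC ler_wpM2r// sqr_ge0.
    by apply: le_trans (ler_wpM2r t0 h) _; lra.
  have := hXg P PP; under eq_integral => w _.
    rewrite ger0_norm; last first.
      by rewrite mulr_ge0 ?sqr_ge0//; case/andP: (gM M (W k.+1 w)).
    over.
  move=> /le_trans; apply; rewrite lee_fin.
  have -> : 2 * (C * (2 * c + 2 * (e / D))) + 2 * M%:R ^+ 2 * (e / D) =
    4 * C * c + (D - 1) * (e / D) by rewrite /D; ring.
  rewrite lerD2l mulrC mulrAC -mulrA ler_piMr ?(ltW e0)//.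
  by rewrite ler_pdivrMr// mul1r gerDl lerN10.
have mXg M : measurable_fun [set: OmegaF W N]
    (fun w => (X w ^+ 2 * g M (W k.+1 w))%:E).
  by apply/measurable_EFinP; apply: measurable_funM => //; exact: measurable_funX.
have Xg0 M w : [set: OmegaF W N] w -> (0%:E <= (X w ^+ 2 * g M (W k.+1 w))%:E)%E.
  by move=> _; rewrite lee_fin mulr_ge0 ?sqr_ge0//; case/andP: (gM M (W k.+1 w)).
have Xgmono w : [set: OmegaF W N] w ->
    nondecreasing_seq (fun M => (X w ^+ 2 * g M (W k.+1 w))%:E).
  move=> _ M M' MM'; rewrite lee_fin ler_wpM2l ?sqr_ge0//.
  rewrite lerXn2r ?nnegrE ?le_min ?ler0n//=.
  by rewrite !ge_min lexx orbT andbT ler_nat MM'.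
have cv := @cvg_monotone_convergence _ _ _ P _ measurableT _ mXg Xg0 Xgmono.
rewrite (eq_integral (fun w : OmegaF W N => limn (fun M => (X w ^+ 2 * g M (W k.+1 w))%:E))).
  rewrite -(cvg_lim _ cv)//; apply: lime_le; last exact: nearW.
  by apply/cvg_ex; eexists; exact: cv.
(* The truncation is inactive once M exceeds the noise component, so the sequence is eventually
   constant. *)
move=> w _; apply/esym/(@lim_near_cst) => //.
exists (Num.truncn `|W k.+1 w i 0|).+1 => // M /= wM.
rewrite /g min_r; last first.
  by apply: ltW; apply: lt_le_trans (truncnS_gt _) _; rewrite ler_nat.
by rewrite normrX normr_id normrM exprMn !real_normK ?num_real.
Qed.

(** If X is a bounded Lipschitz function of the past, only W_(k+1) has to be approximated;
    [mean_le_noise] then passes from closeness of X to closeness of the products. *)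
Lemma lipL_noise k i X : (k < N)%N -> lipL 2 k X ->
  lipL 2 k.+1 (fun w => X w * W k.+1 w i 0).
Proof.
move=> kN LX; have [C C0 hC] := mean_le_noise i kN.
have [mX aX] := LX; have [mW aW] := lipL_W i kN.
have LphiW phi : @Cblip R d k phi ->
    lipL 2 k.+1 (fun w => phi (Wpath W k w) * W k.+1 w i 0).
  move=> cphi; have mphi := Cblip_meas (ltnW kN) cphi.
  split; first exact: measurable_funM.
  move=> e e0; have [B B0 bB] := Cblip_norm_bound cphi.
  have B20 : 0 < B ^+ 2 by rewrite exprn_gt0.
  have [psi cpsi hpsi] := aW (e / B ^+ 2) (divr_gt0 e0 B20).
  have mpsi := Cblip_meas kN cpsi.
  exists (fun x => phi (col' ord_max x) * psi x).
    by apply: CblipM => //; apply: (Cblip_comp (h := col' ord_max)) => //; exact: col'_lip.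
  rewrite -[e](@divfK _ (B ^+ 2)) ?gt_eqF// mulrC.
  apply: (mean_le_dom _ _ _ _ hpsi); last 1 first.
  - move=> w; rewrite !normrX !normr_id Wpath_col' -mulrBr normrM exprMn.
    by rewrite ler_wpM2r ?exprn_ge0// lerXn2r ?nnegrE ?(ltW B0).
  - under eq_fun do rewrite Wpath_col'.
    by apply: measurable_normX; apply: measurable_funB; exact: measurable_funM.
  - by apply: measurable_normX; exact: measurable_funB.
  - exact: ltW.
apply: lipL_lim => //; first exact: measurable_funM.
move=> e e0; have C1 : 0 < C + 1 by rewrite ltr_wpDl.
have [phi cphi hphi] := aX (e / (C + 1)) (divr_gt0 e0 C1).
exists (fun w => phi (Wpath W k w) * W k.+1 w i 0); first exact: LphiW.
have LD : lipL 2 k (fun w => X w - phi (Wpath W k w)).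
  by have kN' := ltnW kN; apply: lipLB => //; exact: lipL_Cblip.
apply: mean_leW (_ : mean_le _ (C * (e / (C + 1)))).
  by rewrite mulrCA ler_piMr ?(ltW e0)// ler_pdivrMr// mul1r lerDl.
by under eq_fun do rewrite -mulrBl; exact: hC.
Qed.

End NoiseMultiplication.
End CompletionSpaces.

(** * Composition with smooth coefficients *)

(** Increments are tested inside [0, 1] only, the coefficients being given only for controls in U_k.
    At the end points this still yields the continuity that the mean value theorem asks for. *)
Lemma mean_value_01 (R : realType) (f df : R -> R) :
  (forall t e : R, 0 <= t <= 1 -> 0 < e -> exists2 del : R, 0 < del &
    forall s : R, 0 <= s <= 1 -> `|s - t| < del ->
      `|f s - f t - df t * (s - t)| <= e * `|s - t|) ->
  exists2 c : R, 0 <= c <= 1 & f 1 - f 0 = df c.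
Proof.
move=> diff.
have [|t t01||c c01 ->] := @MVT_segment R f df 0 1; last 1 first.
- by exists c; [move: c01; rewrite in_itv|rewrite subr0 mulr1].
- exact: ler01.
- move: t01; rewrite in_itv/= => /andP[t0 t1].
  have lim : h^-1 *: ((f \o shift t) (h *: 1) - f t) @[h --> 0^'] --> df t.
    apply/cvgrPdist_le => e e0.
    have [|del del0 hdel] := diff t e _ e0; first by rewrite !ltW.
    near=> h.
    have h0 : h != 0 by near: h; exact: nbhs_dnbhs_neq.
    have hlt : `|h| < Num.min del (Num.min t (1 - t)).
      by near: h; apply: dnbhs0_lt; rewrite !lt_min del0 t0/= subr_gt0.
    move: hlt; rewrite !lt_min => /and3P[hd ht h1t].
    have := hdel (h + t); rewrite addrK => /(_ _ hd) hh.
    have {hh} : `|f (h + t) - f t - df t * h| <= e * `|h|.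
      apply: hh; move: ht h1t; rewrite !ltr_norml => /andP[? ?] /andP[? ?].
      by apply/andP; split; lra.
    rewrite -ler_pdivrMr ?normr_gt0//; apply: le_trans.
    rewrite -normfV -normrM distrC /= [h *: 1]mulr1.
    have -> : h^-1 *: (f (h + t) - f t) - df t = (f (h + t) - f t - df t * h) / h.
      by rewrite /GRing.scale/=; field.
    by [].
  have der : derivable f t 1 by apply/cvg_ex; exists (df t).
  by apply: DeriveDef => //; exact/cvg_lim.
- apply/subspace_continuousP => t; rewrite /= in_itv/= => t01.
  apply/cvgrPdist_le => e e0.
  have [del del0 hdel] := diff t 1 t01 ltr01.
  have d10 : 0 < 1 + `|df t| by rewrite ltr_pwDl.
  apply/nbhs_ballP; exists (Num.min del (e / (1 + `|df t|))).
    by rewrite /= lt_min del0 divr_gt0.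
  move=> s; rewrite -ball_normE /= lt_min => /andP[s1 s2]; rewrite in_itv/= => s01.
  have s1' : `|s - t| < del by rewrite distrC.
  have le1 : `|f s - f t| <= (1 + `|df t|) * `|s - t|.
    rewrite mulrDl -normrM.
    have := ler_normD (f s - f t - df t * (s - t)) (df t * (s - t)).
    by rewrite subrK => /le_trans; apply; rewrite lerD2r; exact: hdel.
  rewrite distrC; apply: le_trans le1 _.
  by rewrite distrC mulrC -ler_pdivlMr// ltW.
Unshelve. all: by end_near. Qed.

Section Composition.
Context {R : realType} {Omega : pointedType} {d : nat} {Theta : Type}.
Variables (W : nat -> Omega -> 'cV[R]_d) (F : Theta -> probability (borelM R d 1) R).
Variables (N k : nat).
Hypothesis kN : (k <= N)%N.
Local Notation meas := (measurable_fun [set: OmegaF W N]).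
Local Notation mean_le := (mean_le W F N).
Local Notation lipL := (lipL W F N).

Definition lipV q (Z : Omega -> 'cV[R]_q) : Prop := forall i, lipL 2 k (fun w => Z w i 0).

(** The maximum norm is a finite maximum of absolute values, operations under which [lipL] is
    stable. *)
Lemma lipV_norm q (Z : Omega -> 'cV[R]_q) : lipV Z -> lipL 2 k (fun w => `|Z w|).
Proof.
move=> LZ.
have nE w : `|Z w| = \big[Num.max/0]_(ij : 'I_q * 'I_1) `|Z w ij.1 ij.2|.
  by rewrite -mx_normrE.
under eq_fun do rewrite nE.
elim: (index_enum _) => [|[i j] s IH].
  by under eq_fun do rewrite big_nil; exact: lipL_cst.
rewrite (ord1 j); under eq_fun do rewrite big_cons /=.
by apply: lipL_max => //; exact: lipL_abs.
Qed.

Lemma lipV_sub_cst q (Z : Omega -> 'cV[R]_q) y : lipV Z -> lipV (fun w => Z w - y).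
Proof.
by move=> LZ i; under eq_fun do rewrite !mxE; apply: lipLB => //; exact: lipL_cst.
Qed.

(* The exponent r = 2 - p of the growth weight treats the coefficients of the state
   equation (p = 2) and the running and terminal costs (p = 1) together. *)
Variables (p r : nat).
Hypotheses (p_gt0 : (0 < p)%N) (pr2 : (p + r)%N = 2%N).

Lemma exponents : (p = 1%N /\ r = 1%N) \/ (p = 2%N /\ r = 0%N).
Proof. by move: p_gt0 pr2; case: p => [|[|[|?]]] //=; case: r => [|[|?]] //=; [left|right]. Qed.

Definition weight q (z y : 'cV[R]_q) : R := (1 + `|z| + `|y|) ^+ r * `|z - y|.

Lemma weight_ge0 q (z y : 'cV[R]_q) : 0 <= weight z y.
Proof. by rewrite mulr_ge0// exprn_ge0// !addr_ge0. Qed.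

Lemma lipL_weight q (Z : Omega -> 'cV[R]_q) y : lipV Z -> lipL p k (fun w => weight (Z w) y).
Proof.
move=> LZ; have L1 := lipV_norm (lipV_sub_cst y LZ).
have [[-> r1]|[-> r0]] := exponents; rewrite /weight ?r1 ?r0; last first.
  by under eq_fun do rewrite expr0 mul1r.
under eq_fun do rewrite expr1; apply: lipL_mul => //.
have -> : (fun w => 1 + `|Z w| + `|y|) = fun w => `|Z w| + (1 + `|y|).
  by apply/funext => w; ring.
by apply: lipLD => //; [exact: lipV_norm|exact: lipL_cst].
Qed.

(** Both exponent pairs satisfy p (r + 1) = 2, so p-th powers of weighted quantities are dominated
    by squares of L_c^2 elements in either case. *)
Lemma exp_dom (c u v : R) : 0 <= c -> 0 <= u -> u <= v -> 1 <= v ->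
  (c * (v ^+ r * u)) ^+ p <= ((1 + c) * v) ^+ 2.
Proof.
move=> c0 u0 uv v1; have v0 : 0 <= v by lra.
have c1 : c * v <= (1 + c) * v by rewrite ler_wpM2r// lerDr.
have vv : v <= (1 + c) * v by rewrite ler_peMl// lerDl.
have [[-> ->]|[-> ->]] := exponents.
  rewrite !expr1 expr2 mulrA; apply: ler_pM => //; first exact: mulr_ge0.
  exact: le_trans uv vv.
rewrite expr0 mul1r lerXn2r ?nnegrE ?mulr_ge0//; first by lra.
by rewrite ler_pM// lerDr.
Qed.

Lemma exp_small (u e : R) : 0 <= u -> u <= 1 -> u <= e -> u ^+ p <= e.
Proof. by move=> u0 u1; apply: le_trans; exact: ler_iXnr. Qed.

Lemma expr_le_base (v : R) : 1 <= v -> v ^+ r <= v.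
Proof. by move=> v1; have [[_ ->]|[_ ->]] := exponents. Qed.

Section Nemytskii.
Variables (q : nat) (D : set 'cV[R]_q) (g : 'cV[R]_q -> Omega -> R) (L : R).
Hypothesis L0 : 0 <= L.
Hypothesis g_lip : forall w z z', D z -> D z' -> `|g z w - g z' w| <= L * weight z z'.
Hypothesis g_L : forall z, D z -> lipL p k (g z).

Let h (Z : Omega -> 'cV[R]_q) y w := g y w + L * weight (Z w) y.

Let h_ge Z y w : D (Z w) -> D y -> g (Z w) w <= h Z y w.
Proof.
move=> DZ Dy; rewrite -lerBlDl; apply: le_trans (ler_norm _) _; exact: g_lip.
Qed.

Let h_le Z y w : D (Z w) -> D y -> h Z y w - g (Z w) w <= 2 * L * weight (Z w) y.
Proof.
move=> DZ Dy; have := g_lip w Dy DZ; rewrite /h => le1.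
have le2 := le_trans (ler_norm _) le1.
have sym : weight y (Z w) = weight (Z w) y.
  by rewrite /weight distrC [1 + _ + _]addrAC.
by rewrite sym in le2; lra.
Qed.

Let mn Z y0 (ys : seq 'cV[R]_q) w := foldr (fun y => Num.min (h Z y w)) (h Z y0 w) ys.

Let mn_L Z y0 ys : lipV Z -> D y0 -> (forall y, y \in ys -> D y) -> lipL p k (mn Z y0 ys).
Proof.
move=> LZ Dy0; have hL y : D y -> lipL p k (h Z y).
  move=> Dy; apply: lipLD => //; first exact: g_L.
  by apply: lipLZ => //; exact: lipL_weight.
elim: ys => [|y ys IH] Dys; first exact: hL.
apply: lipL_min => //; first by apply: hL; apply: Dys; rewrite mem_head.
by apply: IH => z zys; apply: Dys; rewrite in_cons zys orbT.
Qed.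

Let mn_ge Z y0 ys w : D (Z w) -> D y0 -> (forall y, y \in ys -> D y) ->
  g (Z w) w <= mn Z y0 ys w.
Proof.
move=> DZ Dy0; elim: ys => [|y ys IH] Dys /=; first exact: h_ge.
rewrite le_min h_ge//=; last by apply: Dys; rewrite mem_head.
by apply: IH => z zys; apply: Dys; rewrite in_cons zys orbT.
Qed.

Let mn_le Z y0 ys w y : y \in y0 :: ys -> mn Z y0 ys w <= h Z y w.
Proof.
elim: ys y => [|y' ys IH] y /=; first by rewrite inE => /eqP ->.
rewrite ge_min !inE => /or3P[/eqP ->|/eqP ->|yys].
- by apply/orP; right; apply: IH; rewrite mem_head.
- by rewrite lexx.
- by apply/orP; right; apply: IH; rewrite inE yys orbT.
Qed.

(* Infimal convolution over a finite net: min_y (g y + L weight Z y) lies above g Z,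
   within 2 L weight Z y for every node y. *)
Theorem lipL_nemytskii Z : lipV Z -> (forall w, D (Z w)) ->
  lipL p k (fun w => g (Z w) w).
Proof.
(* A fixed node, a value of Z and hence in [D], takes part in every infimum and supplies the
   domination where Z is large. *)
move=> LZ DZ; pose y0 := Z point; have Dy0 : D y0 by exact: DZ.
(* Where |Z| <= j, the base of the weight at a close node is at most 2 j + 2, so this mesh makes the
   weight at most 1 / (j + 1). *)
pose eta (j : nat) : R := ((2 * j%:R + 2) * j.+1%:R)^-1.
have c0 (j : nat) : 0 < 2 * j%:R + 2 :> R by rewrite ltr_wpDl// mulr_ge0.
have eta0 j : 0 < eta j by rewrite invr_gt0 mulr_gt0.
pose net j := finite_net D j%:R (eta0 j).
pose ys j := projT1 (cid2 (net j)).
have ysD j y : y \in ys j -> D y.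
  by rewrite /ys; case: (cid2 (net j)) => /= s + _; exact.
have ysP j z : D z -> `|z| <= j%:R -> exists2 y, y \in ys j & `|z - y| <= eta j.
  by rewrite /ys; case: (cid2 (net j)) => /= s _; exact.
pose f j := mn Z y0 (ys j).
have fL j : lipL p k (f j) by apply: mn_L => //; exact: ysD.
have f_ge j w : 0 <= f j w - g (Z w) w.
  by rewrite subr_ge0; apply: mn_ge => //; exact: ysD.
have f_le0 j w : f j w - g (Z w) w <= 2 * L * weight (Z w) y0.
  apply: le_trans (h_le (DZ w) Dy0); rewrite lerD2r.
  by apply: mn_le; rewrite mem_head.
have f_le j w : `|Z w| <= j%:R -> f j w - g (Z w) w <= 2 * L / j.+1%:R.
  move=> Zj; have [y yys Zy] := ysP j _ (DZ w) Zj.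
  apply: (@le_trans _ _ (2 * L * weight (Z w) y)).
    apply: le_trans (h_le (DZ w) (ysD _ _ yys)); rewrite lerD2r.
    by apply: mn_le; rewrite in_cons yys orbT.
  rewrite ler_wpM2l ?mulr_ge0//.
  have eta1 : eta j <= 1.
    rewrite invf_le1 ?mulr_gt0// -[leLHS]mulr1; apply: ler_pM => //.
      by rewrite -[leLHS]add0r lerD ?mulr_ge0// ler1n.
    by rewrite ler1n.
  have y_le : `|y| <= j%:R + 1.
    rewrite -[y in leLHS](subKr (Z w)) (le_trans (ler_normB _ _))// lerD//.
    exact: le_trans Zy eta1.
  have base : 1 + `|Z w| + `|y| <= 2 * j%:R + 2 by lra.
  apply: (@le_trans _ _ ((2 * j%:R + 2) * eta j)).
    apply: ler_pM => //.
    apply: le_trans base; apply: expr_le_base.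
    by rewrite -addrA lerDl addr_ge0.
  by rewrite /eta invfM mulrA divff ?mul1r// gt_eqF.
(* Measurability of g(Z) comes from the pointwise limit of the infima over the nets. *)
have mgZ : meas (fun w => g (Z w) w).
  apply: (@measurable_fun_cvg _ (OmegaF W N) R setT f) => [j|w _].
    exact: (fL j).1.
  apply/cvgrPdist_le => e e0.
  near=> j; rewrite distrC ger0_norm// (le_trans (f_le j w _))//.
    by near: j; exact: nbhs_infty_ger.
  have : (2 * L) / e <= j%:R by near: j; exact: nbhs_infty_ger.
  rewrite ler_pdivrMr// => h1; rewrite ler_pdivrMr// [leRHS]mulrC (le_trans h1)//.
  by rewrite ler_wpM2r ?(ltW e0)// ler_nat.
apply: lipL_lim => // e e0.
(* By [exp_dom], G ^ 2 dominates the p-th power of the error 2 L weight(Z, y0). *)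
pose G w := (1 + 2 * L) * (1 + `|Z w| + `|y0|).
have LG : lipL 2 k G.
  apply: lipLZ => //; apply: lipLD => //; last exact: lipL_cst.
  by apply: lipLD => //; [exact: lipL_cst|exact: lipV_norm].
have [K K0 hK] := uniform_domination kN LG e0.
pose e' := Num.min 1 (e / 2).
have e'0 : 0 < e' by rewrite lt_min ltr01 divr_gt0.
pose j := (Num.truncn (Num.max K ((2 * L) / e'))).+1.
have jK : K <= j%:R.
  by apply: ltW; apply: le_lt_trans (truncnS_gt _); rewrite le_max lexx.
have je : (2 * L) / j.+1%:R <= e'.
  rewrite ler_pdivrMr// [leRHS]mulrC -ler_pdivrMr//.
  apply: (@le_trans _ _ j%:R); last by rewrite ler_nat.
  by apply: ltW; apply: le_lt_trans (truncnS_gt _); rewrite le_max lexx orbT.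
exists (f j) => //; apply: hK.
- by apply: measurable_normX; apply: measurable_funB => //; exact: (fL j).1.
- move=> w; rewrite exprn_ge0//= distrC ger0_norm//.
  have v1 : 1 <= 1 + `|Z w| + `|y0| by rewrite -addrA lerDl addr_ge0.
  apply: (@le_trans _ _ ((2 * L * weight (Z w) y0) ^+ p)).
    by rewrite lerXn2r ?nnegrE ?mulr_ge0 ?weight_ge0.
  rewrite /G ger0_norm ?mulr_ge0 ?addr_ge0 ?mulr_ge0//.
  apply: exp_dom => //; first by rewrite mulr_ge0.
  by rewrite (le_trans (ler_normB _ _))// lerD2r lerDr.
move=> w Gw; rewrite distrC ger0_norm//.
have Zj : `|Z w| <= j%:R.
  apply: le_trans jK; apply: le_trans Gw; rewrite /G ger0_norm; last first.
    by rewrite mulr_ge0 ?addr_ge0 ?mulr_ge0.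
  apply: (@le_trans _ _ (1 + `|Z w| + `|y0|)).
    by rewrite -addrA addrCA lerDl addr_ge0.
  by rewrite ler_peMl ?addr_ge0// lerDl mulr_ge0.
have := le_trans (f_le j w Zj) je; rewrite le_min => /andP[h1 h2].
exact: exp_small.
Unshelve. all: by end_near. Qed.

End Nemytskii.

(** * Differentiation in the mean along random directions *)

Section Derivative.
Variables (q : nat) (D : set 'cV[R]_q) (g : 'cV[R]_q -> Omega -> R).
Variables (Dg : 'cV[R]_q -> Omega -> 'rV[R]_q) (L : R).
Hypothesis L0 : 0 <= L.
Hypothesis D_conv : forall z h (t : R), D z -> D (z + h) -> 0 <= t <= 1 -> D (z + t *: h).
Hypothesis g_diff : forall w z, D z -> forall e : R, 0 < e ->
  exists2 del : R, 0 < del & forall z', D z' -> `|z' - z| < del ->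
    `|g z' w - g z w - (Dg z w *m (z' - z)) 0 0| <= e * `|z' - z|.
Hypothesis Dg_bound : forall w z, D z -> `|Dg z w| <= L * (1 + `|z|) ^+ r.
Hypothesis Dg_mod : forall alpha : R, 0 < alpha -> exists2 om, modulus om &
  forall w z z', D z -> D z' -> `|z| <= alpha -> `|z'| <= alpha ->
    `|Dg z w - Dg z' w| <= om `|z - z'|.
Hypothesis g_L : forall z, D z -> lipL p k (g z).

Lemma segment_mean_value w z h : D z -> D (z + h) -> exists2 c : R, 0 <= c <= 1 &
  g (z + h) w - g z w = (Dg (z + c *: h) w *m h) 0 0.
Proof.
move=> Dz Dzh.
have [t e t01 e0|c c01] := @mean_value_01 R (fun t => g (z + t *: h) w)
    (fun t => (Dg (z + t *: h) w *m h) 0 0); last first.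
  by rewrite scale1r scale0r addr0 => ->; exists c.
(* The added 1 avoids a division by zero when h = 0. *)
have h1 : 0 < `|h| + 1 by rewrite ltr_wpDl.
have [del del0 hdel] := g_diff w (D_conv Dz Dzh t01) (divr_gt0 e0 h1).
exists (del / (`|h| + 1)) => [|s s01 st]; first by rewrite divr_gt0.
have zE : z + s *: h - (z + t *: h) = (s - t) *: h.
  by rewrite scalerBl opprD addrACA subrr add0r.
have := hdel _ (D_conv Dz Dzh s01); rewrite zE normrZ => /(_ _)/le_trans.
rewrite -scalemxAr mxE [(s - t) * _]mulrC; apply.
  move: st; rewrite ltr_pdivlMr//; apply: le_lt_trans.
  by rewrite ler_wpM2l// lerDl.
rewrite mulrAC mulrA ler_pdivrMr// -[X in _ <= X]mulrA -mulrA ler_wpM2l ?(ltW e0)//.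
by rewrite ler_wpM2l// lerDl.
Qed.

Lemma segment_norm (z h : 'cV[R]_q) (t : R) : 0 <= t <= 1 ->
  `|z + t *: h| <= `|z| + `|z + h|.
Proof.
move=> /andP[t0 t1].
have -> : z + t *: h = (1 - t) *: z + t *: (z + h).
  by rewrite scalerBl scale1r scalerDr addrA subrK.
rewrite (le_trans (ler_normD _ _))// !normrZ ger0_norm ?subr_ge0// ger0_norm// lerD//.
  by rewrite ler_piMl// lerBlDr lerDl.
by rewrite ler_piMl.
Qed.

(** Points of the segment are bounded by |z| + |z'|, which turns the growth of [Dg] into the weight;
    the factor q is the cost of a row-by-column product in the maximum norm. *)
Lemma derivative_lip w z z' : D z -> D z' ->
  `|g z w - g z' w| <= (q%:R * L) * weight z z'.
Proof.
move=> Dz Dz'; have Dzz : D (z + (z' - z)) by rewrite addrC subrK.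
have [c c01] := segment_mean_value w Dz Dzz.
rewrite [z + (z' - z)]addrC subrK => E; rewrite distrC E.
apply: le_trans (ler_norm_mulmx _ _) _; rewrite -mulrA ler_wpM2l//.
rewrite /weight mulrA distrC ler_wpM2r//.
apply: le_trans (Dg_bound w (D_conv Dz Dzz c01)) _; rewrite ler_wpM2l//.
rewrite lerXn2r ?nnegrE ?addr_ge0// -addrA lerD2l.
by have := segment_norm z (z' - z) c01; rewrite [z + (z' - z)]addrC subrK.
Qed.

Lemma lipL_comp Z : lipV Z -> (forall w, D (Z w)) -> lipL p k (fun w => g (Z w) w).
Proof.
apply: (@lipL_nemytskii _ D g (q%:R * L)) => //; first by rewrite mulr_ge0.
by move=> w z z'; exact: derivative_lip.
Qed.

Definition mean_cvg (s : nat) (X : R -> Omega -> R) (Y : Omega -> R) : Prop :=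
  forall e : R, 0 < e -> exists2 del : R, 0 < del & forall t : R, 0 < t < del ->
    mean_le (fun w => `|X t w - Y w| ^+ s) e.

Section Direction.
Variables (Z H : Omega -> 'cV[R]_q).
Hypotheses (LZ : lipV Z) (LH : lipV H).
Hypotheses (DZ : forall w, D (Z w)) (DZH : forall w, D (Z w + H w)).

Let quot t w := t^-1 * (g (Z w + t *: H w) w - g (Z w) w).
Let dgH w := (Dg (Z w) w *m H w) 0 0.

Let DZt t w : 0 < t <= 1 -> D (Z w + t *: H w).
Proof. by move=> /andP[t0 t1]; apply: D_conv => //; rewrite (ltW t0). Qed.

Let quotE t w : 0 < t <= 1 -> exists2 c : R, 0 <= c <= t &
  quot t w - dgH w = ((Dg (Z w + c *: H w) w - Dg (Z w) w) *m H w) 0 0.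
Proof.
move=> t01; have [c /andP[c0 c1] E] := segment_mean_value w (DZ w) (DZt w t01).
have /andP[t0 _] := t01; exists (c * t).
  by rewrite mulr_ge0 ?(ltW t0)//= ler_piMl ?(ltW t0).
rewrite /quot E -scalemxAr mxE mulrA mulVf ?gt_eqF// mul1r scalerA.
by rewrite mulmxBl [RHS]mxE [X in _ = _ + X]mxE.
Qed.

Let quot_L t : 0 < t <= 1 -> lipL p k (quot t).
Proof.
move=> t01; apply: lipLZ => //; apply: lipLB => //; last exact: lipL_comp.
apply: lipL_comp => [i|w]; last exact: DZt.
under eq_fun do rewrite !mxE; apply: lipLD => //; exact: lipLZ.
Qed.

(** [Dg] comes without measurability in omega; the derivative is the pointwise limit of the
    measurable quotients at t = 1 / (j + 1). *)
Let dgH_meas : meas dgH.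
Proof.
apply: (@measurable_fun_cvg _ (OmegaF W N) R setT (fun j => quot j.+1%:R^-1)) => [j|w _].
  by apply: (quot_L _).1; rewrite invr_gt0 ltr0n/= invf_le1// ler1n.
apply/cvgrPdist_le => e e0.
have H1 : 0 < `|H w| + 1 by rewrite ltr_wpDl.
have [del del0 hdel] := g_diff w (DZ w) (divr_gt0 e0 H1).
near=> j; set t : R := j.+1%:R^-1.
have t0 : 0 < t by rewrite invr_gt0.
have t1 : t <= 1 by rewrite invf_le1// ler1n.
have td : t * (`|H w| + 1) < del.
  rewrite -ltr_pdivlMr// -[_ / _]invrK ltf_pV2 ?posrE ?invr_gt0 ?divr_gt0//.
  by apply: (@le_lt_trans _ _ j%:R); [near: j; exact: nbhs_infty_ger|rewrite ltr_nat].
have zE : Z w + t *: H w - Z w = t *: H w by rewrite addrC addKr.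
have := hdel (Z w + t *: H w); rewrite zE normrZ (gtr0_norm t0) => h.
have {}h : `|g (Z w + t *: H w) w - g (Z w) w - (Dg (Z w) w *m (t *: H w)) 0 0| <=
    e / (`|H w| + 1) * (t * `|H w|).
  apply: h; first by apply: DZt; rewrite t0.
  by apply: le_lt_trans td; rewrite ler_wpM2l ?(ltW t0)// lerDl.
rewrite -scalemxAr mxE in h.
rewrite distrC /quot -(ler_pM2l t0) -{1}(gtr0_norm t0) -normrM mulrBr mulrA.
rewrite mulfV ?gt_eqF// mul1r (le_trans h)// mulrCA ler_wpM2l ?(ltW t0)//.
by rewrite mulrAC ler_pdivrMr// ler_wpM2l ?(ltW e0)// lerDl.
Unshelve. all: by end_near. Qed.

Let G w := (1 + 2 * (q%:R * L)) * (1 + `|Z w| + `|H w|).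

Let LG : lipL 2 k G.
Proof.
apply: lipLZ => //; apply: lipLD => //; last exact: lipV_norm.
by apply: lipLD => //; [exact: lipL_cst|exact: lipV_norm].
Qed.

Let ZH_le t w : 0 <= t <= 1 -> `|Z w + t *: H w| <= `|Z w| + `|H w|.
Proof.
move=> /andP[t0 t1]; rewrite (le_trans (ler_normD _ _))// lerD2l normrZ ger0_norm//.
by rewrite ler_piMl.
Qed.

(** Where G <= K, the mean value theorem and the modulus of [Dg] on a fixed ball make the error
    uniformly small; elsewhere G ^ 2 dominates its p-th power and [uniform_domination] applies. *)
Let fixed_direction : mean_cvg p quot dgH.
Proof.
move=> e e0; have [K K0 hK] := uniform_domination kN LG e0.
pose e' := Num.min 1 (e / 2).
have e'0 : 0 < e' by rewrite lt_min ltr01 divr_gt0.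
(* Z + c H has norm at most |Z| + |H|, hence the radius 2 K for the modulus. *)
have K20 : 0 < K + K by rewrite addr_gt0.
have [om [om0 om_mono om_0 om_cvg] hom] := Dg_mod K20.
have q1 : 0 < q%:R * K + 1 by rewrite ltr_wpDl// mulr_ge0// ltW.
have [del del0 hdel] : exists2 del : R, 0 < del &
    forall x : R, 0 < x < del -> om x <= e' / (q%:R * K + 1).
  have /cvgrPdist_le /(_ _ (divr_gt0 e'0 q1)) := om_cvg.
  rewrite near_withinE => /nbhs_ballP[del /= del0 hdel]; exists del => // x /andP[x0 xd].
  have := hdel x; rewrite -ball_normE /= sub0r normrN gtr0_norm// => /(_ xd x0).
  by rewrite sub0r normrN; apply: le_trans; exact: ler_norm.
exists (Num.min 1 (del / K)); first by rewrite lt_min ltr01 divr_gt0.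
move=> t /andP[t0]; rewrite lt_min => /andP[t1 td].
have t01 : 0 < t <= 1 by rewrite t0 ltW.
have ZH0 w : 0 <= 1 + `|Z w| + `|H w| by rewrite !addr_ge0.
have qL0 : 0 <= q%:R * L by rewrite mulr_ge0.
have Gn w : `|G w| = G w by rewrite ger0_norm// mulr_ge0// addr_ge0// mulr_ge0.
apply: hK.
- apply: measurable_normX; apply: measurable_funB; [exact: (quot_L t01).1|exact: dgH_meas].
- move=> w; rewrite exprn_ge0//= Gn.
  have [c /andP[c0 ct] ->] := quotE w t01.
  have c01 : 0 <= c <= 1 by rewrite c0 (le_trans ct)// ltW.
  apply: (@le_trans _ _
      ((2 * (q%:R * L) * ((1 + `|Z w| + `|H w|) ^+ r * `|H w|)) ^+ p)); last first.
    apply: exp_dom => //; first by rewrite mulr_ge0.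
      by rewrite lerDr addr_ge0.
    by rewrite -addrA lerDl addr_ge0.
  rewrite lerXn2r ?nnegrE ?mulr_ge0 ?exprn_ge0//.
  apply: le_trans (ler_norm_mulmx _ _) _.
  rewrite [leRHS](_ : _ =
      q%:R * (2 * (L * (1 + `|Z w| + `|H w|) ^+ r) * `|H w|)); last by ring.
  rewrite ler_wpM2l// ler_wpM2r// (le_trans (ler_normB _ _))//.
  rewrite mulr_natl mulr2n lerD//.
    apply: le_trans (Dg_bound w (D_conv (DZ w) (DZH w) c01)) _; rewrite ler_wpM2l//.
    by rewrite lerXn2r ?nnegrE ?addr_ge0// -addrA lerD2l ZH_le.
  apply: le_trans (Dg_bound w (DZ w)) _; rewrite ler_wpM2l//.
  by rewrite lerXn2r ?nnegrE ?addr_ge0// lerDl.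
move=> w; rewrite Gn => GK.
have ZHK : 1 + `|Z w| + `|H w| <= K.
  by apply: le_trans GK; rewrite ler_peMl// lerDl mulr_ge0.
have ZK : `|Z w| <= K by apply: le_trans ZHK; rewrite -addrA addrCA lerDl addr_ge0.
have HK : `|H w| <= K by apply: le_trans ZHK; rewrite lerDr addr_ge0.
have [c /andP[c0 ct] ->] := quotE w t01.
have c01 : 0 <= c <= 1 by rewrite c0 (le_trans ct)// ltW.
have omc : om `|Z w + c *: H w - Z w| <= e' / (q%:R * K + 1).
  apply: (@le_trans _ _ (om (t * K))).
    apply: om_mono; first exact: normr_ge0.
    have -> : Z w + c *: H w - Z w = c *: H w by rewrite addrC addKr.
    by rewrite normrZ ger0_norm// ler_pM.
  by apply: hdel; rewrite mulr_gt0//= -ltr_pdivlMr.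
have le1 : `|((Dg (Z w + c *: H w) w - Dg (Z w) w) *m H w) 0 0| <= e'.
  apply: le_trans (ler_norm_mulmx _ _) _.
  apply: (@le_trans _ _ (q%:R * (e' / (q%:R * K + 1) * K))).
    rewrite ler_wpM2l// ler_pM//; apply: le_trans omc; apply: hom => //.
    - exact: D_conv.
    - by rewrite (le_trans (ZH_le w c01))// lerD.
    - by rewrite (le_trans ZK)// lerDl ltW.
  rewrite [leLHS](_ : _ = e' * (q%:R * K) / (q%:R * K + 1)); last by ring.
  by rewrite ler_pdivrMr// ler_wpM2l ?(ltW e'0)// lerDl.
move: le1; rewrite le_min => /andP[? ?]; exact: exp_small.
Qed.

Variable Ht : R -> Omega -> 'cV[R]_q.
Hypothesis LHt : forall t, 0 < t <= 1 -> lipV (Ht t).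
Hypothesis DHt : forall t, 0 < t <= 1 -> forall w, D (Z w + t *: Ht t w).
Hypothesis Ht_cvg : mean_cvg 2 (fun t w => `|Ht t w - H w|) (fun=> 0).

Let quot_Ht t w := t^-1 * (g (Z w + t *: Ht t w) w - g (Z w) w).

Lemma quotient_L t : 0 < t <= 1 -> lipL p k (quot_Ht t).
Proof.
move=> t01; apply: lipLZ => //; apply: lipLB => //; last exact: lipL_comp.
apply: lipL_comp => [i|w]; last exact: DHt.
under eq_fun do rewrite !mxE; apply: lipLD => //; apply: lipLZ => //; exact: LHt.
Qed.

Let dist_Ht t : 0 < t <= 1 -> lipL 2 k (fun w => `|Ht t w - H w|).
Proof.
move=> t01; apply: lipV_norm => i.
by under eq_fun do rewrite !mxE; apply: lipLB => //; exact: LHt.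
Qed.

(** The weighted Lipschitz bound between Z + t Ht and Z + t H produces a factor t that cancels the
    division by t. *)
Let perturbation_le t w : 0 < t <= 1 -> `|quot_Ht t w - quot t w| <=
  (q%:R * L) * ((2 * (1 + `|Z w| + `|H w|) + `|Ht t w - H w|) ^+ r * `|Ht t w - H w|).
Proof.
move=> t01; have /andP[t0 t1] := t01.
rewrite /quot_Ht /quot -mulrBr opprB addrA subrK normrM gtr0_norm ?invr_gt0//.
rewrite mulrC ler_pdivrMr//.
apply: le_trans (derivative_lip w (DHt t01 w) (DZt w t01)) _.
rewrite -!mulrA ler_wpM2l// ler_wpM2l// /weight opprD addrACA subrr add0r.
rewrite -scalerBr normrZ gtr0_norm// mulrA [leRHS]mulrA [leRHS]mulrAC.
rewrite mulrC [leRHS]mulrC mulrC [leRHS]mulrC -!mulrA.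
rewrite ler_wpM2r ?mulr_ge0 ?(ltW t0)//.
rewrite lerXn2r ?nnegrE ?addr_ge0 ?mulr_ge0 ?addr_ge0//.
have le1 : `|Z w + t *: Ht t w| <= `|Z w| + `|H w| + `|Ht t w - H w|.
  have -> : Z w + t *: Ht t w = Z w + t *: H w + t *: (Ht t w - H w).
    by rewrite -addrA -scalerDr addrCA subrr addr0.
  rewrite (le_trans (ler_normD _ _))// lerD//.
    by rewrite ZH_le// (ltW t0).
  by rewrite normrZ gtr0_norm// ler_piMl.
have le2 : `|Z w + t *: H w| <= `|Z w| + `|H w| by rewrite ZH_le// (ltW t0).
move: (`|_ + t *: Ht t w|) (`|_ + t *: H w|) (`|Z w|) (`|H w|) (`|Ht t w - _|) le1 le2.
by move=> *; lra.
Qed.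

(** [lipL] is closed under limits in mean, so the derivative inherits membership from quotients in
    the fixed direction. *)
Theorem derivative_L : lipL p k dgH.
Proof.
apply: lipL_lim => // e e0; have [del del0 hdel] := fixed_direction e0.
pose t := Num.min 1 (del / 2).
have t0 : 0 < t by rewrite lt_min ltr01 divr_gt0.
have t1 : 0 < t <= 1 by rewrite t0 ge_min lexx.
exists (quot t); first exact: quot_L.
under eq_fun do rewrite distrC; apply: hdel; rewrite t0 gt_min; apply/orP; right.
by rewrite ltr_pdivrMr// ltr_pMr// ltr1n.
Qed.

Theorem derivative_mean_cvg : mean_cvg p quot_Ht dgH.
Proof.
move=> e e0; pose A : R := q%:R * L; have A0 : 0 <= A by rewrite mulr_ge0.
have p20 : 0 < 2 ^+ p :> R by rewrite exprn_gt0.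
pose e1 := e / 2 / 2 ^+ p; have e10 : 0 < e1 by rewrite !divr_gt0.
have e12 : 0 <= e1 / 2 by rewrite divr_ge0// ltW.
pose G0 w := 1 + `|Z w| + `|H w|.
have LG0 : lipL 2 k G0.
  apply: lipLD => //; last exact: lipV_norm.
  by apply: lipLD => //; [exact: lipL_cst|exact: lipV_norm].
have [C C0 hC] := lipL_bound kN LG0.
have G00 w : 0 <= G0 w by rewrite !addr_ge0.
(* Young's inequality is weighted unevenly: the coefficient [a] of the fixed term u ^ 2 is made
   small, and a large [b] is left to v ^ 2, which tends to 0. For p = 2 there is no fixed term. *)
have [[a b] /= [a0 b0 aC dom]] : exists ab : R * R, [/\ 0 <= ab.1, 0 <= ab.2,
    ab.1 * C <= e1 / 2 & forall (u v : R), 0 <= u -> 0 <= v ->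
      (A * ((2 * u + v) ^+ r * v)) ^+ p <= ab.1 * u ^+ 2 + ab.2 * v ^+ 2].
  have [[-> ->]|[-> ->]] := exponents; last first.
    exists (0, A ^+ 2); split => //=; [exact: exprn_ge0|by rewrite mul0r|].
    by move=> u v _ _; rewrite expr0 mul1r mul0r add0r exprMn.
  have AC : 0 < A * C + 1 by rewrite ltr_wpDl// mulr_ge0.
  pose s := e1 / 2 / (A * C + 1); have s0 : 0 < s by rewrite !divr_gt0.
  exists (A * s, A * (s^-1 + 1)); split => /=.
  - by rewrite mulr_ge0// ltW.
  - by rewrite mulr_ge0// addr_ge0// invr_ge0 ltW.
  - rewrite [leLHS](_ : _ = e1 / 2 * (A * C / (A * C + 1))); last by rewrite /s; ring.
    by apply: ler_piMr => //; rewrite ler_pdivrMr// mul1r lerDl.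
  move=> u v u0 v0; rewrite !expr1.
  rewrite [leRHS](_ : _ = A * (s * u ^+ 2 + (s^-1 + 1) * v ^+ 2)); last by ring.
  rewrite ler_wpM2l//.
  have sq := sqr_ge0 (s * u - v); rewrite -(ler_pM2l s0).
  have -> : s * (s * u ^+ 2 + (s^-1 + 1) * v ^+ 2) =
      (s * u) ^+ 2 + v ^+ 2 + s * v ^+ 2 by field; rewrite gt_eqF.
  by rewrite !expr2 in sq *; nra.
have b1 : 0 < b + 1 by rewrite ltr_wpDl.
have [del1 del10 h1] := fixed_direction e10.
have [del2 del20 h2] := Ht_cvg (divr_gt0 (divr_gt0 e10 (ltr0Sn R 1)) b1).
exists (Num.min 1 (Num.min del1 del2)); first by rewrite !lt_min ltr01 del10.
move=> t /andP[t0]; rewrite !lt_min => /and3P[t1 td1 td2].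
have t01 : 0 < t <= 1 by rewrite t0 ltW.
have mR : meas (fun w => `|Ht t w - H w|) := (dist_Ht t01).1.
have mq : meas (quot t) := (quot_L t01).1.
have mqH : meas (quot_Ht t) := (quotient_L t01).1.
have pert : mean_le (fun w => `|quot_Ht t w - quot t w| ^+ p) e1.
  apply: (@mean_leW _ _ _ _ _ _ _ _ (a * C + b * (e1 / 2 / (b + 1)))).
    rewrite [leRHS]splitr lerD// mulrCA; apply: ler_piMr => //.
    by rewrite ler_pdivrMr// mul1r lerDl.
  have {}h2 := h2 t; rewrite t0 in h2.
  apply: (mean_le_dom2 _ _ _ a0 b0 _ hC (h2 td2)).
  - by apply: measurable_normX; exact: measurable_funB.
  - by apply: measurable_normX; exact: LG0.1.
  - by apply: measurable_normX; apply: measurable_funB.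
  move=> w; rewrite subr0 !normrX !normr_id [`|G0 w|]ger0_norm//.
  apply: le_trans (dom _ _ (G00 w) (normr_ge0 (Ht t w - H w))).
  rewrite lerXn2r ?nnegrE ?mulr_ge0 ?exprn_ge0 ?addr_ge0 ?mulr_ge0//.
  exact: perturbation_le.
rewrite [e]splitr -[e / 2](@divfK _ (2 ^+ p)) ?gt_eqF// mulrC.
have {}h1 := h1 t; rewrite t0 in h1.
apply: (mean_le_dom2 _ _ _ _ _ _ pert (h1 td1)); [| | |exact: ltW|exact: ltW|].
- by apply: measurable_normX; exact: measurable_funB.
- by apply: measurable_normX; exact: measurable_funB.
- by apply: measurable_normX; exact: measurable_funB.
move=> w; rewrite !normrX !normr_id.
have := ler_normD_exp p (quot_Ht t w - quot t w) (quot t w - dgH w).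
by rewrite addrA subrK.
Qed.

End Direction.
End Derivative.
End Composition.

(** * Derivatives in the mean *)

Section MeanConvergence.
Context {R : realType} {Omega : pointedType} {d : nat} {Theta : Type}.
Variables (W : nat -> Omega -> 'cV[R]_d) (F : Theta -> probability (borelM R d 1) R).
Variable N : nat.
Local Notation meas := (measurable_fun [set: OmegaF W N]).
Local Notation mean_le := (mean_le W F N).
Local Notation lipL := (lipL W F N).
Local Notation lipV := (lipV W F N).
Local Notation mean_cvg := (mean_cvg W F N).

(** Membership is required for 0 < t <= 1 only, the range in which perturbed controls remain in the
    convex sets. *)
Definition tends p k (X : R -> Omega -> R) (Y : Omega -> R) : Prop :=
  [/\ forall t : R, 0 < t <= 1 -> lipL p k (X t), lipL p k Y & mean_cvg p X Y].

Definition tendsV k q (V : R -> Omega -> 'cV[R]_q) (H : Omega -> 'cV[R]_q) : Prop :=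
  forall i, tends 2 k (fun t w => V t w i 0) (fun w => H w i 0).

Lemma mean_cvg_cst p (Y : Omega -> R) : (0 < p)%N -> mean_cvg p (fun=> Y) Y.
Proof.
move=> p0 e e0; exists 1 => // t _; apply: (mean_leW (ltW e0)).
rewrite (_ : (fun w => _) = fun=> 0); first exact: mean_le_cst.
by apply/funext => w; rewrite subrr normr0 expr0n eqn0Ngt p0.
Qed.

Lemma tends_cst p k Y : (0 < p)%N -> lipL p k Y -> tends p k (fun=> Y) Y.
Proof. by move=> p0 LY; split => //; exact: mean_cvg_cst. Qed.

Lemma tends_mono p k k' X Y : (k <= k')%N -> (k' <= N)%N -> tends p k X Y -> tends p k' X Y.
Proof.
move=> kk kN [LX LY XY]; split => // [t t01|]; apply: (lipL_mono kk kN) => //.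
exact: LX.
Qed.

Lemma tendsD p k X X' Y Y' : (k <= N)%N -> tends p k X Y -> tends p k X' Y' ->
  tends p k (fun t w => X t w + X' t w) (fun w => Y w + Y' w).
Proof.
move=> kN [LX LY XY] [LX' LY' XY']; split.
- by move=> t t01; apply: lipLD => //; [exact: LX|exact: LX'].
- exact: lipLD.
move=> e e0; have p20 : 0 < 2 ^+ p :> R by rewrite exprn_gt0.
have e10 : 0 < e / 2 / 2 ^+ p by rewrite !divr_gt0.
have [del1 del10 h1] := XY _ e10; have [del2 del20 h2] := XY' _ e10.
exists (Num.min 1 (Num.min del1 del2)); first by rewrite !lt_min ltr01 del10.
move=> t /andP[t0]; rewrite !lt_min => /and3P[t1 td1 td2].
have t01 : 0 < t <= 1 by rewrite t0 ltW.
have {}h1 := h1 t; rewrite t0 in h1; have {}h2 := h2 t; rewrite t0 in h2.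
rewrite [e]splitr -[e / 2](@divfK _ (2 ^+ p)) ?gt_eqF// mulrC.
have mX := (LX t t01).1; have mX' := (LX' t t01).1.
have mY := LY.1; have mY' := LY'.1.
apply: (mean_le_dom2 _ _ _ _ _ _ (h1 td1) (h2 td2)); [| | |exact: ltW|exact: ltW|].
- by apply: measurable_normX; apply: measurable_funB; exact: measurable_funD.
- by apply: measurable_normX; exact: measurable_funB.
- by apply: measurable_normX; exact: measurable_funB.
move=> w; rewrite !normrX !normr_id.
have := ler_normD_exp p (X t w - Y w) (X' t w - Y' w).
by rewrite addrACA -opprD.
Qed.

Lemma tends_sum p k (I : Type) (s : seq I) X Y : (0 < p)%N -> (k <= N)%N ->
  (forall i, tends p k (X i) (Y i)) ->
  tends p k (fun t w => \sum_(i <- s) X i t w) (fun w => \sum_(i <- s) Y i w).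
Proof.
move=> p0 kN XY; elim: s => [|i s IH].
  rewrite (_ : (fun t w => _) = fun=> fun=> 0); last first.
    by apply/funext => t; apply/funext => w; rewrite big_nil.
  rewrite (_ : (fun w => _) = fun=> 0); last by apply/funext => w; rewrite big_nil.
  by apply: tends_cst => //; exact: lipL_cst.
rewrite (_ : (fun t w => _) = fun t w => X i t w + \sum_(j <- s) X j t w); last first.
  by apply/funext => t; apply/funext => w; rewrite big_cons.
rewrite (_ : (fun w => _) = fun w => Y i w + \sum_(j <- s) Y j w); last first.
  by apply/funext => w; rewrite big_cons.
exact: tendsD.
Qed.

Lemma mean_cvgV k q (V : R -> Omega -> 'cV[R]_q) H : (k <= N)%N -> tendsV k V H ->
  mean_cvg 2 (fun t w => `|V t w - H w|) (fun=> 0).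
Proof.
move=> kN VH.
have bound (v : 'cV[R]_q) : `|v| ^+ 2 <= \sum_i `|v i 0| ^+ 2.
  have [/eqP v0|v0] := boolP (mx_norm v == 0).
    by rewrite (_ : `|v| = 0)// expr0n sumr_ge0// => i _; rewrite exprn_ge0.
  have [[i j] /= vE] := mx_norm_neq0 v0.
  rewrite (_ : `|v| = `|v i 0|); last by rewrite -(ord1 j) -vE.
  by rewrite (bigD1 i)//= lerDl sumr_ge0// => l _; rewrite exprn_ge0.
pose S t w := \sum_i `|V t w i 0 - H w i 0| ^+ 2.
have mV i t : 0 < t <= 1 -> meas (fun w => V t w i 0).
  by move=> t01; have [h _ _] := VH i; exact: (h t t01).1.
have mH i : meas (fun w => H w i 0) by have [_ h _] := VH i; exact: h.1.
have sumcvg (s : seq 'I_q) e : 0 < e -> exists2 del : R, 0 < del & forall t : R,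
    0 < t < del -> mean_le (fun w => \sum_(i <- s) `|V t w i 0 - H w i 0| ^+ 2) e.
  elim: s e => [|i s IH] e e0.
    exists 1 => // t _; apply: (mean_leW (ltW e0)).
    by under eq_fun do rewrite big_nil; exact: mean_le_cst.
  have e20 : 0 < e / 2 by rewrite divr_gt0.
  have [_ _ /(_ _ e20)[del1 del10 h1]] := VH i; have [del2 del20 h2] := IH _ e20.
  exists (Num.min 1 (Num.min del1 del2)); first by rewrite !lt_min ltr01 del10.
  move=> t /andP[t0]; rewrite !lt_min => /and3P[t1 td1 td2].
  have t01 : 0 < t <= 1 by rewrite t0 ltW.
  have {}h1 := h1 t; rewrite t0 in h1; have {}h2 := h2 t; rewrite t0 in h2.
  under eq_fun do rewrite big_cons.
  have mt j : meas (fun w => `|V t w j 0 - H w j 0| ^+ 2).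
    by apply: measurable_normX; apply: measurable_funB => //; exact: mV.
  have ms : meas (fun w => \sum_(j <- s) `|V t w j 0 - H w j 0| ^+ 2).
    exact: measurable_sum.
  apply: (mean_le_sum2 _ _ _ _ (h1 td1) (h2 td2)) => //.
    exact: measurable_funD.
  by move=> w; exact: ler_normD.
move=> e e0; have [del del0 h] := sumcvg (index_enum 'I_q) e e0.
exists (Num.min 1 del); first by rewrite lt_min ltr01.
move=> t /andP[t0]; rewrite lt_min => /andP[t1 td].
have t01 : 0 < t <= 1 by rewrite t0 ltW.
have {}h := h t; rewrite t0 in h.
have LN : lipL 2 k (fun w => `|V t w - H w|).
  apply: lipV_norm => // i; under eq_fun do rewrite !mxE.
  by have [h1 h2 _] := VH i; apply: lipLB => //; exact: h1.
apply: mean_le_mono (h td).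
- by apply: measurable_normX; apply: measurable_funB => //; exact: LN.1.
- apply: measurable_sum => i.
  by apply: measurable_normX; apply: measurable_funB => //; exact: mV.
move=> w; rewrite subr0 normrX !normr_id.
apply: le_trans (bound _) _; apply: le_trans (ler_norm _).
by apply: ler_sum => i _; rewrite !mxE.
Qed.

(** The content of the differentiability assumption and (H1)-(H3) for one scalar entry. The entries
    of b and sigma have p = 2, r = 0 and f has p = r = 1, with x and u stacked in z; varphi has p =
    r = 1 with z = x. *)
Definition smooth_coef p r k q (D : set 'cV[R]_q) (g : 'cV[R]_q -> Omega -> R)
    (Dg : 'cV[R]_q -> Omega -> 'rV[R]_q) : Prop :=
  exists2 L : R, 0 <= L & [/\
    forall w z, D z -> forall e : R, 0 < e ->
      exists2 del : R, 0 < del & forall z', D z' -> `|z' - z| < del ->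
        `|g z' w - g z w - (Dg z w *m (z' - z)) 0 0| <= e * `|z' - z|,
    forall w z, D z -> `|Dg z w| <= L * (1 + `|z|) ^+ r,
    forall alpha : R, 0 < alpha -> exists2 om, modulus om &
      forall w z z', D z -> D z' -> `|z| <= alpha -> `|z'| <= alpha ->
        `|Dg z w - Dg z' w| <= om `|z - z'|
    & forall z, D z -> lipL p k (g z)].

Section SmoothCoef.
Variables (p r k q : nat) (D : set 'cV[R]_q) (g : 'cV[R]_q -> Omega -> R).
Variable Dg : 'cV[R]_q -> Omega -> 'rV[R]_q.
Hypotheses (p_gt0 : (0 < p)%N) (pr2 : (p + r)%N = 2%N) (kN : (k <= N)%N).
Hypothesis D_conv : forall z h (t : R), D z -> D (z + h) -> 0 <= t <= 1 -> D (z + t *: h).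
Hypothesis g_coef : smooth_coef p r k D g Dg.

Lemma smooth_coef_comp Z : lipV k Z -> (forall w, D (Z w)) -> lipL p k (fun w => g (Z w) w).
Proof.
by have [L L0 [h1 h2 h3 h4]] := g_coef; exact: (lipL_comp kN p_gt0 pr2 L0 D_conv h1 h2 h4).
Qed.

Lemma smooth_coef_tends Z H (V : R -> Omega -> 'cV[R]_q) : lipV k Z ->
  (forall w, D (Z w)) -> (forall w, D (Z w + H w)) ->
  (forall t : R, 0 < t <= 1 -> forall w, D (Z w + t *: V t w)) -> tendsV k V H ->
  tends p k (fun t w => t^-1 * (g (Z w + t *: V t w) w - g (Z w) w))
    (fun w => (Dg (Z w) w *m H w) 0 0).
Proof.
move=> LZ DZ DZH DV VH; have [L L0 [h1 h2 h3 h4]] := g_coef.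
have LH : lipV k H by move=> i; have [] := VH i.
have LV (t : R) : 0 < t <= 1 -> lipV k (V t).
  by move=> t01 i; have [h _ _] := VH i; exact: h.
split.
- exact: (quotient_L kN p_gt0 pr2 L0 D_conv h1 h2 h4 LZ DZ LV DV).
- exact: (derivative_L kN p_gt0 pr2 L0 D_conv h1 h2 h3 h4 LZ LH DZ DZH).
- apply: (derivative_mean_cvg kN p_gt0 pr2 L0 D_conv h1 h2 h3 h4 LZ LH DZ DZH LV DV).
  exact: mean_cvgV VH.
Qed.

End SmoothCoef.

Section Noise.
Hypothesis Theta_inh : inhabited Theta.
Hypothesis F_A2 : A2 F.
Hypothesis W_A3 : A3 W F N.
Hypothesis W_Lc2 : noise_Lc2 W F N.

Lemma tends_noise k i X Y : (k < N)%N -> tends 2 k X Y ->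
  tends 2 k.+1 (fun t w => X t w * W k.+1 w i 0) (fun w => Y w * W k.+1 w i 0).
Proof.
move=> kN [LX LY XY]; split.
- move=> t t01; apply: (lipL_noise Theta_inh F_A2 W_A3 W_Lc2) => //; exact: LX.
- exact: (lipL_noise Theta_inh F_A2 W_A3 W_Lc2).
move=> e e0.
have [C C0 hC] := mean_le_noise Theta_inh F_A2 W_A3 W_Lc2 i kN.
have C1 : 0 < C + 1 by rewrite ltr_wpDl.
have [del del0 h] := XY _ (divr_gt0 e0 C1).
exists (Num.min 1 del); first by rewrite lt_min ltr01.
move=> t /andP[t0]; rewrite lt_min => /andP[t1 td].
have t01 : 0 < t <= 1 by rewrite t0 ltW.
apply: mean_leW (_ : mean_le _ (C * (e / (C + 1)))).
  by rewrite mulrCA ler_piMr ?(ltW e0)// ler_pdivrMr// mul1r lerDl.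
under eq_fun do rewrite -mulrBl.
apply: hC; first by apply: lipLB => //; [exact: ltnW|exact: LX].
by apply: h; rewrite t0.
Qed.

End Noise.

Lemma lipL_integrable k X P : (k <= N)%N -> lipL 1 k X -> calP W F N P ->
  P.-integrable setT (EFin \o X).
Proof.
move=> kN LX PP; have [C C0 hC] := lipL_bound kN LX.
apply/integrableP; split.
  by apply/measurable_EFinP; exact: LX.1.
apply: le_lt_trans (ltry C); have := hC P PP.
by under eq_integral do rewrite expr1 normr_id.
Qed.

(** Real-valued form of [Ehat], as Hahn-Banach requires; it is meaningful on [lipL 1 N], where the
    set of integrals is bounded. *)
Definition upperE (X : Omega -> R) : R :=
  sup [set (\int[P]_w X w)%R | P in calP W F N].

Hypothesis calP_neq0 : exists P : probability (OmegaF W N) R, calP W F N P.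

Let integ P X : calP W F N P -> lipL 1 N X -> P.-integrable setT (EFin \o X).
Proof. by move=> PP LX; exact: lipL_integrable LX PP. Qed.

Lemma int_mean_le P X c : calP W F N P -> lipL 1 N X ->
  mean_le (fun w => `|X w| ^+ 1) c -> `|(\int[P]_w X w)%R| <= c.
Proof.
move=> PP LX hX; apply: le_trans (le_normr_Rintegral _ (integ PP LX)) _ => //.
rewrite -lee_fin fineK; last first.
  apply: integrable_fin_num => //; exact: (integrable_norm (integ PP LX)).
apply: le_trans (hX P PP); rewrite le_eqVlt; apply/orP; left; apply/eqP.
by apply: eq_integral => w _; rewrite expr1 normr_id.
Qed.

Lemma upperE_has_sup X : lipL 1 N X ->
  has_sup [set (\int[P]_w X w)%R | P in calP W F N].
Proof.
move=> LX; have [P0 PP0] := calP_neq0; split; first by exists (\int[P0]_w X w)%R, P0.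
have [C C0 hC] := lipL_bound (leqnn N) LX.
exists C => _ [P PP <-]; apply: le_trans (ler_norm _) _; exact: int_mean_le.
Qed.

Lemma upperE_ge P X : calP W F N P -> lipL 1 N X -> (\int[P]_w X w)%R <= upperE X.
Proof. by move=> PP LX; apply: ub_le_sup; [exact: (upperE_has_sup LX).2|exists P]. Qed.

Lemma upperE_le X c : (forall P, calP W F N P -> (\int[P]_w X w)%R <= c) -> upperE X <= c.
Proof.
move=> h; have [P0 PP0] := calP_neq0; apply: ge_sup.
  by exists (\int[P0]_w X w)%R, P0.
by move=> _ [P PP <-]; exact: h.
Qed.

Lemma upperED X Y : lipL 1 N X -> lipL 1 N Y ->
  upperE (fun w => X w + Y w) <= upperE X + upperE Y.
Proof.
move=> LX LY; apply: upperE_le => P PP.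
by rewrite RintegralD//; [rewrite lerD// upperE_ge|exact: integ|exact: integ].
Qed.

Lemma upperEZ a X : lipL 1 N X -> 0 <= a -> upperE (fun w => a * X w) = a * upperE X.
Proof.
move=> LX; have intZ (c : R) P : calP W F N P ->
    (\int[P]_w (c * X w) = c * \int[P]_w X w)%R.
  by move=> PP; rewrite RintegralZl//; exact: integ.
rewrite le_eqVlt => /predU1P[<-|a0].
  rewrite mul0r; apply/eqP; rewrite eq_le; apply/andP; split.
    by apply: upperE_le => P PP; rewrite intZ// mul0r.
  have [P0 PP0] := calP_neq0.
  have := upperE_ge PP0 (lipLZ (leqnn N) 0 (isT : (0 < 1)%N) LX).
  by rewrite intZ// mul0r.
apply/eqP; rewrite eq_le; apply/andP; split.
  by apply: upperE_le => P PP; rewrite intZ// ler_pM2l// upperE_ge.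
rewrite mulrC -ler_pdivlMr//; apply: upperE_le => P PP.
by rewrite ler_pdivlMr// mulrC -intZ// upperE_ge//; exact: lipLZ.
Qed.

Lemma upperE_dist X Y c : lipL 1 N X -> lipL 1 N Y ->
  mean_le (fun w => `|X w - Y w| ^+ 1) c -> upperE X <= upperE Y + c.
Proof.
move=> LX LY h; apply: upperE_le => P PP.
have LD := lipLB (leqnn N) LX LY.
have := int_mean_le PP LD h; rewrite RintegralB//; [|exact: integ|exact: integ].
move=> /(le_trans (ler_norm _)); rewrite lerBlDl => /le_trans; apply.
by rewrite lerD2r upperE_ge.
Qed.

Lemma expectation_Rintegral P X : calP W F N P -> lipL 1 N X ->
  ('E_P[(X : OmegaF W N -> R)] = (\int[P]_w X w)%R%:E)%E.
Proof.
by move=> PP LX; rewrite unlock fineK//; apply: integrable_fin_num => //; exact: integ.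
Qed.

Lemma Ehat_upperE X : lipL 1 N X -> Ehat W F N X = (upperE X)%:E.
Proof.
move=> LX; apply/eqP; rewrite eq_le; apply/andP; split.
  apply: ge_ereal_sup => _ [P PP <-].
  by rewrite expectation_Rintegral// lee_fin upperE_ge.
have fin : Ehat W F N X \is a fin_num.
  have [P0 PP0] := calP_neq0; rewrite fin_numE; apply/andP; split.
    have : ('E_P0[(X : OmegaF W N -> R)] <= Ehat W F N X)%E.
      by apply: ereal_sup_ubound; exists P0.
    by rewrite expectation_Rintegral//; case: (Ehat _ _ _ _).
  have : (Ehat W F N X <= (upperE X)%:E)%E.
    apply: ge_ereal_sup => _ [P PP <-].
    by rewrite expectation_Rintegral// lee_fin upperE_ge.
  by case: (Ehat _ _ _ _).
rewrite -(fineK fin) lee_fin; apply: upperE_le => P PP.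
rewrite -lee_fin (fineK fin) -expectation_Rintegral//.
by apply: ereal_sup_ubound; exists P.
Qed.

Lemma lipL_linear_set p k : (0 < p)%N -> (k <= N)%N -> linear_set (lipL p k).
Proof.
move=> p0 kN; split=> [|a X Y LX LY]; last exact: lipL_lin.
exact: (@lipL_cst _ _ _ _ W F N k kN p 0 p0).
Qed.

Lemma upperE_sublinear : sublinear_on (lipL 1 N) upperE.
Proof. by split=> [X Y LX LY|a X LX a0]; [exact: upperED|exact: upperEZ]. Qed.

End MeanConvergence.

(** * Dominated linear functionals as expectations *)

Section Representation.
Context {R : realType} {Omega : pointedType} {d : nat} {Theta : Type}.
Variables (W : nat -> Omega -> 'cV[R]_d) (F : Theta -> probability (borelM R d 1) R).
Variable N : nat.
Hypotheses (Theta_inh : inhabited Theta) (F_A2 : A2 F) (W_A3 : A3 W F N).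
Local Notation lipL := (lipL W F N).
Local Notation upperE := (upperE W F N).

(** The measure is found from the functions of the noise path. It represents l on all of [lipL 1 N]
    because l and the integral under P both move by at most the uniform mean distance, for which
    these functions are dense. *)
Lemma represent_upperE (l : (Omega -> R) -> R) : linear_on (lipL 1 N) l ->
  (forall X, lipL 1 N X -> l X <= upperE X) ->
  exists2 P : probability (OmegaF W N) R, calP W F N P &
    forall X, lipL 1 N X -> (\int[P]_w X w)%R = l X.
Proof.
move=> llin lE; have neP := calP_nonempty Theta_inh F_A2 W_A3.
have Lphi phi (cphi : @Cblip R d N phi) := @lipL_Cblip _ _ _ _ W F N N (leqnn N) 1 phi isT cphi.
pose l' (phi : 'M[R]_(d, N) -> R) := l (fun w => phi (Wpath W N w)).
have l'lin : linear_on (@Cblip R d N) l'.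
  by move=> a phi psi cphi cpsi; exact: (llin a _ _ (Lphi _ cphi) (Lphi _ cpsi)).
have intL P X : calP W F N P -> lipL 1 N X -> ((\int[P]_w X w)%R%:E = \int[P]_w (X w)%:E)%E.
  move=> PP LX; rewrite fineK//; apply: integrable_fin_num => //.
  exact: lipL_integrable LX PP.
have l'E phi : Cblip phi -> l' phi <= Elip F phi.
  move=> cphi; apply: le_trans (lE _ (Lphi _ cphi)) _; apply: upperE_le => // P PP.
  by rewrite -lee_fin intL//; [exact: calP_Elip|exact: Lphi].
have [P PP PE] := represent Theta_inh F_A2 W_A3 l'lin l'E; exists P => // X LX.
apply/eqP; rewrite -subr_eq0 -normr_le0; apply/ler_addgt0Pr => e e0; rewrite add0r.
have [phi cphi h] := LX.2 _ (divr_gt0 e0 (ltr0Sn _ 1)).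
pose Y w := phi (Wpath W N w); have LY : lipL 1 N Y := Lphi _ cphi.
have lsub A B c : lipL 1 N A -> lipL 1 N B ->
    mean_le W F N (fun w => `|A w - B w| ^+ 1) c -> l A - l B <= c.
  move=> LA LB hc; have LD := lipLB (leqnn N) LA LB.
  have -> : l A - l B = l (fun w => A w - B w).
    rewrite (_ : (fun w => _) = (-1) *: B + A); first by rewrite llin// mulN1r addrC.
    by apply/funext => w; rewrite scaleN1r addrC.
  apply: le_trans (lE _ LD) _; apply: upperE_le => // P' PP'.
  by apply: le_trans (ler_norm _) _; exact: (int_mean_le PP' LD hc).
have h' : mean_le W F N (fun w => `|Y w - X w| ^+ 1) (e / 2).
  by rewrite (_ : (fun w => _) = fun w => `|X w - Y w| ^+ 1)//; apply/funext => w; rewrite distrC.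
have lY : (\int[P]_w Y w)%R = l Y.
  by have := PE _ cphi; rewrite -intL// => -[].
have := int_mean_le PP (lipLB (leqnn N) LX LY) h.
rewrite RintegralB//; [|exact: lipL_integrable LX PP|exact: lipL_integrable LY PP].
have := lsub _ _ _ LX LY h; have := lsub _ _ _ LY LX h'.
rewrite lY; set x := (\int[P]_w X w)%R; rewrite !ler_norml; lra.
Qed.

End Representation.

(** * The control problem *)

Section Jacobian.
Context {R : realType}.

Lemma norm_row p q (A : 'M[R]_(p, q)) i : `|row i A| <= `|A|.
Proof. by apply/mx_norm_leP => // i' j; rewrite mxE ler_entry_norm. Qed.

Lemma norm_lrsubmx p q1 q2 (A : 'M[R]_(p, q1 + q2)) :
  `|A| <= `|lsubmx A| + `|rsubmx A|.
Proof.
apply/mx_norm_leP => [|i j]; first by rewrite addr_ge0.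
have -> : A i j = row_mx (lsubmx A) (rsubmx A) i j by rewrite hsubmxK.
rewrite mxE; case: (fintype.split j) => j'.
  by rewrite (le_trans (ler_entry_norm _ _ _))// lerDl.
by rewrite (le_trans (ler_entry_norm _ _ _))// lerDr.
Qed.

Lemma norm_usubmx p1 p2 q (A : 'M[R]_(p1 + p2, q)) : `|usubmx A| <= `|A|.
Proof. by apply/mx_norm_leP => // i j; rewrite mxE ler_entry_norm. Qed.

Lemma norm_dsubmx p1 p2 q (A : 'M[R]_(p1 + p2, q)) : `|dsubmx A| <= `|A|.
Proof. by apply/mx_norm_leP => // i j; rewrite mxE ler_entry_norm. Qed.

Lemma is_jacobian_row p q (D : set 'cV[R]_q) (G : 'cV[R]_q -> 'cV[R]_p) z0 A i :
  is_jacobian D G z0 A -> forall e : R, 0 < e -> exists2 del : R, 0 < del &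
    forall z, D z -> `|z - z0| < del ->
      `|G z i 0 - G z0 i 0 - (row i A *m (z - z0)) 0 0| <= e * `|z - z0|.
Proof.
move=> jac e e0; have := jac e e0; rewrite near_withinE => /nbhs_ballP[del /= del0 h].
exists del => // z Dz zd; have := h z; rewrite -ball_normE /= distrC => /(_ zd Dz).
apply: le_trans.
have := ler_entry_norm (G z - G z0 - A *m (z - z0)) i 0.
by rewrite -row_mul !mxE.
Qed.

Lemma scale_sub_entry p q (a : R) (A B : 'M[R]_(p, q)) i j :
  (a *: (A - B)) i j = a * (A i j - B i j).
Proof. by rewrite !mxE. Qed.

Lemma opprD_addrACA (V : zmodType) (x y z v : V) : x + y - (z + v) = x - z + (y - v).
Proof. by rewrite opprD addrACA. Qed.

(** (H3) uses |x - x'| + |u - u'|, which is at most twice the maximum norm of the stacked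
    difference. *)
Lemma modulus_comp2 (om : R -> R) : modulus om -> modulus (fun r => om (2 * r)).
Proof.
move=> [om0 om_mono om_0 om_cvg]; split.
- by move=> r r0; apply: om0; rewrite mulr_ge0.
- by move=> r s r0 rs; apply: om_mono; rewrite ?mulr_ge0// ler_wpM2l.
- by rewrite mulr0.
apply/cvgrPdist_le => e e0; have /cvgrPdist_le /(_ e e0) := om_cvg.
rewrite !near_withinE => /nbhs_ballP[del /= del0 h].
apply/nbhs_ballP; exists (del / 2) => /=; first by rewrite divr_gt0.
move=> x; rewrite -ball_normE /= sub0r normrN => xd x0.
apply: h; last by rewrite /= mulr_gt0.
by rewrite -ball_normE /= sub0r normrN normrM ger0_norm// mulrC -ltr_pdivlMr.
Qed.

End Jacobian.

Section ControlProblem.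
Context {R : realType} {Omega : pointedType} {d n m : nat} {Theta : Type}.
Variables (W : nat -> Omega -> 'cV[R]_d) (F : Theta -> probability (borelM R d 1) R).
Variables (N : nat) (U : nat -> set 'cV[R]_m) (x0 : 'cV[R]_n).
Variables (b : nat -> 'cV[R]_n -> 'cV[R]_m -> Omega -> 'cV[R]_n)
  (sigma : nat -> 'I_d -> 'cV[R]_n -> 'cV[R]_m -> Omega -> 'cV[R]_n)
  (f : nat -> 'cV[R]_n -> 'cV[R]_m -> Omega -> R)
  (varphi : 'cV[R]_n -> Omega -> R).
Variables (Db : nat -> 'cV[R]_n -> 'cV[R]_m -> Omega -> 'M[R]_(n, n + m))
  (Dsigma : nat -> 'I_d -> 'cV[R]_n -> 'cV[R]_m -> Omega -> 'M[R]_(n, n + m))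
  (Df : nat -> 'cV[R]_n -> 'cV[R]_m -> Omega -> 'rV[R]_(n + m))
  (Dvarphi : 'cV[R]_n -> Omega -> 'rV[R]_n).
Hypotheses (N_gt0 : (0 < N)%N) (d_gt0 : (0 < d)%N) (Theta_inh : inhabited Theta).
Hypotheses (F_A2 : A2 F) (W_A3 : A3 W F N) (W_Lc2 : noise_Lc2 W F N).
Hypothesis U_ok : control_sets N U.
Hypothesis derivs : coef_derivatives N U b sigma f varphi Db Dsigma Df Dvarphi.
Hypothesis hyp1 : H1 W F N U b sigma f varphi.
Hypothesis hyp2 : H2 N U Db Dsigma Df Dvarphi.
Hypothesis hyp3 : H3 N U Db Dsigma Df Dvarphi.

Local Notation lipL := (lipL W F N).
Local Notation lipV := (lipV W F N).
Local Notation tends := (tends W F N).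
Local Notation tendsV := (tendsV W F N).
Local Notation adm := (admissible W F N U).
Local Notation st := (state W x0 b sigma).
Local Notation cst u := (cost W N x0 b sigma f varphi u).
Local Notation vst ustar := (var_state W x0 b sigma Db Dsigma ustar).
Local Notation vcost ustar := (var_cost W N x0 b sigma Db Dsigma Df Dvarphi ustar).

Let neP : exists P : probability (OmegaF W N) R, calP W F N P :=
  calP_nonempty Theta_inh F_A2 W_A3.

Let Dk k := [set z : 'cV[R]_(n + m) | U k (dsubmx z)].

Lemma control_segment k z h (t : R) : (k < N)%N -> U k z -> U k (z + h) ->
  0 <= t <= 1 -> U k (z + t *: h).
Proof.
move=> kN Uz Uzh /andP[t0 t1]; have [_ conv] := U_ok kN.
have := conv (z + h) z (Itv01 t0 t1); rewrite !inE => /(_ Uzh Uz).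
rewrite /conv /= => Uc; rewrite (_ : z + t *: h = t *: (z + h) + (1 - t) *: z)//.
by rewrite scalerDr scalerBl scale1r addrAC [t *: z + _]addrC subrK.
Qed.

Lemma Dk_segment k z h (t : R) : (k < N)%N -> Dk k z -> Dk k (z + h) ->
  0 <= t <= 1 -> Dk k (z + t *: h).
Proof.
move=> kN; rewrite /Dk /=.
have -> : dsubmx (z + h) = dsubmx z + dsubmx h by apply/matrixP => i j; rewrite !mxE.
have -> : dsubmx (z + t *: h) = dsubmx z + t *: dsubmx h.
  by apply/matrixP => i j; rewrite !mxE.
exact: control_segment.
Qed.

(** (H2) states the bounds for b, f and varphi jointly with those for sigma^l, so an index l is
    needed to read them off. *)
Let l0 : 'I_d := Ordinal d_gt0.

Let jacobian_xu_row p k (G : 'cV[R]_n -> 'cV[R]_m -> 'cV[R]_p) z A i :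
  is_jacobian_xu U k G (usubmx z) (dsubmx z) A -> forall e : R, 0 < e ->
  exists2 del : R, 0 < del & forall z', Dk k z' -> `|z' - z| < del ->
    `|G (usubmx z') (dsubmx z') i 0 - G (usubmx z) (dsubmx z) i 0 -
      (row i A *m (z' - z)) 0 0| <= e * `|z' - z|.
Proof. by rewrite /is_jacobian_xu vsubmxK; exact: is_jacobian_row. Qed.

Let mod_norm (om : R -> R) (z z' : 'cV[R]_(n + m)) : modulus om ->
  om (`|usubmx z - usubmx z'| + `|dsubmx z - dsubmx z'|) <= om (2 * `|z - z'|).
Proof.
move=> [_ om_mono _ _]; apply: om_mono; first by rewrite addr_ge0.
have -> : usubmx z - usubmx z' = usubmx (z - z') by apply/matrixP => i j; rewrite !mxE.
have -> : dsubmx z - dsubmx z' = dsubmx (z - z') by apply/matrixP => i j; rewrite !mxE.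
by rewrite mulr_natl mulr2n lerD ?norm_usubmx ?norm_dsubmx.
Qed.

Lemma smooth_b k i : (k < N)%N -> smooth_coef W F N 2 0 k (Dk k)
  (fun z w => b k (usubmx z) (dsubmx z) w i 0)
  (fun z w => row i (Db k (usubmx z) (dsubmx z) w)).
Proof.
move=> kN; have [L L0 hL] := hyp2; exists L; first exact: ltW.
split.
- move=> w z Dz; have [jb _ _] := derivs.1 w k (usubmx z) _ kN Dz.
  exact: (jacobian_xu_row (G := fun x u => b k x u w)).
- move=> w z Dz; rewrite expr0 mulr1 (le_trans (norm_row _ _))//.
  have [h _] := hL w k (usubmx z) _ l0 kN Dz.
  by rewrite (le_trans (norm_lrsubmx _))// (le_trans _ h)// -addrA lerDl addr_ge0.
- move=> alpha a0; have [om mom h] := hyp3 a0.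
  exists (fun r => om (2 * r)); first exact: modulus_comp2.
  move=> w z z' Dz Dz' za za'.
  have [h1 _ _] := h w k (usubmx z) (usubmx z') _ _ kN Dz Dz'
    (le_trans (norm_usubmx z) za) (le_trans (norm_usubmx z') za')
    (le_trans (norm_dsubmx z) za) (le_trans (norm_dsubmx z') za').
  apply: le_trans (mod_norm z z' mom); apply: le_trans h1.
  by rewrite -linearB (le_trans (norm_row _ _))// lerDl.
- move=> z Dz; have [h1 _ _] := hyp1.1 k (usubmx z) _ kN Dz.
  exact: (Lc_lipL (isT : (0 < 2)%N) (ltnW kN) neP (h1 _)).
Qed.

Lemma smooth_sigma k l i : (k < N)%N -> smooth_coef W F N 2 0 k (Dk k)
  (fun z w => sigma k l (usubmx z) (dsubmx z) w i 0)
  (fun z w => row i (Dsigma k l (usubmx z) (dsubmx z) w)).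
Proof.
move=> kN; have [L L0 hL] := hyp2; exists L; first exact: ltW.
split.
- move=> w z Dz; have [_ js _] := derivs.1 w k (usubmx z) _ kN Dz.
  exact: (jacobian_xu_row (G := fun x u => sigma k l x u w)).
- move=> w z Dz; rewrite expr0 mulr1 (le_trans (norm_row _ _))//.
  have [h _] := hL w k (usubmx z) _ l kN Dz.
  by rewrite (le_trans (norm_lrsubmx _))// (le_trans _ h)// -[leRHS]addrA lerDr addr_ge0.
- move=> alpha a0; have [om mom h] := hyp3 a0.
  exists (fun r => om (2 * r)); first exact: modulus_comp2.
  move=> w z z' Dz Dz' za za'.
  have [_ h1 _] := h w k (usubmx z) (usubmx z') _ _ kN Dz Dz'
    (le_trans (norm_usubmx z) za) (le_trans (norm_usubmx z') za')
    (le_trans (norm_dsubmx z) za) (le_trans (norm_dsubmx z') za').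
  apply: le_trans (mod_norm z z' mom); apply: le_trans (h1 l).
  by rewrite -linearB (le_trans (norm_row _ _))// lerDl.
- move=> z Dz; have [_ h1 _] := hyp1.1 k (usubmx z) _ kN Dz.
  exact: (Lc_lipL (isT : (0 < 2)%N) (ltnW kN) neP (h1 l i)).
Qed.

Lemma smooth_f k : (k < N)%N -> smooth_coef W F N 1 1 k (Dk k)
  (fun z w => f k (usubmx z) (dsubmx z) w)
  (fun z w => Df k (usubmx z) (dsubmx z) w).
Proof.
(* The factor 2 absorbs |x| + |u| <= 2 |z| for the stacked z. *)
move=> kN; have [L L0 hL] := hyp2; exists (2 * L); first by rewrite mulr_ge0 ?ltW.
split.
- move=> w z Dz; have [_ _ jf] := derivs.1 w k (usubmx z) _ kN Dz.
  move=> e e0; have [del del0 h] :=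
    jacobian_xu_row (G := fun x u => (f k x u w)%:M) 0 jf e0.
  exists del => // z' Dz' zd; have := h z' Dz' zd.
  by rewrite !mxE !mulr1n row_id.
- move=> w z Dz; have [_ h] := hL w k (usubmx z) _ l0 kN Dz.
  rewrite expr1 (le_trans (norm_lrsubmx _))//.
  apply: (@le_trans _ _ (L * (1 + `|usubmx z| + `|dsubmx z|))).
    by apply: le_trans h; rewrite lerDl.
  rewrite [2 * L]mulrC -mulrA ler_wpM2l ?(ltW L0)//.
  by have := norm_usubmx z; have := norm_dsubmx z; have := normr_ge0 z; lra.
- move=> alpha a0; have [om mom h] := hyp3 a0.
  exists (fun r => om (2 * r)); first exact: modulus_comp2.
  move=> w z z' Dz Dz' za za'.
  have [_ _ h1] := h w k (usubmx z) (usubmx z') _ _ kN Dz Dz'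
    (le_trans (norm_usubmx z) za) (le_trans (norm_usubmx z') za')
    (le_trans (norm_dsubmx z) za) (le_trans (norm_dsubmx z') za').
  apply: le_trans (mod_norm z z' mom); apply: le_trans h1.
  by rewrite lerDl.
- move=> z Dz; have [_ _ h1] := hyp1.1 k (usubmx z) _ kN Dz.
  exact: (Lc_lipL (isT : (0 < 1)%N) (ltnW kN) neP h1).
Qed.

Lemma smooth_varphi : smooth_coef W F N 1 1 N setT varphi Dvarphi.
Proof.
(* The conditions on [Dvarphi] come with a control variable; it is frozen at some u0 in U_0, whose
   norm enters the constants. *)
have [L L0 hL] := hyp2; have [[u0 Uu0] _] := U_ok N_gt0.
exists (L * (1 + `|u0|)); first by rewrite mulr_ge0 ?(ltW L0)// addr_ge0.
split.
- move=> w z _ e e0; have [del del0 h] := is_jacobian_row 0 (derivs.2 w z) e0.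
  exists del => // z' Dz' zd; have := h z' Dz' zd.
  by rewrite !mxE !mulr1n row_id.
- move=> w z _; have [_ h] := hL w 0%N z _ l0 N_gt0 Uu0.
  rewrite expr1; apply: (@le_trans _ _ (L * (1 + `|z| + `|u0|))).
    by apply: le_trans h; rewrite lerDr addr_ge0.
  rewrite -mulrA ler_wpM2l ?(ltW L0)//.
  by have := mulr_ge0 (normr_ge0 z) (normr_ge0 u0); rewrite mulrDl mulrDr; lra.
- move=> alpha a0; have a1 : 0 < alpha + `|u0| by rewrite ltr_pwDl.
  have [om mom h] := hyp3 a1; exists om => // w z z' _ _ za za'.
  have ale (y : 'cV[R]_n) : `|y| <= alpha -> `|y| <= alpha + `|u0|.
    by move=> ya; rewrite (le_trans ya)// lerDl.
  have ule : `|u0| <= alpha + `|u0| by rewrite lerDr ltW.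
  have [h1 _ _] := h w 0%N z z' u0 u0 N_gt0 Uu0 Uu0 (ale _ za) (ale _ za') ule ule.
  rewrite subrr normr0 addr0 in h1; apply: le_trans h1; by rewrite lerDr.
- by move=> z _; apply: Lc_lipL => //; exact: hyp1.2.
Qed.

Let xi (u : nat -> Omega -> 'cV[R]_m) k w : 'cV[R]_(n + m) := col_mx (st u k w) (u k w).

Lemma lipV_col_mx k (X : Omega -> 'cV[R]_n) (Y : Omega -> 'cV[R]_m) :
  lipV k X -> lipV k Y -> lipV k (fun w => col_mx (X w) (Y w)).
Proof.
move=> LX LY i; rewrite -(fintype.splitK i); case: (fintype.split i) => j /=.
  by under eq_fun do rewrite col_mxEu; exact: LX.
by under eq_fun do rewrite col_mxEd; exact: LY.
Qed.

Lemma tendsV_col_mx k (X : R -> Omega -> 'cV[R]_n) (Y : R -> Omega -> 'cV[R]_m) X' Y' :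
  tendsV k X X' -> tendsV k Y Y' ->
  tendsV k (fun t w => col_mx (X t w) (Y t w)) (fun w => col_mx (X' w) (Y' w)).
Proof.
move=> LX LY i; rewrite -(fintype.splitK i); case: (fintype.split i) => j /=.
  rewrite (_ : (fun w => _) = fun w => X' w j 0); last first.
    by apply/funext => w; rewrite col_mxEu.
  rewrite (_ : (fun t w => _) = fun t w => X t w j 0)//.
  by apply/funext => t; apply/funext => w; rewrite col_mxEu.
rewrite (_ : (fun w => _) = fun w => Y' w j 0); last first.
  by apply/funext => w; rewrite col_mxEd.
rewrite (_ : (fun t w => _) = fun t w => Y t w j 0)//.
by apply/funext => t; apply/funext => w; rewrite col_mxEd.
Qed.

Lemma adm_lipV u k : adm u -> (k < N)%N -> lipV k (u k).
Proof. by move=> au kN i; exact: (Lc_lipL (isT : (0 < 2)%N) (ltnW kN) neP ((au k kN).2 i)). Qed.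

Lemma stateS u k w i : st u k.+1 w i 0 = b k (st u k w) (u k w) w i 0 +
  \sum_(l < d) sigma k l (st u k w) (u k w) w i 0 * W k.+1 w l 0.
Proof.
rewrite /= mxE summxE; congr (_ + _); apply: eq_bigr => l _.
by rewrite mxE mulrC.
Qed.

Lemma xi_D u k w : adm u -> (k < N)%N -> Dk k (xi u k w).
Proof. by move=> au kN; rewrite /Dk /= /xi col_mxKd; exact: (au k kN).1. Qed.

(** Induction in time: the coefficients act on the pair (state, control) at time k, and the noise
    takes the result to time k + 1. *)
Lemma lipV_state u k : adm u -> (k <= N)%N -> lipV k (st u k).
Proof.
move=> au; elim: k => [|k IH] kN i; first exact: lipL_cst.
have Lxi : lipV k (xi u k) by apply: lipV_col_mx; [exact: IH (ltnW kN)|exact: adm_lipV].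
have kN' := ltnW kN.
under eq_fun do rewrite stateS; apply: lipLD => //.
  apply: (@lipL_mono _ _ _ _ _ _ _ _ k) => //.
  have := smooth_coef_comp (isT : (0 < 2)%N) (erefl : (2 + 0)%N = 2%N) kN'
    (fun z h t => @Dk_segment k z h t kN) (smooth_b i kN) Lxi (fun w => xi_D w au kN).
  by under eq_fun do rewrite /xi col_mxKu col_mxKd.
apply: lipL_sum => // l; apply: (lipL_noise Theta_inh F_A2 W_A3 W_Lc2) => //.
have := smooth_coef_comp (isT : (0 < 2)%N) (erefl : (2 + 0)%N = 2%N) kN'
  (fun z h t => @Dk_segment k z h t kN) (smooth_sigma l i kN) Lxi (fun w => xi_D w au kN).
by under eq_fun do rewrite /xi col_mxKu col_mxKd.
Qed.

Lemma lipV_xi u k : adm u -> (k < N)%N -> lipV k (xi u k).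
Proof.
by move=> au kN; apply: lipV_col_mx; [exact: lipV_state (ltnW kN)|exact: adm_lipV].
Qed.

Lemma lipL_cost u : adm u -> lipL 1 N (cst u).
Proof.
move=> au; apply: lipLD => //.
  apply: lipL_sum => // -[k kN] /=.
  apply: (@lipL_mono _ _ _ _ _ _ _ _ k); [exact: ltnW|by []|].
  have := smooth_coef_comp (isT : (0 < 1)%N) (erefl : (1 + 1)%N = 2%N) (ltnW kN)
    (fun z h t => @Dk_segment k z h t kN) (smooth_f kN) (lipV_xi au kN)
    (fun w => xi_D w au kN).
  by under eq_fun do rewrite /xi col_mxKu col_mxKd.
exact: (smooth_coef_comp (isT : (0 < 1)%N) (erefl : (1 + 1)%N = 2%N) (leqnn N) _
  smooth_varphi (lipV_state au (leqnn N))).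
Qed.

Lemma adm_conv u v (t : R) : adm u -> adm v -> 0 <= t <= 1 ->
  adm (fun k w => v k w + t *: (u k w - v k w)).
Proof.
move=> au av t01 k kN; split.
  move=> w; apply: control_segment => //; first exact: (av k kN).1.
  by rewrite addrC subrK; exact: (au k kN).1.
move=> i; have kN' := ltnW kN.
rewrite (_ : (fun w => _) = fun w => t * (u k w i 0) + ((1 - t) * (v k w i 0) + 0)).
  apply: Lc_lin => //; first exact: (au k kN).2.
  rewrite (_ : (fun w => _) = fun w => - t * (v k w i 0) + v k w i 0).
    by apply: Lc_lin => //; exact: (av k kN).2.
  by apply/funext => w; ring.
by apply/funext => w; rewrite !mxE; ring.
Qed.

(** * First variation of the state and of the cost *)

Section Variation.
Variables (ustar u : nat -> Omega -> 'cV[R]_m).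
Hypotheses (aus : adm ustar) (au : adm u).

Let ut (t : R) k w := ustar k w + t *: (u k w - ustar k w).
(** Difference quotient of the pair (state, control); its lower block is free of t because the
    perturbed control is affine in t. *)
Let V k (t : R) w : 'cV[R]_(n + m) :=
  col_mx (t^-1 *: (st (ut t) k w - st ustar k w)) (u k w - ustar k w).
Let H k w : 'cV[R]_(n + m) := col_mx (vst ustar u k w) (u k w - ustar k w).

Let aut (t : R) : 0 < t <= 1 -> adm (ut t).
Proof. by move=> /andP[t0 t1]; apply: adm_conv => //; rewrite (ltW t0). Qed.

Let xiV k t w : t != 0 -> xi ustar k w + t *: V k t w = xi (ut t) k w.
Proof.
move=> t0; rewrite /xi /V scale_col_mx add_col_mx scalerA mulfV// scale1r.
by rewrite addrC subrK.
Qed.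

(** [tends] is transported along equalities of functions of t, so t = 0 is included; there the
    convention that 0 has inverse 0 makes both sides vanish. *)
Let quotE k t w (g : 'cV[R]_(n + m) -> R) :
  t^-1 * (g (xi ustar k w + t *: V k t w) - g (xi ustar k w)) =
  t^-1 * (g (xi (ut t) k w) - g (xi ustar k w)).
Proof. by have [->|t0] := eqVneq t 0; [rewrite invr0 !mul0r|rewrite xiV]. Qed.

Let DH k w : (k < N)%N -> Dk k (xi ustar k w + H k w).
Proof.
move=> kN; rewrite /Dk /= /xi /H add_col_mx col_mxKd addrC subrK.
exact: (au kN).1.
Qed.

Let DV k t w : (k < N)%N -> 0 < t <= 1 -> Dk k (xi ustar k w + t *: V k t w).
Proof.
move=> kN t01; rewrite xiV; last by case/andP: t01 => /gt_eqF ->.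
exact: xi_D (aut t01) kN.
Qed.

Let tendsV_V k : (k < N)%N ->
  tendsV k (fun t w => t^-1 *: (st (ut t) k w - st ustar k w)) (vst ustar u k) ->
  tendsV k (V k) (H k).
Proof.
move=> kN IH; apply: tendsV_col_mx => // i; apply: tends_cst => //.
under eq_fun do rewrite !mxE.
by have kN' := ltnW kN; apply: lipLB => //; exact: adm_lipV.
Qed.

Let along_mulmx T k w (D : nat -> 'cV[R]_n -> 'cV[R]_m -> Omega -> 'M[R]_(T, n + m)) :
  lsubmx (along W x0 b sigma ustar D k w) *m vst ustar u k w +
  rsubmx (along W x0 b sigma ustar D k w) *m (u k w - ustar k w) =
  D k (usubmx (xi ustar k w)) (dsubmx (xi ustar k w)) w *m H k w.
Proof.
rewrite /xi col_mxKu col_mxKd /along /H.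
by rewrite -[in RHS](hsubmxK (D _ _ _ _)) mul_row_col.
Qed.

Lemma var_stateS k w i : vst ustar u k.+1 w i 0 =
  (lsubmx (along W x0 b sigma ustar Db k w) *m vst ustar u k w +
   rsubmx (along W x0 b sigma ustar Db k w) *m (u k w - ustar k w)) i 0 +
  \sum_(l < d) (lsubmx (along W x0 b sigma ustar (Dsigma ^~ l) k w) *m vst ustar u k w +
   rsubmx (along W x0 b sigma ustar (Dsigma ^~ l) k w) *m (u k w - ustar k w)) i 0 *
   W k.+1 w l 0.
Proof.
rewrite [in LHS]/= [LHS]mxE [X in _ + X = _]summxE; congr (_ + _).
by apply: eq_bigr => l _; rewrite [LHS]mxE mulrC.
Qed.

(** Induction in time. The direction [V] depends on t, which is why [derivative_mean_cvg] allows
    directions that merely converge in square mean. *)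
Lemma tends_state k : (k <= N)%N ->
  tendsV k (fun t w => t^-1 *: (st (ut t) k w - st ustar k w)) (vst ustar u k).
Proof.
elim: k => [|k IH] kN i.
  rewrite (_ : (fun t w => _) = fun=> fun=> 0); last first.
    by apply/funext => t; apply/funext => w; rewrite subrr scaler0 mxE.
  rewrite (_ : (fun w => _) = fun=> 0); last by apply/funext => w; rewrite mxE.
  by apply: tends_cst => //; exact: lipL_cst.
have kN' := ltnW kN; have VH := tendsV_V kN (IH kN').
have Lxi := lipV_xi aus kN.
pose gb z w := b k (usubmx z) (dsubmx z) w i 0.
pose gs l z w := sigma k l (usubmx z) (dsubmx z) w i 0.
have tb := smooth_coef_tends (isT : (0 < 2)%N) (erefl : (2 + 0)%N = 2%N) kN'
  (fun z h t => @Dk_segment k z h t kN) (smooth_b i kN) Lxi (fun w => xi_D w aus kN)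
  (fun w => DH w kN) (fun t t01 w => DV w kN t01) VH.
have ts l := smooth_coef_tends (isT : (0 < 2)%N) (erefl : (2 + 0)%N = 2%N) kN'
  (fun z h t => @Dk_segment k z h t kN) (smooth_sigma l i kN) Lxi (fun w => xi_D w aus kN)
  (fun w => DH w kN) (fun t t01 w => DV w kN t01) VH.
have := tendsD kN (tends_mono (leqnSn k) kN tb) (tends_sum (index_enum 'I_d)
  (isT : (0 < 2)%N) kN (fun l => tends_noise Theta_inh F_A2 W_A3 W_Lc2 l kN (ts l))).
congr tends.
  apply/funext => t; apply/funext => w; rewrite [RHS]scale_sub_entry.
  rewrite !stateS [X in _ = _ * X]opprD_addrACA [RHS]mulrDr; congr (_ + _).
    rewrite [LHS](quotE k t w (fun z => b k (usubmx z) (dsubmx z) w i 0)).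
    by rewrite /xi !col_mxKu !col_mxKd.
  rewrite -sumrB mulr_sumr; apply: eq_bigr => l _.
  rewrite [X in X * _](quotE k t w (fun z => sigma k l (usubmx z) (dsubmx z) w i 0)).
  by rewrite /xi !col_mxKu !col_mxKd -mulrBl mulrA.
apply/funext => w; rewrite [RHS]var_stateS; congr (_ + _).
  by rewrite along_mulmx -row_mul mxE.
by apply: eq_bigr => l _; rewrite (along_mulmx k w (Dsigma ^~ l)) -row_mul [X in X * _]mxE.
Qed.

Lemma tends_cost : tends 1 N (fun t w => t^-1 * (cst (ut t) w - cst ustar w))
  (vcost ustar u).
Proof.
have tf (k : 'I_N) := tends_mono (ltnW (ltn_ord k)) (leqnn N)
  (smooth_coef_tends (isT : (0 < 1)%N) (erefl : (1 + 1)%N = 2%N) (ltnW (ltn_ord k))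
    (fun z h t => @Dk_segment k z h t (ltn_ord k)) (smooth_f (ltn_ord k))
    (lipV_xi aus (ltn_ord k)) (fun w => xi_D w aus (ltn_ord k))
    (fun w => DH w (ltn_ord k)) (fun t t01 w => DV w (ltn_ord k) t01)
    (tendsV_V (ltn_ord k) (tends_state (ltnW (ltn_ord k))))).
have tphi := smooth_coef_tends (isT : (0 < 1)%N) (erefl : (1 + 1)%N = 2%N) (leqnn N)
  (fun z h t _ _ _ => I) smooth_varphi (lipV_state aus (leqnn N)) (fun=> I) (fun=> I)
  (fun t _ w => I) (tends_state (leqnn N)).
have := tendsD (leqnn N)
  (tends_sum (index_enum 'I_N) (isT : (0 < 1)%N) (leqnn N) tf) tphi.
congr tends.
  apply/funext => t; apply/funext => w; rewrite /cost [X in _ = _ * X]opprD_addrACA [RHS]mulrDr.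
  congr (_ + _).
    rewrite -sumrB mulr_sumr; apply: eq_bigr => k _.
    rewrite [LHS](quotE k t w (fun z => f k (usubmx z) (dsubmx z) w)).
    by rewrite /xi !col_mxKu !col_mxKd.
  have [->|t0] := eqVneq t 0; first by rewrite invr0 !mul0r.
  by rewrite scalerA mulfV// scale1r [st ustar N w + _]addrC subrK.
apply/funext => w; rewrite /var_cost; congr (_ + _).
by apply: eq_bigr => k _; rewrite along_mulmx.
Qed.

End Variation.

Section Affine.
Variables (ustar u u' : nat -> Omega -> 'cV[R]_m) (a : R).

Let ua k w := u' k w + a *: (u k w - u' k w).

(** The offset s does no harm, because the weights 1 - a and a add up to 1. *)
Let block_affine p (A : 'M[R]_(p, n)) (B : 'M[R]_(p, m)) (x x' : 'cV[R]_n)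
    (v v' s : 'cV[R]_m) :
  A *m (x' + a *: (x - x')) + B *m (v' + a *: (v - v') - s) =
  A *m x' + B *m (v' - s) + a *: (A *m x + B *m (v - s) - (A *m x' + B *m (v' - s))).
Proof.
rewrite !(mulmxDr, mulmxBr) -!scalemxAr !mulmxBr.
move: (A *m x) (A *m x') (B *m v) (B *m v') (B *m s) => y1 y2 y3 y4 y5.
by apply/matrixP => i j; rewrite !mxE; ring.
Qed.

Lemma var_state_affine k w :
  vst ustar ua k w = vst ustar u' k w + a *: (vst ustar u k w - vst ustar u' k w).
Proof.
elim: k => [|k IH]; first by rewrite /= subrr scaler0 addr0.
rewrite /= IH block_affine.
under eq_bigr do rewrite block_affine scalerDr.
rewrite big_split/= [_ - (_ + _) in RHS]opprD_addrACA [in RHS]scalerDr -sumrB scaler_sumr addrACA.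
congr (_ + _ + (_ + _)).
by apply: eq_bigr => l _; rewrite -scalerBr !scalerA mulrC.
Qed.

Lemma var_cost_affine w :
  vcost ustar ua w = vcost ustar u' w + a * (vcost ustar u w - vcost ustar u' w).
Proof.
rewrite /var_cost [in RHS]opprD_addrACA mulrDr -sumrB mulr_sumr addrACA -big_split/=.
congr (_ + _).
  by apply: eq_bigr => k _; rewrite var_state_affine block_affine [LHS]mxE scale_sub_entry.
rewrite var_state_affine mulmxDr -scalemxAr mulmxBr [LHS]mxE; congr (_ + _).
by rewrite scale_sub_entry.
Qed.

End Affine.

(** * Optimality and the stationary measure *)

Section Optimality.
Variable ustar : nat -> Omega -> 'cV[R]_m.
Hypothesis opt : optimal W F N U x0 b sigma f varphi ustar.

Local Notation upperE := (upperE W F N).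
Let Y := cst ustar.
Let aus : adm ustar := opt.1.
Let LY : lipL 1 N Y := lipL_cost aus.
Let LT u (au : adm u) : lipL 1 N (vcost ustar u).
Proof. by have [_ LT _] := tends_cost aus au. Qed.
Let LYT u tau (au : adm u) : lipL 1 N (fun w => Y w + tau * vcost ustar u w).
Proof. by apply: lipLD => //; apply: lipLZ => //; exact: LT. Qed.

Lemma optimal_upperE u : adm u -> upperE Y <= upperE (cst u).
Proof.
move=> au; have := opt.2 u au.
by rewrite /J !(Ehat_upperE neP) ?lee_fin//; exact: lipL_cost.
Qed.

(* [tau |-> upperE (Y + tau * vcost u)] is convex, so that the inequality for a
   small [tau], where [cost u^tau] is close to [Y + tau * vcost u], gives it for
   every [tau]. *)
Lemma upperE_variation u tau : adm u -> 0 <= tau ->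
  upperE Y <= upperE (fun w => Y w + tau * vcost ustar u w).
Proof.
move=> au; rewrite le_eqVlt => /predU1P[<-|tau0].
  by rewrite (_ : (fun w => _) = Y)//; apply/funext => w; rewrite mul0r addr0.
set Z := fun w => _ : R; have LZ : lipL 1 N Z by exact: LYT.
apply/ler_addgt0Pr => e e0.
(* With accuracy e / tau the total error is e times the weight t / tau given to Z below, so that
   this weight can be divided out. *)
have [_ _ /(_ (e / tau) (divr_gt0 e0 tau0))[del del0 hdel]] := tends_cost aus au.
(* t < del serves the approximation, t <= 1 admissibility, and t <= tau the convex combination. *)
pose t := Num.min (Num.min (del / 2) 1) tau.
have t0 : 0 < t by rewrite !lt_min divr_gt0//= ltr01 tau0.
have tdel : t < del by rewrite !gt_min ltr_pdivrMr// ltr_pMr// ltr1n.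
have t1 : t <= 1 by rewrite !ge_min lexx orbT.
have ttau : t <= tau by rewrite ge_min lexx orbT.
pose ut k w := ustar k w + t *: (u k w - ustar k w).
have aut : adm ut by apply: adm_conv => //; rewrite (ltW t0).
have Lt : lipL 1 N (cst ut) := lipL_cost aut.
have close : mean_le W F N
      (fun w => `|cst ut w - (Y w + t * vcost ustar u w)| ^+ 1) (t * (e / tau)).
  have := hdel t; rewrite t0 => /(_ tdel) h.
  apply: mean_le_dom h; [| |exact: ltW|].
  - apply: measurable_normX; exact: (lipLB (leqnn N) Lt (LYT t au)).1.
  - apply: measurable_normX.
    by have := lipLB (leqnn N) (lipLZ (leqnn N) t^-1 (isT : (0 < 1)%N)
      (lipLB (leqnn N) Lt LY)) (LT au) => -[].
  move=> w; rewrite !expr1 !normr_id.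
  rewrite -[leRHS](_ : `|t * (t^-1 * (cst ut w - cst ustar w) - vcost ustar u w)| = _).
    by rewrite mulrBr mulrA mulfV ?gt_eqF// mul1r opprD addrA.
  by rewrite normrM gtr0_norm.
have := upperE_dist neP Lt (LYT t au) close.
move=> /(le_trans (optimal_upperE aut)).
(* Y + t Theta^u lies on the segment from Y to Z, at parameter t / tau. *)
have -> : (fun w => Y w + t * vcost ustar u w) =
    (fun w => (1 - t / tau) * Y w + (t / tau) * Z w).
  by apply/funext => w; rewrite /Z; field; rewrite gt_eqF.
have s0 : 0 < t / tau by rewrite divr_gt0.
have s1 : t / tau <= 1 by rewrite ler_pdivrMr// mul1r.
have s1' : 0 <= 1 - t / tau by rewrite subr_ge0.
have L1 := lipLZ (leqnn N) (1 - t / tau) (isT : (0 < 1)%N) LY.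
have L2 := lipLZ (leqnn N) (t / tau) (isT : (0 < 1)%N) LZ.
have := upperED neP L1 L2; rewrite !(upperEZ neP)//; last exact: ltW.
have -> : t * (e / tau) = (t / tau) * e by ring.
move=> h1 h2; rewrite -(ler_pM2l s0) mulrDr.
by move: h1 h2; rewrite mulrBl mul1r; lra.
Qed.

(** Covers the constraints with s = 0, which cannot be reduced to [upperE_variation] by dividing by
    s. *)
Lemma vcost_upperE_ge0 u : adm u -> 0 <= upperE (vcost ustar u).
Proof.
move=> au; have := upperE_variation au ler01; under eq_fun do rewrite mul1r.
by move=> /le_trans/(_ (upperED neP LY (LT au))); rewrite lerDl.
Qed.

Lemma stationary_measure : exists2 P : probability (OmegaF W N) R, calP W F N P &
  (\int[P]_w Y w)%R = upperE Y /\
  forall u, adm u -> 0 <= (\int[P]_w vcost ustar u w)%R.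
Proof.
pose C (c : Omega -> R) (r : R) := exists (s tau : R) u, [/\ 0 <= s, 0 <= tau, adm u,
  c = (fun w => s * Y w + tau * vcost ustar u w) & r = s * upperE Y].
have CE c r : C c r -> lipL 1 N c /\ r <= upperE c.
  move=> [s [tau [u [s0 tau0 au -> ->]]]]; split.
    by apply: lipLD => //; apply: lipLZ => //; exact: LT.
  move: s0; rewrite le_eqVlt => /predU1P[<-|s0].
    under eq_fun do rewrite mul0r add0r.
    by rewrite mul0r (upperEZ neP (LT au))// mulr_ge0// vcost_upperE_ge0.
  rewrite (_ : (fun w => _) = fun w => s * (Y w + tau / s * vcost ustar u w)).
    rewrite (upperEZ neP (LYT _ au)) ?(ltW s0)// ler_pM2l//.
    by apply: upperE_variation => //; rewrite divr_ge0// ltW.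
  by apply/funext => w; field; rewrite gt_eqF.
have C0 : C 0 0.
  exists 0, 0, ustar; split=> //; last by rewrite mul0r.
  by apply/funext => w; rewrite !mul0r addr0.
have CD c r c' r' : C c r -> C c' r' -> C (c + c') (r + r').
  move=> [s [tau [u [s0 tau0 au -> ->]]]] [s' [tau' [u' [s'0 tau'0 au' -> ->]]]].
  (* When both weights vanish the controls have no average; any admissible control serves. *)
  have [tt0|tt0] := eqVneq (tau + tau') 0.
    have taus : tau = 0 /\ tau' = 0 by split; lra.
    exists (s + s'), 0, ustar; split; rewrite ?addr_ge0//; last by rewrite mulrDl.
    by apply/funext => w; rewrite taus.1 taus.2 !fctE; ring.
  have ttp : 0 < tau + tau' by rewrite lt_neqAle eq_sym tt0 addr_ge0.
  (* Barycentre of u and u' with weights tau and tau': by affinity, tau Theta^u + tau' Theta^u' is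
     tau + tau' times its variation. *)
  exists (s + s'), (tau + tau'),
    (fun k w => u' k w + (tau / (tau + tau')) *: (u k w - u' k w)).
  split; rewrite ?addr_ge0//; last by rewrite mulrDl.
    apply: adm_conv => //; rewrite divr_ge0 ?(ltW ttp)//=.
    by rewrite ler_pdivrMr// mul1r lerDl.
  by apply/funext => w; rewrite var_cost_affine !fctE; field.
have CZ a c r : 0 <= a -> C c r -> C (a *: c) (a * r).
  move=> a0 [s [tau [u [s0 tau0 au -> ->]]]]; exists (a * s), (a * tau), u.
  split; rewrite ?mulr_ge0// ?mulrA//.
  by apply/funext => w; rewrite fctE/= /GRing.scale/=; ring.
have [l [llin lE lC]] := hahn_banach_cone
  (lipL_linear_set W F (isT : (0 < 1)%N) (leqnn N)) (upperE_sublinear neP) CE C0 CD CZ.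
have [P PP Pl] := represent_upperE Theta_inh F_A2 W_A3 llin lE.
exists P => //; split=> [|u au].
  rewrite Pl//; apply/eqP; rewrite eq_le lE//=; apply: lC.
  exists 1, 0, ustar; split; rewrite ?mul1r//.
  by apply/funext => w; rewrite mul1r mul0r addr0.
rewrite Pl; last exact: LT.
apply: lC; exists 0, 1, u; split; rewrite ?mul0r//.
by apply/funext => w; rewrite mul0r mul1r add0r.
Qed.

Lemma optimal_stationary : exists P : probability (OmegaF W N) R,
  calPstar W F N x0 b sigma f varphi ustar P /\
  (0 <= ereal_inf [set 'E_P[(vcost ustar u : OmegaF W N -> R)] | u in adm])%E.
Proof.
have [P PP [PY PT]] := stationary_measure; exists P; split.
  by split=> //; rewrite (expectation_Rintegral PP LY) (Ehat_upperE neP LY) PY.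
apply: le_ereal_inf_tmp => _ [u au <-].
by rewrite (expectation_Rintegral PP (LT au)) lee_fin PT.
Qed.

End Optimality.

End ControlProblem.

Theorem theorem4p4 (R : realType) (Omega : pointedType) (Theta : Type)
    (N d n m : nat)
    (W : nat -> Omega -> 'cV[R]_d) (F : Theta -> probability (borelM R d 1) R)
    (U : nat -> set 'cV[R]_m) (x0 : 'cV[R]_n)
    (b : nat -> 'cV[R]_n -> 'cV[R]_m -> Omega -> 'cV[R]_n)
    (sigma : nat -> 'I_d -> 'cV[R]_n -> 'cV[R]_m -> Omega -> 'cV[R]_n)
    (f : nat -> 'cV[R]_n -> 'cV[R]_m -> Omega -> R)
    (varphi : 'cV[R]_n -> Omega -> R)
    (Db : nat -> 'cV[R]_n -> 'cV[R]_m -> Omega -> 'M[R]_(n, n + m))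
    (Dsigma : nat -> 'I_d -> 'cV[R]_n -> 'cV[R]_m -> Omega -> 'M[R]_(n, n + m))
    (Df : nat -> 'cV[R]_n -> 'cV[R]_m -> Omega -> 'rV[R]_(n + m))
    (Dvarphi : 'cV[R]_n -> Omega -> 'rV[R]_n)
    (ustar : nat -> Omega -> 'cV[R]_m) :
  (0 < N)%N -> (0 < d)%N -> inhabited Theta ->
  A1 W F N -> A2 F -> A3 W F N -> noise_Lc2 W F N ->
  control_sets N U ->
  coef_derivatives N U b sigma f varphi Db Dsigma Df Dvarphi ->
  H1 W F N U b sigma f varphi ->
  H2 N U Db Dsigma Df Dvarphi ->
  H3 N U Db Dsigma Df Dvarphi ->
  optimal W F N U x0 b sigma f varphi ustar ->
  exists Pstar : probability (OmegaF W N) R,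
    calPstar W F N x0 b sigma f varphi ustar Pstar /\
    (0 <= ereal_inf
      [set 'E_Pstar[(var_cost W N x0 b sigma Db Dsigma Df Dvarphi ustar u
                      : OmegaF W N -> R)]
      | u in admissible W F N U])%E.
Proof.
move=> N_gt0 d_gt0 Theta_inh _ F_A2 W_A3 W_Lc2 U_ok derivs hyp1 hyp2 hyp3 opt.
exact: (optimal_stationary N_gt0 d_gt0 Theta_inh F_A2 W_A3 W_Lc2 U_ok derivs hyp1 hyp2 hyp3 opt).
Qed.
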